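(* Let $\omega_0=\log_{n_0}p_0$ be the exponent of a Strassen-like algorithm with parameters $n_0,p_0$, with $m\geq n_0$. All pairs shortest distances of an $n$-vertex unweighted undirected graph can be computed in the $(m,\ell)$-TCU model in time $$T(n)=O\!\left(\left(\frac{n^2}{m}\right)^{\omega_0}(m+\ell)\log n\right).$$
   Context: The $(m,\ell)$-TCU model (parameters $m\ge 1$, $\ell\ge 0$) is the standard RAM model whose CPU additionally contains a tensor unit: by a constant-size instruction specifying the memory addresses of the operands and of the output, the unit multiplies an $N\times\sqrt{m}$ matrix by a $\sqrt{m}\times\sqrt{m}$ matrix (where $N\geq\sqrt{m}$ is chosen by the algorithm) and writes the product to memory, at a cost of $O(N\sqrt{m}+\ell)$ time. The running time of an algorithm is the total cost of all operations performed, including all calls to the tensor unit. A Strassen-like algorithm with parameters $n_0,p_0$ (with $n_0=O(p_0)$) is a recursive matrix multiplication algorithm built from a base algorithm that multiplies two $\sqrt{n_0}\times\sqrt{n_0}$ matrices using $p_0$ element multiplications and $O(n_0)$ other operations: to multiply two $\sqrt{N}\times\sqrt{N}$ matrices with $N>n_0$, it views each as a $\sqrt{n_0}\times\sqrt{n_0}$ matrix of $\sqrt{N/n_0}\times\sqrt{N/n_0}$ blocks, recursively performs the $p_0$ block multiplications, and performs $O(N)$ other operations.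
   Formalization: Restricted to tensor units no larger than the matrices, m ≤ n² (and to n ≥ 2, as log 1 = 0): for fixed n, ℓ = 0 and m → ∞ the stated bound tends to 0 because ω₀ > 1, while every algorithm takes at least one step. *)

(* Defs.v *)
From HB Require Import structures.
From mathcomp Require Import all_boot all_order all_algebra.
From mathcomp Require Import reals exp.

Set Implicit Arguments.
Unset Strict Implicit.
Unset Printing Implicit Defensive.

Import Order.TTheory GRing.Theory Num.Theory.
Local Open Scope ring_scope.

(* A base algorithm is a straight-line program over a growing list of values:
   the i-th value is an entry of one of the operands or the result of an
   earlier operation (an out-of-range index denotes 0). *)
Inductive base_op :=
  | BAdd of nat & nat
  | BSub of nat & nat
  | BScale of rat & nat
  | BMul of nat & nat.

Definition is_mul (o : base_op) : bool := if o is BMul _ _ then true else false.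

Record base_algorithm (q : nat) := BaseAlgorithm {
  base_ops : seq base_op;
  base_out : 'I_q -> 'I_q -> nat  (* index of the value of each output entry *)
}.

Definition base_op_val (A : algType rat) (vs : seq A) (o : base_op) : A :=
  match o with
  | BAdd i j => vs`_i + vs`_j
  | BSub i j => vs`_i - vs`_j
  | BScale a i => a *: vs`_i
  | BMul i j => vs`_i * vs`_j
  end.

Definition base_input (A : algType rat) (q : nat) (X Y : 'M[A]_q) : seq A :=
  [seq X i j | i <- enum 'I_q, j <- enum 'I_q] ++
  [seq Y i j | i <- enum 'I_q, j <- enum 'I_q].

Definition base_run (A : algType rat) (ops : seq base_op) (vs : seq A) : seq A :=
  foldl (fun us o => rcons us (base_op_val us o)) vs ops.

Definition base_result (A : algType rat) (q : nat) (B : base_algorithm q)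
    (X Y : 'M[A]_q) : 'M[A]_q :=
  \matrix_(i, k) (base_run (base_ops B) (base_input X Y))`_(base_out B i k).

(* Correctness is required over all, possibly noncommutative, algebras: in the
   recursion the values are blocks and a BMul is a recursive call, so this is
   what makes the recursive algorithm generated by B well defined. The number
   kappa is the constant of the two O's, in "O(n0) other operations" and in
   n0 = O(p0). *)
Definition strassen_like (kappa n0 p0 q : nat) (B : base_algorithm q) : Prop :=
  [/\ (n0 = q ^ 2)%N,
      forall (A : algType rat) (X Y : 'M[A]_q), base_result B X Y = X *m Y,
      count is_mul (base_ops B) = p0,
      (count (predC is_mul) (base_ops B) <= kappa * n0)%N
    & (n0 <= kappa * p0)%N].

Definition strassen_exponent (R : realType) (n0 p0 : nat) : R :=
  ln p0%:R / ln n0%:R.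

(* A word RAM with registers and a random-access memory, both indexed by nat;
   a program only names finitely many registers. Arguments of type nat are
   register names, except jump targets, which are positions in the program. *)
Inductive instr :=
  | IConst of nat & int
  | IAdd of nat & nat & nat
  | ISub of nat & nat & nat
  | IMul of nat & nat & nat
  | IDiv of nat & nat & nat
  | ILoad of nat & nat
  | IStore of nat & nat
  | IJump of nat
  | IJumpPos of nat & nat
  | ITensor of nat & nat & nat & nat
      (* ITensor a b c k: with N = r_k, multiply the N x sqrt m matrix at
         address r_a by the sqrt m x sqrt m matrix at address r_b and write
         the product at address r_c; all matrices are stored by rows. *)
  | IHalt.

Definition program := seq instr.

Record config := Config { pc : nat; regs : nat -> int; memory : nat -> int }.

Definition upd (f : nat -> int) (x : nat) (v : int) : nat -> int :=
  fun y => if y == x then v else f y.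

(* W is the word length; s stands for sqrt m. *)
Definition fits (W : nat) (v : int) : bool := (`|v| < 2 ^ W)%N.

Definition fetch (P : program) (c : config) : instr := nth IHalt P (pc c).

Definition set_reg (W : nat) (c : config) (d : nat) (v : int) : option config :=
  if fits W v then Some (Config (pc c).+1 (upd (regs c) d v) (memory c)) else None.

Definition tensor_entry (s : nat) (M : nat -> int) (a b x : nat) : int :=
  \sum_(k < s) M (a + (x %/ s) * s + k)%N * M (b + k * s + x %% s)%N.

Definition tensor_write (s : nat) (M : nat -> int) (a b c N : nat) : nat -> int :=
  fun y => if (c <= y < c + N * s)%N then tensor_entry s M a b (y - c) else M y.

Definition tensor_unit (s W : nat) (c : config) (ra rb rc rk : int) :
    option config :=
  match ra, rb, rc, rk with
  | Posz a, Posz b, Posz d, Posz N =>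
      if (s <= N)%N &&
         [forall x : 'I_(N * s), fits W (tensor_entry s (memory c) a b x)]
      then Some (Config (pc c).+1 (regs c) (tensor_write s (memory c) a b d N))
      else None
  | _, _, _, _ => None
  end.

(* None: the machine has halted or is stuck (overflow, negative address, or a
   tensor operand with fewer than sqrt m rows). *)
Definition step (s W : nat) (P : program) (c : config) : option config :=
  let r := regs c in
  match fetch P c with
  | IConst d z => set_reg W c d z
  | IAdd d a b => set_reg W c d (r a + r b)
  | ISub d a b => set_reg W c d (r a - r b)
  | IMul d a b => set_reg W c d (r a * r b)
  | IDiv d a b => set_reg W c d (r a %/ r b)%Z
  | ILoad d a => if r a is Posz x then set_reg W c d (memory c x) else None
  | IStore a b => if r a is Posz x
                  then Some (Config (pc c).+1 r (upd (memory c) x (r b))) else None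
  | IJump t => Some (Config t r (memory c))
  | IJumpPos a t => Some (Config (if 0 < r a then t else (pc c).+1) r (memory c))
  | ITensor a b d k => tensor_unit s W c (r a) (r b) (r d) (r k)
  | IHalt => None
  end.

(* The unit of time is scaled so that the constant in the O(N sqrt m + l) cost
   of a tensor instruction is 1. *)
Definition cost (R : realType) (s : nat) (ell : R) (P : program) (c : config) : R :=
  if fetch P c is ITensor _ _ _ k then (`|regs c k| * s)%N%:R + ell else 1.

(* runs s W ell P c T c': from c, P halts in c' without getting stuck, and the
   total cost of the operations performed is T. *)
Inductive runs (R : realType) (s W : nat) (ell : R) (P : program) :
    config -> R -> config -> Prop :=
  | runs_halt c : fetch P c = IHalt -> runs s W ell P c 1 c
  | runs_step c c1 c2 T :
      step s W P c = Some c1 -> runs s W ell P c1 T c2 ->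
      runs s W ell P c (cost s ell P c + T) c2.

Definition simple_graph (n : nat) (e : rel 'I_n) : Prop :=
  symmetric e /\ irreflexive e.

Definition is_distance (n : nat) (e : rel 'I_n) (x y : 'I_n) (d : nat) : Prop :=
  (exists p, [/\ path e x p, last x p = y & size p = d]) /\
  (forall p, path e x p -> last x p = y -> (d <= size p)%N).

(* The word -1 encodes an infinite distance. *)
Definition is_distance_word (n : nat) (e : rel 'I_n) (x y : 'I_n) (v : int) : Prop :=
  if connect e x y then exists2 d : nat, is_distance e x y d & v = d%:Z
  else v = -1.

(* r_0 = n, r_1 = sqrt m, and the adjacency matrix is stored by rows from
   address 0; every other register or memory cell holds 0. *)
Definition adjacency_memory (n : nat) (e : rel 'I_n) (y : nat) : int :=
  \sum_(i < n) \sum_(j < n | (i * n + j == y)%N) (e i j)%:Z.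

Definition initial_config (s n : nat) (e : rel 'I_n) : config :=
  Config 0 (upd (upd (fun=> 0) 0 n%:Z) 1 s%:Z) (adjacency_memory e).

Definition distance_memory (n : nat) (e : rel 'I_n) (M : nat -> int) : Prop :=
  forall i j : 'I_n, is_distance_word e i j (M (i * n + j)%N).

(* Main.v *)
Require Import Defs.
From mathcomp Require Import all_boot all_order all_algebra.
From mathcomp Require Import reals exp.
From mathcomp Require Import zify ring lra.

(** The base algorithm is reduced to a bilinear one: over strictly upper triangular
    3 x 3 matrices its run writes every entry of the product as a combination of
    p0 products of a linear form in X and a linear form in Y, and clearing
    denominators makes all coefficients integers, at the price of a factor D.
    Since matrix multiplication has rank greater than q ^ 2, p0 > n0, so that the
    costs of the levels of the recursion form a geometric series dominated by the
    p0 ^ L products of sqrt m x sqrt m matrices done by the tensor unit. On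
    matrices stored recursively by blocks the recursion becomes iterative: L
    linear transforms of the whole array before the leaf products and L after
    them, which yields D ^ L times the product.

    The distances follow Seidel's scheme with reflexive reachability matrices
    R_k (distance at most 2 ^ k), which also covers disconnected graphs: R_(k+1)
    is the support of R_k ^ 2, and ceil(dist / 2 ^ k) is recovered from
    ceil(dist / 2 ^ (k+1)) by one sign test per pair, computed with two
    products. Only supports and signs of products are used, so the factor D ^ L
    is harmless. *)

Set Implicit Arguments.
Unset Strict Implicit.
Unset Printing Implicit Defensive.

Import Order.TTheory GRing.Theory Num.Theory.
Local Open Scope ring_scope.

(** * Base algorithms as bilinear algorithms *)

(** The program may depend on the base algorithm only, not on n, m or ell, and words have O(log n)
    bits; these two demands shape the development. The depth L is found at run time, as the least L
    with n <= q ^ L * s. Minimality gives n0 ^ (L - 1) * m <= n ^ 2 (for L = 0 this is the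
    hypothesis m <= n ^ 2), hence p0 ^ L <= p0 * (n ^ 2 / m) ^ omega_0, while a product costs O(p0 ^
    L * m) time and p0 ^ L tensor calls. The factor log n counts the products: one per squaring and
    two per refinement, over lam = ceil(log2 n) scales. Since L <= lam, a power c ^ L of a constant
    is polynomial in n; so the denominators that are never divided out and the growth of nested
    linear combinations still fit in O(log n) bits. A single bound U on all variables and cells,
    with words long enough for a fixed power of U, replaces overflow checks of single instructions.
    Time and tensor calls are counted separately in nat, because ell is an arbitrary nonnegative
    real. *)

Lemma allpairs_enum_ord (T : Type) (f : nat -> T) a b :
  [seq f (i * b + j)%N | i : 'I_a <- enum 'I_a, j : 'I_b <- enum 'I_b] =
  map f (iota 0 (a * b)).
Proof.
have -> : [seq f (i * b + j)%N | i : 'I_a <- enum 'I_a, j : 'I_b <- enum 'I_b] =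
          [seq f (i * b + j)%N | i <- iota 0 a, j <- iota 0 b].
  rewrite -(val_enum_ord a) -(val_enum_ord b).
  rewrite -map_comp; congr flatten; apply: eq_map => i /=.
  by rewrite -map_comp.
elim: a => [|a IHa] //.
rewrite -addn1 iotaD map_cat flatten_cat IHa mulnDl mul1n iotaD map_cat; congr cat.
by rewrite /= cats0 !add0n -[in RHS](addn0 (a * b)%N) iotaDl -map_comp.
Qed.

Definition linear_form (F : pzRingType) (k : nat) (a x : nat -> F) : F :=
  \sum_(c < k) a c * x c.

(* The strictly upper triangular 3 x 3 matrices form an algebra in which only
   the product of a linear form in x by a linear form in y survives. *)
Definition heis (a b c : rat) : 'M[rat]_3 :=
  a *: delta_mx 0 1 + b *: delta_mx 1 (inord 2) + c *: delta_mx 0 (inord 2).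

Lemma heisD a b c a' b' c' : heis a b c + heis a' b' c' = heis (a + a') (b + b') (c + c').
Proof. by apply/matrixP => i j; rewrite !mxE; ring. Qed.

Lemma heisZ k a b c : k *: heis a b c = heis (k * a) (k * b) (k * c).
Proof. by rewrite /heis !scalerDr !scalerA. Qed.

Lemma heisM a b c a' b' c' : heis a b c * heis a' b' c' = heis 0 0 (a * b').
Proof.
apply/matrixP => i j; rewrite /heis mxE.
have -> : (inord 2 : 'I_3) = Ordinal (isT : 2 < 3)%N by apply: val_inj; rewrite /= inordK.
rewrite !big_ord_recl big_ord0 !mxE.
by case: i => [[|[|[|//]]] ?]; case: j => [[|[|[|//]]] ?] /=;
   rewrite !(mulr0, mul0r, mulr1, addr0, add0r).
Qed.

Lemma heis_out a b c : heis a b c 0 (inord 2) = c.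
Proof.
rewrite !mxE; have -> : (inord 2 == 1 :> 'I_3) = false by rewrite -val_eqE /= inordK.
by rewrite !eqxx /= !mulr0 mulr1 !add0r.
Qed.

Section BilinearForm.
Variables (q : nat).
Let nn := (q * q)%N.
Local Notation lin := (linear_form nn).

Definition formal_input (x y : nat -> rat) : seq 'M[rat]_3 :=
  [seq heis (x c) 0 0 | c <- iota 0 nn] ++ [seq heis 0 (y c) 0 | c <- iota 0 nn].

Lemma lin_delta (i : nat) (x : nat -> rat) :
  lin (fun c => (c == i)%:R) x = if (i < nn)%N then x i else 0.
Proof.
rewrite /linear_form; case: ltnP => hi.
  rewrite (bigD1 (Ordinal hi)) //= eqxx mul1r big1 ?addr0 // => c.
  by rewrite -val_eqE /= => /negbTE ->; rewrite mul0r.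
rewrite big1 // => c _; case: eqP => [E|]; last by rewrite mul0r.
by move: (ltn_ord c); rewrite E ltnNge hi.
Qed.

Lemma nth_rconsE (T : Type) (x0 : T) s v i :
  nth x0 (rcons s v) i = if i == size s then v else nth x0 s i.
Proof.
rewrite nth_rcons; case: ltngtP => // h; last by rewrite nth_default // ltnW.
Qed.

(** Induction from the end of the program. Every value carries a linear form in [x], one in [y] and
    a combination of the products so far. Linear operations act on all three; [BMul] erases both
    linear parts and leaves one new product, the [x] form of its left operand times the [y] form of
    its right one. *)
Lemma base_run_forms (ops : seq base_op) :
  exists (u w al be ga : nat -> nat -> rat), forall x y i,
    (base_run ops (formal_input x y))`_i =
    heis (lin (al i) x) (lin (be i) y)
         (\sum_(t < count is_mul ops) ga i t * (lin (u t) x * lin (w t) y)).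
Proof.
elim/last_ind: ops => [|ops o [u [w [al [be [ga IH]]]]]].
  (* Subtraction is truncated: the guard [nn <= i] keeps the entries of [x] from acquiring a form in
     [y]. *)
  exists (fun _ _ => 0), (fun _ _ => 0), (fun i c => (c == i)%:R),
    (fun i c => (c == i - nn)%N%:R *+ (nn <= i)%N), (fun _ _ => 0) => x y i.
  rewrite /= big_ord0 lin_delta /formal_input nth_cat size_map size_iota.
  have linM0 (a : nat -> rat) z : lin (fun c => a c *+ 0) z = 0.
    by rewrite /linear_form big1 // => c _; rewrite mulr0n mul0r.
  case: ltnP => hi; first by rewrite linM0 (nth_map 0%N) ?size_iota // nth_iota.
  have linM1 (a : nat -> rat) z : lin (fun c => a c *+ true) z = lin a z by [].
  rewrite linM1 lin_delta; case: ltnP => hi2; first by rewrite (nth_map 0%N) ?size_iota // nth_iota.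
  by rewrite nth_default ?size_map ?size_iota // /heis !scale0r !addr0.
pose sz := (nn + nn + size ops)%N.
have hsz x y : size (base_run ops (formal_input x y)) = sz.
  have szE (s : seq base_op) (vs : seq 'M[rat]_3) :
      size (base_run s vs) = (size vs + size s)%N.
    by elim: s vs => [|o1 s IHs] vs /=; rewrite ?addn0 // IHs size_rcons addnS.
  by rewrite szE size_cat !size_map !size_iota.
have E x y i : (base_run (rcons ops o) (formal_input x y))`_i =
   if i == sz then base_op_val (base_run ops (formal_input x y)) o
   else (base_run ops (formal_input x y))`_i.
  by rewrite /base_run -cats1 foldl_cat /= nth_rconsE -/(base_run _ _) hsz.
set p := count is_mul ops in IH *.
have linD a b z : lin a z + lin b z = lin (fun c => a c + b c) z.
  by rewrite /linear_form -big_split; apply: eq_bigr => c _; rewrite mulrDl.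
have linB a b z : lin a z - lin b z = lin (fun c => a c - b c) z.
  by rewrite /linear_form -sumrB; apply: eq_bigr => c _; rewrite mulrBl.
have linZ k a z : k * lin a z = lin (fun c => k * a c) z.
  by rewrite /linear_form mulr_sumr; apply: eq_bigr => c _; rewrite mulrA.
have lin0 z : lin (fun=> 0) z = 0.
  by rewrite /linear_form big1 // => c _; rewrite mul0r.
pose put (f : nat -> nat -> rat) v i := if i == sz then v else f i.
have putE f v i z : lin (put f v i) z = if i == sz then lin v z else lin (f i) z.
  by rewrite /put; case: eqP.
(* Only one value is new: each operation amounts to coefficients [a], [b], [d] for it and a
   rewriting [c] of the old coefficients over the possibly longer list of products. *)
have ext (a b : nat -> rat) (c : nat -> nat -> rat) (d : nat -> rat) (u' w' : nat -> nat -> rat) :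
    (forall x y, base_op_val (base_run ops (formal_input x y)) o =
       heis (lin a x) (lin b y)
         (\sum_(t < count is_mul (rcons ops o)) d t * (lin (u' t) x * lin (w' t) y))) ->
    (forall x y i, \sum_(t < p) ga i t * (lin (u t) x * lin (w t) y) =
      \sum_(t < count is_mul (rcons ops o)) c i t * (lin (u' t) x * lin (w' t) y)) ->
  exists (u w al be ga : nat -> nat -> rat), forall x y i,
    (base_run (rcons ops o) (formal_input x y))`_i =
    heis (lin (al i) x) (lin (be i) y)
      (\sum_(t < count is_mul (rcons ops o)) ga i t * (lin (u t) x * lin (w t) y)).
  move=> hv hold; exists u', w', (put al a), (put be b), (put c d) => x y i.
  rewrite E !putE; case: eqP => hi.
    by rewrite hv; congr heis; apply: eq_bigr => t _; rewrite /put hi eqxx.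
  by rewrite IH hold; congr heis; apply: eq_bigr => t _; rewrite /put; move/eqP/negbTE: hi ->.
have sub1 (x y : rat) : x - y = x + (-1) * y by rewrite mulN1r.
have hcnt : count is_mul (rcons ops o) = (p + is_mul o)%N.
  by rewrite -cats1 count_cat /= addn0.
move: ext; rewrite hcnt; case: (o) => [i j|i j|k i|i j] /= ext; rewrite ?addn0 ?addn1 in ext *.
- apply: (ext (fun c => al i c + al j c) (fun c => be i c + be j c) ga
            (fun t => ga i t + ga j t) u w) => // x y.
  rewrite !IH heisD !linD; congr heis; rewrite -big_split.
  by apply: eq_bigr => t _; rewrite mulrDl.
- apply: (ext (fun c => al i c - al j c) (fun c => be i c - be j c) ga
            (fun t => ga i t - ga j t) u w) => // x y.
  rewrite !IH -[- heis _ _ _]scaleN1r heisZ heisD -!sub1 !linB; congr heis; rewrite -sumrB.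
  by apply: eq_bigr => t _; rewrite mulrBl.
- apply: (ext (fun c => k * al i c) (fun c => k * be i c) ga
            (fun t => k * ga i t) u w) => // x y.
  rewrite !IH heisZ !linZ; congr heis; rewrite mulr_sumr.
  by apply: eq_bigr => t _; rewrite mulrA.
(* The new product has index [p]; the old values get coefficient 0 there. *)
apply: (ext (fun=> 0) (fun=> 0) (fun i t => if t == p then 0 else ga i t)
  (fun t => (t == p)%:R) (fun t => if t == p then al i else u t)
  (fun t => if t == p then be j else w t)) => [x y|x y i'].
  rewrite !IH heisM !lin0; congr heis.
  rewrite big_ord_recr /= !eqxx mul1r big1 ?add0r // => t _.
  by rewrite ltn_eqF ?ltn_ord // mul0r.
rewrite big_ord_recr /= !eqxx mul0r addr0; apply: eq_bigr => t _.
by rewrite ltn_eqF ?ltn_ord.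
Qed.

Lemma base_inputE (x y : nat -> rat) :
  base_input (\matrix_(i < q, j < q) heis (x (i * q + j)%N) 0 0)
             (\matrix_(i < q, j < q) heis 0 (y (i * q + j)%N) 0) = formal_input x y.
Proof.
rewrite /base_input /formal_input -2!allpairs_enum_ord.
by congr (_ ++ _); congr flatten; apply: eq_map => i; apply: eq_map => j; rewrite mxE.
Qed.

Lemma base_algorithm_forms p (B : base_algorithm q) :
  (forall (A : algType rat) (X Y : 'M[A]_q), base_result B X Y = X *m Y) ->
  count is_mul (base_ops B) = p ->
  exists (u w ga : nat -> nat -> rat), forall (x y : nat -> rat) i k, (i < q)%N -> (k < q)%N ->
    \sum_(t < p) ga (i * q + k)%N t * (lin (u t) x * lin (w t) y) =
    \sum_(j < q) x (i * q + j)%N * y (j * q + k)%N.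
Proof.
move=> hB <-; have [u [w [al [be [ga H]]]]] := base_run_forms (base_ops B).
(* [base_out] takes ordinals below [q] and [inord] needs a successor; the default 0 is never read,
   since [q] is positive as soon as there is an entry. *)
pose out c := match q =P q.-1.+1 with
  | ReflectT e => base_out B (cast_ord (esym e) (inord (c %/ q))) (cast_ord (esym e) (inord (c %% q)))
  | _ => 0%N end.
exists u, w, (fun c => ga (out c)) => x y i k hi hk.
have q0 : (0 < q)%N by apply: leq_ltn_trans hi.
have outE : out (i * q + k)%N = base_out B (Ordinal hi) (Ordinal hk).
  rewrite /out; case: eqP => [e|]; last by rewrite prednK.
  congr (base_out B); apply: val_inj => /=; rewrite inordK ?prednK //.
  - by rewrite divnMDl // divn_small ?addn0.
  - by rewrite divnMDl // divn_small ?addn0.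
  - by rewrite modnMDl modn_small.
  - by rewrite ltn_mod.
rewrite outE -[LHS](heis_out (lin (al (base_out B (Ordinal hi) (Ordinal hk))) x)
   (lin (be (base_out B (Ordinal hi) (Ordinal hk))) y)) -H -base_inputE.
have := hB _ (\matrix_(i < q, j < q) heis (x (i * q + j)%N) 0 0)
             (\matrix_(i < q, j < q) heis 0 (y (i * q + j)%N) 0).
move/matrixP/(_ (Ordinal hi) (Ordinal hk)); rewrite [in X in X -> _]mxE => ->.
rewrite mxE summxE; apply: eq_bigr => j _.
rewrite [(\matrix_(_, _) _) (Ordinal hi) j]mxE [(\matrix_(_, _) _) j (Ordinal hk)]mxE.
by rewrite heisM heis_out.
Qed.
End BilinearForm.

(** Used over [rat] with [De = 1], and over [int] with the common denominator as [De]. *)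
Definition bilinear_algorithm (F : comPzRingType) (q p : nat) (u w ga : nat -> nat -> F) (De : F) :=
  forall (x y : nat -> F) i k, (i < q)%N -> (k < q)%N ->
    \sum_(t < p) ga (i * q + k)%N t *
       (linear_form (q * q) (u t) x * linear_form (q * q) (w t) y) =
    De * \sum_(j < q) x (i * q + j)%N * y (j * q + k)%N.

Lemma eq_mulnD q a b c d : (b < q -> d < q -> (a * q + b == c * q + d) = (a == c) && (b == d))%N.
Proof.
move=> hb hd; apply/eqP/andP => [E|[/eqP -> /eqP ->] //].
have Ea : ((a * q + b) %/ q = (c * q + d) %/ q)%N by rewrite E.
have Eb : ((a * q + b) %% q = (c * q + d) %% q)%N by rewrite E.
move: Ea Eb; rewrite !modnMDl !modn_small // !divnMDl ?(leq_ltn_trans _ hb) //.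
by rewrite !divn_small // !addn0 => -> ->; rewrite !eqxx.
Qed.

(** The elementary matrices E_(i,j1) and E_(j2,k) have product E_(i,k) if [j1 = j2] and 0 otherwise;
    [la] reads the entries of that product. *)
Lemma product_form_delta (F : comPzRingType) q (la : nat -> F) i j1 j2 k :
  (i < q)%N -> (j1 < q)%N -> (j2 < q)%N -> (k < q)%N ->
  \sum_(c < q * q) la c * \sum_(j < q) (c %/ q * q + j == i * q + j1)%N%:R
     * (j * q + c %% q == j2 * q + k)%N%:R = if j1 == j2 then la (i * q + k)%N else 0.
Proof.
move=> hi hj1 hj2 hk; have q0 : (0 < q)%N by apply: leq_ltn_trans hi.
have hc : (i * q + k < q * q)%N by nia.
rewrite (bigD1 (Ordinal hc)) //= [X in _ + X]big1 => [|c ne_c].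
  rewrite addr0 divnMDl // divn_small // addn0 modnMDl modn_small //.
  rewrite (bigD1 (Ordinal hj1)) //= !eq_mulnD // !eqxx /= andbT mul1r big1 ?addr0.
    by case: (j1 == j2); rewrite ?mulr1 ?mulr0.
  by move=> j ne_j; rewrite eq_mulnD // eqxx /= -(inj_eq val_inj) /= in ne_j *; rewrite (negbTE ne_j) mul0r.
rewrite big1 ?mulr0 // => j _; rewrite -natrM !eq_mulnD // ?ltn_mod //.
case: eqP => //= Ei; case: eqP => //= _; case: eqP => //= _; case: eqP => //= Ek; case/negP: ne_c.
by rewrite -(inj_eq val_inj) /= [X in X == _](divn_eq c q) Ei Ek.
Qed.

Lemma linear_form_delta (F : pzRingType) k (a : nat -> F) i : (i < k)%N ->
  linear_form k a (fun c => (c == i)%:R) = a i.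
Proof.
move=> hi; rewrite /linear_form (bigD1 (Ordinal hi)) //= eqxx mulr1 big1 ?addr0 // => c.
by rewrite -(inj_eq val_inj) /= => /negbTE ->; rewrite mulr0.
Qed.

(* If q * q rank-one products were enough, each of them would be a combination of
   the entries of the matrix product; but a nonzero combination of these has rank
   at least q >= 2 as a bilinear form. *)
Lemma bilinear_algorithm_lower (F : fieldType) q p (u w ga : nat -> nat -> F) : (1 < q)%N ->
  bilinear_algorithm q p u w ga 1 -> (q * q < p)%N.
Proof.
move=> q1 H; rewrite ltnNge; apply/negP => le_p.
pose d i : nat -> F := fun c => (c == i)%:R.
pose Ga := \matrix_(c < q * q, t < p) ga c t.
have comb (la : nat -> F) (x y : nat -> F) :
    \sum_(t < p) (\sum_(c < q * q) la c * ga c t) * (linear_form (q * q) (u t) x * linear_form (q * q) (w t) y) =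
    \sum_(c < q * q) la c * \sum_(j < q) x (c %/ q * q + j)%N * y (j * q + c %% q)%N.
  transitivity (\sum_(c < q * q) la c * \sum_(t < p) ga c t * (linear_form (q * q) (u t) x * linear_form (q * q) (w t) y)).
    under eq_bigr do rewrite mulr_suml; rewrite exchange_big /=; apply: eq_bigr => c _.
    by rewrite mulr_sumr; apply: eq_bigr => t _; rewrite mulrA.
  apply: eq_bigr => c _; congr (_ * _); rewrite -[RHS]mul1r -H; last 2 first.
  - by rewrite ltn_divLR ?(ltnW q1) // ltn_ord.
  - by rewrite ltn_mod ltnW.
  by rewrite -divn_eq.
have pairP (c : 'I_(q * q)) : exists i k, [/\ (i < q)%N, (k < q)%N & c = (i * q + k)%N :> nat].
  exists (c %/ q)%N, (c %% q)%N; rewrite -divn_eq ltn_mod (ltnW q1) ltn_divLR ?(ltnW q1) //.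
(* Elementary matrices show that the entries of the product are independent bilinear forms, so the
   rows of [Ga] are independent and [p] is exactly [q * q]. *)
have free : row_free Ga.
  apply: inj_row_free => v hv; apply/rowP => c; rewrite mxE.
  have [i [k [hi hk Ec]]] := pairP c.
  pose la n : F := if insub n is Some c then v 0 c else 0.
  have laE (c' : 'I_(q * q)) : la c' = v 0 c' by rewrite /la valK.
  have := comb la (d (i * q + 0)%N) (d (0 * q + k)%N).
  rewrite product_form_delta ?(ltnW q1) // eqxx -Ec laE => <-; apply: big1 => t _.
  suff -> : \sum_(c0 < q * q) la c0 * ga c0 t = 0 by rewrite mul0r.
  move/rowP/(_ t): hv; rewrite !mxE => {2}<-; apply: eq_bigr => c' _.
  by rewrite laE mxE.
have Ep : p = (q * q)%N.
  by apply/eqP; rewrite eqn_leq le_p -(eqP free) rank_leq_col.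
(* [Ga] is now invertible: row [t0] of its inverse writes one rank-one product as a combination of
   entries of the matrix product. *)
have /row_fullP[La hLa] : row_full Ga by rewrite /row_full (eqP free) Ep.
have p0 : (0 < p)%N by rewrite Ep; nia.
pose t0 := Ordinal p0.
suff La0 c : La t0 c = 0.
  move/matrixP/(_ t0 t0): hLa; rewrite !mxE eqxx big1 => [/eqP|c _].
    by rewrite eq_sym oner_eq0.
  by rewrite La0 mul0r.
have [i [k [hi hk Ec]]] := pairP c.
pose la n : F := if insub n is Some c then La t0 c else 0.
have laE (c' : 'I_(q * q)) : la c' = La t0 c' by rewrite /la valK.
have rank1 x y : linear_form (q * q) (u t0) x * linear_form (q * q) (w t0) y =
    \sum_(c < q * q) la c * \sum_(j < q) x (c %/ q * q + j)%N * y (j * q + c %% q)%N.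
  rewrite -comb (bigD1 t0) //= [X in _ + X]big1 ?addr0 => [|t /= ne_t].
    move/matrixP/(_ t0 t0): hLa; rewrite !mxE eqxx => E.
    suff -> : \sum_(c0 < q * q) la c0 * ga c0 0%N = 1 by rewrite mul1r.
    by rewrite -[RHS]E; apply: eq_bigr => c' _; rewrite laE mxE.
  move/matrixP/(_ t0 t): hLa; rewrite !mxE eq_sym (negbTE ne_t) => E.
  suff -> : \sum_(c0 < q * q) la c0 * ga c0 t = 0 by rewrite mul0r.
  by rewrite -[RHS]E; apply: eq_bigr => c' _; rewrite laE mxE.
have rk j1 j2 : (j1 < q)%N -> (j2 < q)%N ->
    u t0 (i * q + j1)%N * w t0 (j2 * q + k)%N = if j1 == j2 then La t0 c else 0.
  move=> h1 h2; rewrite -laE Ec -product_form_delta // -(rank1 (d _) (d _)).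
  by rewrite !linear_form_delta //; nia.
(* Both diagonal coefficients equal [La t0 c], while the off-diagonal one is 0; one of its factors
   vanishes and occurs in a diagonal coefficient. *)
have /= e00 := rk 0%N 0%N (ltnW q1) (ltnW q1); have /= e11 := rk 1%N 1%N q1 q1.
have /eqP := rk 0%N 1%N (ltnW q1) q1.
rewrite /= mulf_eq0 => /orP[] /eqP z.
  by rewrite -e00 z mul0r.
by rewrite -e11 z mulr0.
Qed.

(** * Clearing denominators *)

Lemma common_denominator (s : seq rat) : exists2 D : nat, (0 < D)%N &
  forall r, r \in s -> exists z : int, z%:~R = D%:R * r.
Proof.
elim: s => [|r s [D D0 HD]]; first by exists 1%N.
exists (D * `|denq r|)%N; first by rewrite muln_gt0 D0 absz_gt0 denq_neq0.
move=> r'; rewrite inE natrM.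
have den : `|denq r|%N%:R = (denq r)%:~R :> rat by rewrite natr_absz ger0_norm ?denq_ge0.
case/orP => [/eqP ->|/HD[z hz]].
  by exists (D%:Z * numq r); rewrite rmorphM /= -mulrA den mulrC (numqE r) [_ * r]mulrC mulrC.
by exists (denq r * z); rewrite rmorphM /= hz den -mulrA mulrCA mulrA.
Qed.

Lemma common_denominator2 a b (f : nat -> nat -> rat) : exists2 D : nat, (0 < D)%N &
  exists g : nat -> nat -> int, forall i j, (i < a)%N -> (j < b)%N -> (g i j)%:~R = D%:R * f i j.
Proof.
have [D D0 HD] := common_denominator [seq f i j | i <- iota 0 a, j <- iota 0 b].
exists D => //; exists (fun i j => numq (D%:R * f i j)) => i j hi hj.
have [|z <-] := HD (f i j); last by rewrite numq_int.
by apply/allpairsP; exists (i, j); rewrite /= !mem_iota.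
Qed.

(** Each term contains one coefficient of each of the three families, so the three common
    denominators multiply. *)
Lemma bilinear_algorithm_int q p (u w ga : nat -> nat -> rat) :
  bilinear_algorithm q p u w ga 1 ->
  exists (D : nat) (al be ga' : nat -> nat -> int), (0 < D)%N /\
    bilinear_algorithm q p al be ga' D%:Z.
Proof.
move=> H.
have [D1 D10 [al hal]] := common_denominator2 p (q * q) u.
have [D2 D20 [be hbe]] := common_denominator2 p (q * q) w.
have [D3 D30 [g hg]] := common_denominator2 (q * q) p ga.
exists (D1 * D2 * D3)%N, al, be, g; split; first by rewrite !muln_gt0 D10 D20.
move=> x y i k hi hk; apply: (@mulrIz rat 1) => //=.
have lf (a : nat -> int) (a' : nat -> rat) (D : nat) (z : nat -> int) :
   (forall c, (c < q * q)%N -> (a c)%:~R = D%:R * a' c) ->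
   (linear_form (q * q) a z)%:~R = D%:R * linear_form (q * q) a' (fun c => (z c)%:~R) :> rat.
  move=> ha; rewrite /linear_form rmorph_sum mulr_sumr; apply: eq_bigr => c _.
  by rewrite rmorphM /= ha // mulrA.
rewrite rmorphM rmorph_sum [in RHS]rmorph_sum /=.
transitivity ((D1 * D2 * D3)%:R * (1 * \sum_(j < q) (x (i * q + j)%N)%:~R * (y (j * q + k)%N)%:~R) : rat).
  rewrite -(H (fun c => (x c)%:~R) (fun c => (y c)%:~R)) // mulr_sumr; apply: eq_bigr => t _.
  rewrite !rmorphM /= hg ?ltn_ord //; last by nia.
  rewrite (lf _ _ _ _ (fun c => hal t c (ltn_ord t))) (lf _ _ _ _ (fun c => hbe t c (ltn_ord t))).
  by rewrite ?natrM; ring.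
by rewrite mul1r; congr (_ * _); apply: eq_bigr => j _; rewrite rmorphM.
Qed.

Lemma strassen_like_bilinear kappa n0 p0 q (B : base_algorithm q) :
  (1 < n0)%N -> strassen_like kappa n0 p0 B ->
  [/\ n0 = (q * q)%N, (1 < q)%N, (n0 < p0)%N &
  exists (D : nat) (al be ga : nat -> nat -> int), (0 < D)%N /\
    bilinear_algorithm q p0 al be ga D%:Z].
Proof.
move=> hn0 [E HB Hp _ _]; rewrite -mulnn in E; rewrite {n0}E in hn0 *.
have q1 : (1 < q)%N by rewrite ltnNge; apply/negP => q1; move: hn0; nia.
have [u [w [ga H]]] := base_algorithm_forms HB Hp.
have H1 : bilinear_algorithm q p0 u w ga 1 by move=> x y i k hi hk; rewrite mul1r H.
split=> //; first exact: bilinear_algorithm_lower H1.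
exact: bilinear_algorithm_int H1.
Qed.

(** * A while language and its compilation to the TCU machine *)

Inductive binop := OAdd | OSub | OMul | ODiv.

(* Addresses are taken up to sign, so that every expression has a value. *)
Inductive expr :=
  | EV of nat
  | EC of int
  | EBin of binop & expr & expr
  | ELoad of expr.

Notation EAdd := (EBin OAdd).
Notation ESub := (EBin OSub).
Notation EMul := (EBin OMul).
Notation EDiv := (EBin ODiv).

Inductive cmd :=
  | CSkip
  | CAsg of nat & expr
  | CSto of expr & expr
  | CTen of expr & expr & expr & expr
  | CSeq of cmd & cmd
  | CWhile of expr & cmd.

Definition opval (o : binop) (a b : int) : int :=
  match o with OAdd => a + b | OSub => a - b | OMul => a * b | ODiv => (a %/ b)%Z end.

Fixpoint eval (r M : nat -> int) (e : expr) : int :=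
  match e with
  | EV x => r x
  | EC z => z
  | EBin o a b => opval o (eval r M a) (eval r M b)
  | ELoad a => M `|eval r M a|%N
  end.

(* All the intermediate values of e are at most U ^ esize e when the variables
   and the memory cells are at most U. *)
Fixpoint esize (e : expr) : nat :=
  match e with
  | EV _ => 1
  | EC z => `|z|.+1
  | EBin _ a b => esize a + esize b
  | ELoad a => (esize a).*2.+2
  end.

(** Registers 0 and 1 hold the input, so variables 0 and 1 must be these registers; the other
    variables take even registers, and temporaries the odd ones from 3 on. *)
Definition vreg (x : nat) : nat := if x == 1%N then 1%N else x.*2.
Definition treg (d : nat) : nat := d.*2.+3.

Definition opinstr (o : binop) : nat -> nat -> nat -> instr :=
  match o with OAdd => IAdd | OSub => ISub | OMul => IMul | ODiv => IDiv end.

(* |v| = v (1 + 2 floor(v / (v ^ 2 + 1))) *)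
Definition cabs (d : nat) : program :=
  [:: IMul (treg d.+1) (treg d) (treg d);
      IConst (treg d.+2) 1;
      IAdd (treg d.+1) (treg d.+1) (treg d.+2);
      IDiv (treg d.+1) (treg d) (treg d.+1);
      IAdd (treg d.+1) (treg d.+1) (treg d.+1);
      IAdd (treg d.+1) (treg d.+1) (treg d.+2);
      IMul (treg d) (treg d) (treg d.+1)].

Fixpoint ecode (e : expr) (d : nat) : program :=
  match e with
  | EV x => [:: IConst (treg d) 0; IAdd (treg d) (treg d) (vreg x)]
  | EC z => [:: IConst (treg d) z]
  | EBin o a b => ecode a d ++ ecode b d.+1 ++ [:: opinstr o (treg d) (treg d) (treg d.+1)]
  | ELoad a => (ecode a d ++ cabs d) ++ [:: ILoad (treg d) (treg d)]
  end.

Definition acode (e : expr) (d : nat) : program := ecode e d ++ cabs d.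

Fixpoint clen (c : cmd) : nat :=
  match c with
  | CSkip => 0
  | CAsg x e => size (ecode e 0) + 2
  | CSto a e => size (acode a 0) + (size (ecode e 1) + 1)
  | CTen a b d k => size (acode a 0) + (size (acode b 1) + (size (acode d 2) + (size (acode k 3) + 1)))
  | CSeq c1 c2 => clen c1 + clen c2
  | CWhile e c => size (ecode e 0) + (2 + (clen c + 1))
  end.

(** Jump targets are absolute, so code is generated for a start position [p]; [clen] gives lengths
    that do not depend on it. *)
Fixpoint ccode (p : nat) (c : cmd) : program :=
  match c with
  | CSkip => [::]
  | CAsg x e => ecode e 0 ++ [:: IConst (vreg x) 0; IAdd (vreg x) (vreg x) (treg 0)]
  | CSto a e => acode a 0 ++ ecode e 1 ++ [:: IStore (treg 0) (treg 1)]
  | CTen a b d k => acode a 0 ++ acode b 1 ++ acode d 2 ++ acode k 3 ++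
                    [:: ITensor (treg 0) (treg 1) (treg 2) (treg 3)]
  | CSeq c1 c2 => ccode p c1 ++ ccode (p + clen c1) c2
  | CWhile e c =>
      let p1 := (p + size (ecode e 0))%N in
      ecode e 0 ++ [:: IJumpPos (treg 0) p1.+2; IJump (p1.+2 + clen c).+1] ++
      ccode p1.+2 c ++ [:: IJump p]
  end.

(** An exponent: words of [W] bits hold all intermediate values as soon as [U ^ csize c < 2 ^ W].
    The terms [.*2.+2] make room for [cabs], which squares an address. *)
Fixpoint csize (c : cmd) : nat :=
  match c with
  | CSkip => 0
  | CAsg _ e => esize e
  | CSto a e => (esize a).*2.+2 + esize e
  | CTen a b d k => (esize a).*2.+2 + ((esize b).*2.+2 + ((esize d).*2.+2 + (esize k).*2.+2))
  | CSeq c1 c2 => csize c1 + csize c2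
  | CWhile e c => esize e + csize c
  end.

Lemma size_ccode p c : size (ccode p c) = clen c.
Proof.
elim: c p => [|x e|a e|a b d k|c1 IH1 c2 IH2|e c IH] p //=.
- by rewrite !size_cat.
- by rewrite !size_cat.
- by rewrite !size_cat.
- by rewrite size_cat IH1 IH2.
- by rewrite size_cat /= size_cat IH.
Qed.

Lemma vreg_inj : injective vreg.
Proof. by move=> x y; rewrite /vreg -!muln2; case: (x =P 1)%N => ?; case: (y =P 1)%N => ?; lia. Qed.

Lemma treg_inj : injective treg.
Proof. by move=> x y; rewrite /treg -!muln2; lia. Qed.

Lemma vreg_treg x d : (vreg x == treg d) = false.
Proof. by rewrite /vreg /treg -!muln2; case: (x =P 1)%N => ?; apply/eqP; lia. Qed.

Lemma treg_vreg x d : (treg d == vreg x) = false.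
Proof. by rewrite eq_sym vreg_treg. Qed.

(** * Execution of compiled expressions *)

Definition code_at (P : program) (p : nat) (l : program) :=
  forall i, (i < size l)%N -> nth IHalt P (p + i) = nth IHalt l i.

Lemma code_at_catl P p l1 l2 : code_at P p (l1 ++ l2) -> code_at P p l1.
Proof. by move=> H i hi; rewrite H ?size_cat ?ltn_addr // nth_cat hi. Qed.

Lemma code_at_catr P p l1 l2 : code_at P p (l1 ++ l2) -> code_at P (p + size l1) l2.
Proof.
move=> H i hi; rewrite -addnA H ?size_cat ?ltn_add2l // nth_cat ltnNge leq_addr /=.
by rewrite addKn.
Qed.

Lemma code_at_head P p i l : code_at P p (i :: l) -> nth IHalt P p = i.
Proof. by move/(_ 0%N isT); rewrite addn0. Qed.

Lemma code_at_tail P p i l : code_at P p (i :: l) -> code_at P p.+1 l.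
Proof. by move=> H j hj; rewrite addSnnS H. Qed.

(** The cost without latency and the number of latencies, both in nat; [reach_runs] recombines
    them. *)
Definition tcost (s : nat) (P : program) (c : config) : nat :=
  if fetch P c is ITensor _ _ _ k then `|regs c k| * s else 1.
Definition kcost (P : program) (c : config) : nat :=
  if fetch P c is ITensor _ _ _ k then 1 else 0.

Inductive reach (s W : nat) (P : program) : config -> nat -> nat -> config -> Prop :=
  | reach0 c : reach s W P c 0 0 c
  | reachS c c1 c2 t k : step s W P c = Some c1 -> reach s W P c1 t k c2 ->
      reach s W P c (tcost s P c + t) (kcost P c + k) c2.

Section Machine.
Variables (s U W : nat) (P : program).
Hypothesis U2 : (1 < U)%N.
Notation reach := (reach s W P).

Lemma reach_trans c1 t1 k1 c2 t2 k2 c3 :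
  reach c1 t1 k1 c2 -> reach c2 t2 k2 c3 -> reach c1 (t1 + t2) (k1 + k2) c3.
Proof. by elim=> [//|c c4 c5 t k hs _ IH] /IH h; rewrite -!addnA; apply: reachS hs h. Qed.

Lemma reach_trans0 c1 t1 c2 t2 c3 :
  reach c1 t1 0 c2 -> reach c2 t2 0 c3 -> reach c1 (t1 + t2) 0 c3.
Proof. exact: reach_trans. Qed.

Lemma reach_step c c1 : step s W P c = Some c1 -> reach c (tcost s P c) (kcost P c) c1.
Proof. by move=> h; rewrite -[X in reach _ X _]addn0 -[X in reach _ _ X]addn0; apply: reachS h (reach0 _ _ _ _). Qed.

Lemma fitsU (v : int) z : (`|v| <= U ^ z)%N -> (U ^ z < 2 ^ W)%N -> fits W v.
Proof. exact: leq_ltn_trans. Qed.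

Definition bounded (r : nat -> int) := forall x, (`|r x| <= U)%N.

Lemma leq_expU a b : (a <= b)%N -> (U ^ a <= U ^ b)%N.
Proof. by move=> h; rewrite leq_exp2l. Qed.

Lemma expU_gt a : (a < U ^ a)%N.
Proof. exact: ltn_expl. Qed.

Lemma expU_double a : (0 < a)%N -> (2 <= U ^ a)%N.
Proof. by move=> h; rewrite (leq_trans U2) // -{1}(expn1 U) leq_expU. Qed.

Lemma esize_gt0 e : (0 < esize e)%N.
Proof. by elim: e => //= o a ha b hb; rewrite addn_gt0 ha. Qed.

Lemma absz_divz_le (a b : int) : (`|(a %/ b)%Z| <= `|a|)%N.
Proof. nia. Qed.

Lemma eval_bound r M e : bounded r -> bounded M -> (`|eval r M e| <= U ^ esize e)%N.
Proof.
move=> hr hM; elim: e => [x|z|o a IHa b IHb|a IHa] /=.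
- by rewrite expn1.
- by rewrite (leq_trans _ (ltnW (expU_gt _))).
(* x + y <= x * y for x, y >= 2, whence the assumption that [U] is at least 2. *)
- have sum : (U ^ esize a + U ^ esize b <= U ^ (esize a + esize b))%N.
    rewrite expnD; have := expU_double (esize_gt0 a); have := expU_double (esize_gt0 b).
    by move: (U ^ _)%N (U ^ _)%N => x y; nia.
  case: o => /=; try by move: sum IHa IHb; lia.
    by rewrite abszM expnD leq_mul.
  by rewrite (leq_trans (absz_divz_le _ _)) // (leq_trans IHa) // leq_expU // leq_addr.
- by rewrite (leq_trans (hM _)) // -{1}(expn1 U) leq_expU.
Qed.


Definition instr_dst (I : instr) (r M : nat -> int) : option (nat * int) :=
  match I with
  | IConst d z => Some (d, z)
  | IAdd d a b => Some (d, r a + r b)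
  | ISub d a b => Some (d, r a - r b)
  | IMul d a b => Some (d, r a * r b)
  | IDiv d a b => Some (d, (r a %/ r b)%Z)
  | ILoad d a => if r a is Posz x then Some (d, M x) else None
  | _ => None
  end.

Lemma reach_dst I p R M d v : nth IHalt P p = I -> instr_dst I R M = Some (d, v) ->
  fits W v -> reach (Config p R M) 1 0 (Config p.+1 (upd R d v) M).
Proof.
move=> hI hd hv.
have hs : step s W P (Config p R M) = Some (Config p.+1 (upd R d v) M).
  rewrite /step /fetch /= hI; case: (I) hd => //= [d' z|d' a b|d' a b|d' a b|d' a b|d' a].
  1-5: by case=> -> ->; rewrite /set_reg hv.
  by case: (R a) => // x [-> ->]; rewrite /set_reg hv.
have := reach_step hs; rewrite /tcost /kcost /fetch /= hI.
by case: (I) hd.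
Qed.

Lemma reach_dst_cons I p R M d v t k c' : nth IHalt P p = I ->
  instr_dst I R M = Some (d, v) -> fits W v ->
  reach (Config p.+1 (upd R d v) M) t k c' -> reach (Config p R M) t.+1 k c'.
Proof. by move=> h1 h2 h3 h4; have := reach_trans (reach_dst h1 h2 h3) h4; rewrite add1n. Qed.

(** The frame condition of code generated at depth [d]: variables survive, and so do the temporaries
    below [d], which hold pending operands. *)
Definition agree_below (d : nat) (R R' : nat -> int) :=
  (forall x, R' (vreg x) = R (vreg x)) /\ (forall d', (d' < d)%N -> R' (treg d') = R (treg d')).

Lemma agree_below_trans d d' R1 R2 R3 : (d <= d')%N ->
  agree_below d R1 R2 -> agree_below d' R2 R3 -> agree_below d R1 R3.
Proof.
move=> hd [h1 h2] [h3 h4]; split=> [x|x hx]; first by rewrite h3 h1.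
by rewrite h4 ?h2 // (leq_trans hx).
Qed.

Lemma agree_below_upd d d' R v : (d <= d')%N -> agree_below d R (upd R (treg d') v).
Proof.
move=> hd; split=> [x|x hx]; rewrite /upd ?vreg_treg //.
by rewrite (inj_eq treg_inj) ltn_eqF // (leq_trans hx).
Qed.

Lemma agree_belowS d R R' : agree_below d.+1 R R' -> agree_below d R R'.
Proof. by case=> h1 h2; split=> // x hx; rewrite h2 // ltnW. Qed.

Lemma updE R d v : upd R d v d = v.
Proof. by rewrite /upd eqxx. Qed.

Lemma upd_treg_neq R d d' v : d' != d -> upd R (treg d) v (treg d') = R (treg d').
Proof. by rewrite /upd (inj_eq treg_inj) => /negbTE ->. Qed.

Lemma reach_cabs d p R M E : (`|R (treg d)| <= U ^ E)%N ->
  (U ^ E.*2.+2 < 2 ^ W)%N -> code_at P p (cabs d) ->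
  exists2 R', reach (Config p R M) 7 0 (Config (p + 7) R' M) &
    agree_below d R R' /\ R' (treg d) = `|R (treg d)|%N.
Proof.
set v := R (treg d); move=> hv hW hc.
(* U ^ (2 E + 2) >= 4 U ^ (2 E) >= 2 (U ^ (2 E) + 1), which covers v ^ 2 + 1 and the other values of
   [cabs]. *)
have fit x : (`|x| <= 2 * (U ^ E * U ^ E).+1)%N -> fits W x.
  move=> hx; apply: fitsU hW; apply: leq_trans hx _.
  rewrite -addnn -(addn2 (E + E)) !expnD; have := U2; have : (0 < U ^ E)%N by rewrite expn_gt0 ltnW.
  rewrite -mulnn; move: (U ^ E)%N => y y0 U2'.
  have h4 : (4 <= U * U)%N by rewrite (leq_mul U2' U2').
  have h1 : (1 <= y * y)%N by rewrite (leq_mul y0 y0).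
  by move: (U * U)%N (y * y)%N h4 h1 => a b; nia.
move: hv fit; move: (U ^ E)%N => y hv fit.
pose sg := (v %/ (v * v + 1))%Z.
have sgE : sg = if v < 0 then -1 else 0.
  rewrite /sg; case: ifP => hv0; last by rewrite divz_small //; nia.
  have {1}-> : v = -1 * (v * v + 1) + (v * v + v + 1) by ring.
  by rewrite divzMDl ?[X in _ + X]divz_small; nia.
pose R1 := upd R (treg d.+1) (v * v).
pose R2 := upd R1 (treg d.+2) 1.
pose R3 := upd R2 (treg d.+1) (v * v + 1).
pose R4 := upd R3 (treg d.+1) sg.
pose R5 := upd R4 (treg d.+1) (sg + sg).
pose R6 := upd R5 (treg d.+1) (sg + sg + 1).
pose R7 := upd R6 (treg d) (v * (sg + sg + 1)).
have n1 : d != d.+1 by lia.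
have n2 : d != d.+2 by lia.
have n3 : d.+1 != d.+2 by lia.
have n4 : d.+2 != d.+1 by lia.
have vabs : v * (sg + sg + 1) = `|v|%N by rewrite sgE; case: ifP; lia.
exists R7; last first.
  split; last by rewrite /R7 updE.
  split=> [x|d' hd']; rewrite /R7 /R6 /R5 /R4 /R3 /R2 /R1 /upd ?vreg_treg // !(inj_eq treg_inj).
  by rewrite !ltn_eqF // ltnW // ltnW.
have v1 : R1 (treg d) = v by rewrite /R1 upd_treg_neq.
have v2 : R2 (treg d) = v by rewrite /R2 upd_treg_neq.
have v3 : R3 (treg d) = v by rewrite /R3 upd_treg_neq.
have v4 : R4 (treg d) = v by rewrite /R4 upd_treg_neq.
have v5 : R5 (treg d) = v by rewrite /R5 upd_treg_neq.
have v6 : R6 (treg d) = v by rewrite /R6 upd_treg_neq.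
have o5 : R5 (treg d.+2) = 1 by rewrite /R5 upd_treg_neq // /R4 upd_treg_neq // /R3 upd_treg_neq // /R2 updE.
have o2 : R2 (treg d.+2) = 1 by rewrite /R2 updE.
have w2 : R2 (treg d.+1) = v * v by rewrite /R2 upd_treg_neq // /R1 updE.
have w3 : R3 (treg d.+1) = v * v + 1 by rewrite /R3 updE.
have w4 : R4 (treg d.+1) = sg by rewrite /R4 updE.
have w5 : R5 (treg d.+1) = sg + sg by rewrite /R5 updE.
have w6 : R6 (treg d.+1) = sg + sg + 1 by rewrite /R6 updE.
rewrite /cabs in hc.
have c0 := code_at_head hc; have {hc} hc := code_at_tail hc.
have c1 := code_at_head hc; have {hc} hc := code_at_tail hc.
have c2 := code_at_head hc; have {hc} hc := code_at_tail hc.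
have c3 := code_at_head hc; have {hc} hc := code_at_tail hc.
have c4 := code_at_head hc; have {hc} hc := code_at_tail hc.
have c5 := code_at_head hc; have {hc} hc := code_at_tail hc.
have c6 := code_at_head hc; have {hc} hc := code_at_tail hc.
have fsg : fits W sg by apply: fit; rewrite sgE; case: ifP; lia.
have fvv : (`|(v * v)%R| <= y * y)%N by rewrite abszM leq_mul.
rewrite (_ : p + 7 = p.+4.+3)%N; last by rewrite !addnS addn0.
apply: (reach_dst_cons c0 (erefl _)); first by apply: fit; lia.
apply: (reach_dst_cons c1 (erefl _)); first by apply: fit; lia.
apply: (reach_dst_cons c2 (v := v * v + 1)); first by rewrite (_ : upd _ _ _ = R2) //= w2 o2.
  by apply: fit; lia.
apply: (reach_dst_cons c3 (v := sg)); first by rewrite (_ : upd _ _ _ = R3) //= v3 w3.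
  exact: fsg.
apply: (reach_dst_cons c4 (v := sg + sg)); first by rewrite (_ : upd _ _ _ = R4) //= w4.
  by apply: fit; rewrite sgE; case: ifP; lia.
apply: (reach_dst_cons c5 (v := sg + sg + 1)); first by rewrite (_ : upd _ _ _ = R5) //= w5 o5.
  by apply: fit; rewrite sgE; case: ifP; lia.
apply: (reach_dst c6 (v := v * (sg + sg + 1))); first by rewrite (_ : upd _ _ _ = R6) //= v6 w6.
by apply: fit; rewrite vabs; nia.
Qed.

Lemma opinstr_dst o d a b r M :
  instr_dst (opinstr o d a b) r M = Some (d, opval o (r a) (r b)).
Proof. by case: o. Qed.

Lemma ecode_correct e d p R r M : (forall x, R (vreg x) = r x) -> bounded r -> bounded M ->
  (U ^ esize e < 2 ^ W)%N -> code_at P p (ecode e d) ->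
  exists2 R', reach (Config p R M) (size (ecode e d)) 0 (Config (p + size (ecode e d)) R' M) &
    agree_below d R R' /\ R' (treg d) = eval r M e.
Proof.
move=> hR hr hM; elim: e d p R hR => [x|z|o a IHa b IHb|a IHa] d p R hR /= hW hc.
- have hx : fits W (r x) by apply: fitsU hW; rewrite expn1.
  have h1 := code_at_head (code_at_tail hc); rewrite addn2.
  exists (upd (upd R (treg d) 0) (treg d) (r x)).
    apply: (reach_dst_cons (code_at_head hc) (erefl _)).
      by apply: fitsU hW; rewrite absz0.
    by apply: (reach_dst h1) hx; rewrite /= updE add0r /upd vreg_treg hR.
  split; last by rewrite updE.
  exact: agree_below_trans (leqnn d) (agree_below_upd _ _ (leqnn d)) (agree_below_upd _ _ (leqnn d)).
- exists (upd R (treg d) z); last by rewrite updE; split=> //; apply: agree_below_upd.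
  rewrite addn1; apply: (reach_dst (code_at_head hc) (erefl _)).
  by apply: fitsU hW; rewrite (leq_trans (leqnSn _)) // ltnW // expU_gt.
- have ha : (U ^ esize a < 2 ^ W)%N by apply: leq_ltn_trans hW; rewrite leq_expU // leq_addr.
  have hb : (U ^ esize b < 2 ^ W)%N by apply: leq_ltn_trans hW; rewrite leq_expU // leq_addl.
  have [R1 r1 [g1 v1]] := IHa d p R hR ha (code_at_catl hc).
  have hc1 := code_at_catr hc.
  have [|R2 r2 [g2 v2]] := IHb d.+1 _ R1 _ hb (code_at_catl hc1); first by move=> x; rewrite g1.1.
  have hc2 := code_at_head (code_at_catr hc1).
  pose v := opval o (eval r M a) (eval r M b).
  exists (upd R2 (treg d) v).
    rewrite !size_cat /= !addnA; apply: reach_trans0; last first.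
      rewrite addn1; apply: (reach_dst hc2).
        by rewrite opinstr_dst v2 g2.2 // v1.
      by apply: fitsU hW; exact: (eval_bound (EBin o a b)).
    exact: (reach_trans0 r1 r2).
  split; last by rewrite updE.
  apply: agree_below_trans (leqnn d) g1 _.
  exact: agree_below_trans (leqnn d) (agree_belowS g2) (agree_below_upd _ _ (leqnn d)).
- have ha : (U ^ esize a < 2 ^ W)%N.
    by apply: leq_ltn_trans hW; rewrite leq_expU // -addnn -addnS -addnS leq_addr.
  have [R1 r1 [g1 v1]] := IHa d p R hR ha (code_at_catl (code_at_catl hc)).
  have hc1 := code_at_catr (code_at_catl hc).
  have hv : (`|R1 (treg d)| <= U ^ esize a)%N by rewrite v1 eval_bound.
  have [R2 r2 [g2 v2]] := reach_cabs M hv hW hc1.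
  have := code_at_head (code_at_catr hc); rewrite size_cat addnA => hc2.
  exists (upd R2 (treg d) (M `|eval r M a|%N)).
    rewrite !size_cat /= !addnA; apply: reach_trans0; last first.
      rewrite addn1; apply: (reach_dst hc2); first by rewrite /= v2 v1.
      by apply: fitsU hW; rewrite (leq_trans (hM _)) // -{1}(expn1 U) leq_expU.
    exact: (reach_trans0 r1 r2).
  split; last by rewrite updE.
  apply: agree_below_trans (leqnn d) g1 _.
  exact: agree_below_trans (leqnn d) g2 (agree_below_upd _ _ (leqnn d)).
Qed.

Lemma acode_correct e d p R r M : (forall x, R (vreg x) = r x) -> bounded r -> bounded M ->
  (U ^ (esize e).*2.+2 < 2 ^ W)%N -> code_at P p (acode e d) ->
  exists2 R', reach (Config p R M) (size (acode e d)) 0 (Config (p + size (acode e d)) R' M) &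
    agree_below d R R' /\ R' (treg d) = `|eval r M e|%N.
Proof.
move=> hR hr hM hW hc.
have he : (U ^ esize e < 2 ^ W)%N.
  by apply: leq_ltn_trans hW; rewrite leq_expU // -addnn -addnS -addnS leq_addr.
have [R1 r1 [g1 v1]] := ecode_correct hR hr hM he (code_at_catl hc).
have hv : (`|R1 (treg d)| <= U ^ esize e)%N by rewrite v1 eval_bound.
have [R2 r2 [g2 v2]] := reach_cabs M hv hW (code_at_catr hc).
exists R2; last by split; [exact: agree_below_trans (leqnn d) g1 g2|rewrite v2 v1].
by rewrite size_cat addnA; apply: (reach_trans0 r1 r2).
Qed.
End Machine.

(** Total correctness with at most [T] time without latency and at most [K] tensor calls. The
    initial state is concrete rather than described by a precondition, so the postcondition of the
    first half of a sequence can be a triple for the second half. Boundedness by [U] is built in on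
    both sides. *)
Definition triple (U s : nat) (c : cmd) (r M : nat -> int) (T K : nat)
    (Q : (nat -> int) -> (nat -> int) -> Prop) :=
  forall W P p R, (1 < U)%N -> (U ^ csize c < 2 ^ W)%N -> code_at P p (ccode p c) ->
    (forall x, R (vreg x) = r x) -> bounded U r -> bounded U M ->
  exists R' M' r' t k,
    [/\ reach s W P (Config p R M) t k (Config (p + clen c) R' M'), (t <= T)%N /\ (k <= K)%N,
        forall x, R' (vreg x) = r' x, bounded U r' /\ bounded U M' & Q r' M'].

(** * Proof rules *)

Section Rules.
Variables (U s : nat).
Implicit Types (r M : nat -> int) (Q : (nat -> int) -> (nat -> int) -> Prop).
Notation triple := (triple U s).

(** Makes the built-in bounds available inside a proof, for instance that a counter held in a
    variable is at most [U]. *)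
Lemma triple_bounded c r M T K Q :
  (bounded U r -> bounded U M -> triple c r M T K Q) -> triple c r M T K Q.
Proof. by move=> h W P p R h1 h2 h3 h4 h5 h6; apply: h. Qed.

Lemma triple_le c r M T K Q T' K' Q' : triple c r M T' K' Q' ->
  (T' <= T)%N -> (K' <= K)%N -> (forall r' M', Q' r' M' -> Q r' M') -> triple c r M T K Q.
Proof.
move=> h hT hK hQ W P p R h1 h2 h3 h4 h5 h6.
have [R' [M' [r' [t [k [q1 [q2 q3] q4 q5 q6]]]]]] := h W P p R h1 h2 h3 h4 h5 h6.
by exists R', M', r', t, k; split=> //; [rewrite (leq_trans q2) ?(leq_trans q3)|apply: hQ].
Qed.

Lemma triple_skip r M Q : Q r M -> triple CSkip r M 0 0 Q.
Proof.
move=> hQ W P p R h1 h2 h3 h4 h5 h6; exists R, M, r, 0%N, 0%N; split=> //.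
by rewrite addn0; apply: reach0.
Qed.

Lemma bounded_upd (r : nat -> int) x v : bounded U r -> (`|v| <= U)%N -> bounded U (upd r x v).
Proof. by move=> h hv y; rewrite /upd; case: eqP. Qed.

Lemma triple_asg x e r M Q : (`|eval r M e| <= U)%N -> Q (upd r x (eval r M e)) M ->
  triple (CAsg x e) r M (clen (CAsg x e)) 0 Q.
Proof.
move=> hv hQ W P p R U1 hW hc hR hr hM.
have [R1 r1 [g1 v1]] := ecode_correct s U1 hR hr hM hW (code_at_catl hc).
have hc1 := code_at_catr hc; have h1 := code_at_head (code_at_tail hc1).
pose v := eval r M e.
exists (upd (upd R1 (vreg x) 0) (vreg x) v), M, (upd r x v), (clen (CAsg x e)), 0%N; split=> //.
- rewrite /= !addnA; apply: (reach_trans0 r1); rewrite addn2.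
  apply: (reach_dst_cons (code_at_head hc1) (erefl _)).
    by apply: fitsU hW; rewrite absz0.
  apply: (reach_dst s h1); first by rewrite /= updE add0r /upd treg_vreg v1.
  by apply: fitsU hW; rewrite eval_bound.
- move=> y; rewrite /upd (inj_eq vreg_inj); case: eqP => // _.
  by rewrite g1.1 hR.
- by split=> //; apply: bounded_upd.
Qed.

Lemma triple_sto a e r M Q : (`|eval r M e| <= U)%N -> Q r (upd M `|eval r M a|%N (eval r M e)) ->
  triple (CSto a e) r M (clen (CSto a e)) 0 Q.
Proof.
move=> hv hQ W P p R U1 hW hc hR hr hM.
have hWa : (U ^ (esize a).*2.+2 < 2 ^ W)%N.
  by apply: leq_ltn_trans hW; rewrite leq_expU // leq_addr.
have hWe : (U ^ esize e < 2 ^ W)%N.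
  by apply: leq_ltn_trans hW; rewrite leq_expU // leq_addl.
have [R1 r1 [g1 v1]] := acode_correct s U1 hR hr hM hWa (code_at_catl hc).
have hc1 := code_at_catr hc.
have hR1 x : R1 (vreg x) = r x by rewrite g1.1.
have [R2 r2 [g2 v2]] := ecode_correct s U1 hR1 hr hM hWe (code_at_catl hc1).
have hc2 := code_at_head (code_at_catr hc1).
exists R2, (upd M `|eval r M a|%N (eval r M e)), r, (clen (CSto a e)), 0%N; split=> //.
- rewrite /= !addnA; apply: reach_trans0; first exact: reach_trans0 r1 r2.
  set q := (p + _ + _)%N in hc2 *.
  have hs : step s W P (Config q R2 M) =
      Some (Config (q + 1) R2 (upd M `|eval r M a|%N (eval r M e))).
    by rewrite /step /fetch /= hc2 g2.2 // v1 v2 addn1.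
  by have := reach_step hs; rewrite /tcost /kcost /fetch /= hc2.
- by move=> x; rewrite g2.1.
- by split=> //; apply: bounded_upd.
Qed.

Lemma triple_seq c1 c2 r M T1 K1 T2 K2 Q :
  triple c1 r M T1 K1 (fun r' M' => triple c2 r' M' T2 K2 Q) ->
  triple (CSeq c1 c2) r M (T1 + T2) (K1 + K2) Q.
Proof.
move=> h W P p R U1 hW hc hR hr hM.
have hW1 : (U ^ csize c1 < 2 ^ W)%N.
  by apply: leq_ltn_trans hW; rewrite leq_expU // leq_addr.
have hW2 : (U ^ csize c2 < 2 ^ W)%N.
  by apply: leq_ltn_trans hW; rewrite leq_expU // leq_addl.
have hc1 := code_at_catl hc; have := code_at_catr hc; rewrite size_ccode => hc2.
have [R' [M' [r' [t [k [q1 [q2 q3] q4 [q5 q6] q7]]]]]] := h W P p R U1 hW1 hc1 hR hr hM.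
have [R2 [M2 [r2 [t2 [k2 [w1 [w2 w3] w4 w5 w7]]]]]] := q7 W P _ R' U1 hW2 hc2 q4 q5 q6.
exists R2, M2, r2, (t + t2)%N, (k + k2)%N; split=> //.
  by rewrite /= addnA; apply: reach_trans q1 w1.
by split; apply: leq_add.
Qed.

(** The index of [I] is the number of iterations left, which gives termination; [T i] is the time of
    the iteration after which [i] are left. *)
Lemma triple_while e c n r M (T : nat -> nat) K Q (I : nat -> (nat -> int) -> (nat -> int) -> Prop) :
  I n r M ->
  (forall n r M, I n.+1 r M -> 0 < eval r M e /\ triple c r M (T n) K (I n)) ->
  (forall r M, I 0%N r M -> eval r M e <= 0 /\ Q r M) ->
  triple (CWhile e c) r M (\sum_(i < n) (T i + (size (ecode e 0) + 2)) + (size (ecode e 0) + 2)) (n * K) Q.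
Proof.
move=> hI hS h0; move: hI; elim: n r M => [|n IH] r M hI W P p R U1 hW hc hR hr hM.
all: have hWe : (U ^ esize e < 2 ^ W)%N
  by apply: leq_ltn_trans hW; rewrite leq_expU // leq_addr.
all: have [R1 r1 [g1 v1]] := ecode_correct s U1 hR hr hM hWe (code_at_catl hc).
all: have hc1 := code_at_catr hc; have j1 := code_at_head hc1; have j2 := code_at_head (code_at_tail hc1).
all: have hR1 x : R1 (vreg x) = r x by rewrite g1.1.
- have [he hQ] := h0 _ _ hI; rewrite -v1 in he.
  exists R1, M, r, (size (ecode e 0) + (1 + 1))%N, (0 + (0 + 0))%N; split=> //; first last.
  - by rewrite big_ord0.
  apply: reach_trans r1 _; set q := (p + _)%N in j1 j2 *.
  have hs1 : step s W P (Config q R1 M) = Some (Config q.+1 R1 M).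
    by rewrite /step /fetch /= j1 ltNge he.
  have hs2 : step s W P (Config q.+1 R1 M) = Some (Config (p + clen (CWhile e c)) R1 M).
    by rewrite /step /fetch /= j2; congr (Some (Config _ _ _)); rewrite /q /=; lia.
  apply: (@reach_trans _ _ _ _ _ _ (Config q.+1 R1 M)).
    by have := reach_step hs1; rewrite /tcost /kcost /fetch /= j1.
  by have := reach_step hs2; rewrite /tcost /kcost /fetch /= j2.
have [he hT] := hS _ _ _ hI; rewrite -v1 in he.
set q := (p + size (ecode e 0))%N in hc1 j1 j2 r1 *.
have := code_at_tail (code_at_tail hc1) => hc2.
have hWc : (U ^ csize c < 2 ^ W)%N.
  by apply: leq_ltn_trans hW; rewrite leq_expU // leq_addl.
have [R' [M' [r' [t [k [q1 [q2 q3] q4 [q5 q6] q7]]]]]] := hT W P _ R1 U1 hWc (code_at_catl hc2) hR1 hr hM.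
have := code_at_head (code_at_catr hc2); rewrite size_ccode => j3.
have [R2 [M2 [r2 [t2 [k2 [w1 [w2 w3] w4 w5 w7]]]]]] := IH _ _ q7 W P p R' U1 hW hc q4 q5 q6.
exists R2, M2, r2, (size (ecode e 0) + (1 + (t + (1 + t2))))%N, (0 + (0 + (k + (0 + k2))))%N; split=> //; last first.
  rewrite big_ord_recr mulSn /=; split; last by lia.
  by move: (\sum_(i < n) _)%N w2 => X w2; lia.
apply: reach_trans r1 _.
have hs1 : step s W P (Config q R1 M) = Some (Config q.+2 R1 M) by rewrite /step /fetch /= j1 he.
have hs3 : step s W P (Config (q.+2 + clen c) R' M') = Some (Config p R' M') by rewrite /step /fetch /= j3.
apply: (@reach_trans _ _ _ _ _ _ (Config q.+2 R1 M)).
  by have := reach_step hs1; rewrite /tcost /kcost /fetch /= j1.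
apply: (reach_trans q1).
apply: (@reach_trans _ _ _ _ _ _ (Config p R' M')); last exact: w1.
by have := reach_step hs3; rewrite /tcost /kcost /fetch /= j3.
Qed.

Lemma triple_ten a b d k r M Q :
  let A := `|eval r M a|%N in let B := `|eval r M b|%N in
  let D := `|eval r M d|%N in let N := `|eval r M k|%N in
  (s <= N)%N -> (forall x, (x < N * s)%N -> (`|tensor_entry s M A B x| <= U)%N) ->
  Q r (tensor_write s M A B D N) ->
  triple (CTen a b d k) r M (clen (CTen a b d k) + N * s) 1 Q.
Proof.
move=> A B D N hN hE hQ W P p R U1 hW hc hR hr hM.
have le z : (z <= csize (CTen a b d k))%N -> (U ^ z < 2 ^ W)%N.
  by move=> hz; apply: leq_ltn_trans hW; rewrite leq_expU.
have [R1 r1 [g1 v1]] := acode_correct s U1 hR hr hM (le _ (leq_addr _ _)) (code_at_catl hc).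
have {}hc := code_at_catr hc.
have hR1 x : R1 (vreg x) = r x by rewrite g1.1.
have [|R2 r2 [g2 v2]] := acode_correct s U1 hR1 hr hM (le _ _) (code_at_catl hc); first by rewrite /=; lia.
have {}hc := code_at_catr hc.
have hR2 x : R2 (vreg x) = r x by rewrite g2.1.
have [|R3 r3 [g3 v3]] := acode_correct s U1 hR2 hr hM (le _ _) (code_at_catl hc); first by rewrite /=; lia.
have {}hc := code_at_catr hc.
have hR3 x : R3 (vreg x) = r x by rewrite g3.1.
have [|R4 r4 [g4 v4]] := acode_correct s U1 hR3 hr hM (le _ _) (code_at_catl hc); first by rewrite /=; lia.
have {}hc := code_at_head (code_at_catr hc).
have e1 : R4 (treg 0) = A by rewrite g4.2 // g3.2 // g2.2.
have e2 : R4 (treg 1) = B by rewrite g4.2 // g3.2.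
have e3 : R4 (treg 2) = D by rewrite g4.2.
exists R4, (tensor_write s M A B D N), r, (size (acode a 0) + (size (acode b 1) + (size (acode d 2) + (size (acode k 3) + N * s))))%N, (0 + (0 + (0 + (0 + 1))))%N; split=> //.
- rewrite /= !addnA -3!addnA; apply: (reach_trans r1); apply: (reach_trans r2); apply: (reach_trans r3); apply: (reach_trans r4).
  set q := (p + _ + _ + _ + _)%N in hc *.
  have hs : step s W P (Config q R4 M) = Some (Config (q + 1) R4 (tensor_write s M A B D N)).
    rewrite /step /fetch /= hc e1 e2 e3 v4 /= hN /= addn1.
    case: forallP => //; case=> x; apply: fitsU (le 1%N _); last by rewrite /=; lia.
    by rewrite expn1 hE.
  by have := reach_step hs; rewrite /tcost /kcost /fetch /= hc v4.
- by split=> //=; lia.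
- by move=> x; rewrite g4.1.
- split=> // y; rewrite /tensor_write; case: ifP => // /andP[h1 h2].
  by apply: hE; lia.
Qed.
End Rules.

(** * Straight-line commands and counted loops *)

Fixpoint straight (c : cmd) : bool :=
  match c with
  | CSkip | CAsg _ _ | CSto _ _ => true
  | CSeq c1 c2 => straight c1 && straight c2
  | _ => false
  end.

(** An executable semantics: with [triple_run], straight-line code is handled by simplification. *)
Fixpoint run (c : cmd) (st : (nat -> int) * (nat -> int)) : (nat -> int) * (nat -> int) :=
  match c with
  | CAsg x e => (upd st.1 x (eval st.1 st.2 e), st.2)
  | CSto a e => (st.1, upd st.2 `|eval st.1 st.2 a|%N (eval st.1 st.2 e))
  | CSeq c1 c2 => run c2 (run c1 st)
  | _ => st
  end.

(** Only values that get stored must stay below [U]; intermediate values of expressions are covered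
    by [csize]. *)
Fixpoint chk (U : nat) (c : cmd) (st : (nat -> int) * (nat -> int)) : Prop :=
  match c with
  | CAsg _ e => (`|eval st.1 st.2 e| <= U)%N
  | CSto _ e => (`|eval st.1 st.2 e| <= U)%N
  | CSeq c1 c2 => chk U c1 st /\ chk U c2 (run c1 st)
  | _ => True
  end.

Definition agree (xs : seq nat) (r r' : nat -> int) := forall x, x \notin xs -> r' x = r x.

Lemma agree_trans xs r1 r2 r3 : agree xs r1 r2 -> agree xs r2 r3 -> agree xs r1 r3.
Proof. by move=> h1 h2 x hx; rewrite h2 ?h1. Qed.

Lemma agree_upd xs r r' x v : x \in xs -> agree xs r r' -> agree xs r (upd r' x v).
Proof. by move=> hx h y hy; rewrite /upd; case: eqP hy => [->|_ /h //]; rewrite hx. Qed.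

Lemma agree_sub xs ys r r' : {subset xs <= ys} -> agree xs r r' -> agree ys r r'.
Proof. by move=> hs h x hx; apply: h; apply: contra hx; apply: hs. Qed.

Definition For (i h : nat) (c : cmd) : cmd :=
  CSeq (CAsg i (EC 0)) (CWhile (ESub (EV h) (EV i)) (CSeq c (CAsg i (EAdd (EV i) (EC 1))))).

(* The numerals in the time bounds below are lengths of compiled straight-line
   code. *)
Section Loops.
Variables (U s : nat).
Implicit Types (r M : nat -> int) (Q : (nat -> int) -> (nat -> int) -> Prop).
Notation triple := (triple U s).

Lemma triple_run c r M T Q : straight c ->
  (bounded U r -> bounded U M -> chk U c (r, M) /\ Q (run c (r, M)).1 (run c (r, M)).2) ->
  (clen c <= T)%N -> triple c r M T 0 Q.
Proof.
move=> hc h hT; apply: (@triple_le _ _ _ _ _ _ _ _ (clen c) 0 Q) => // {hT}.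
apply: triple_bounded => hr hM; have {h hr hM} [] := h hr hM.
elim: c r M Q hc => [|x e|a e|a b d k|c1 IH1 c2 IH2|e c IH] r M Q //=.
- by move=> _ _; apply: triple_skip.
- by move=> _; apply: triple_asg.
- by move=> _; apply: triple_sto.
move=> /andP[h1 h2] [k1 k2] hQ; apply: (@triple_seq _ _ _ _ _ _ _ 0 _ 0).
by apply: IH1 => //; apply: IH2; rewrite -?surjective_pairing.
Qed.

(** The iterations may have different costs, as the levels of a transform do. The invariant is
    required for the incremented counter, so that bodies need not treat the increment. *)
Lemma triple_for_sum i h c N (T : nat -> nat) K r M Q (I : nat -> (nat -> int) -> (nat -> int) -> Prop) :
  h != i -> r h = N%:Z -> I 0%N (upd r i 0) M ->
  (forall j r M, (j < N)%N -> r i = j%:Z -> r h = N%:Z -> I j r M ->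
     triple c r M (T j) K (fun r' M' => [/\ r' i = j%:Z, r' h = N%:Z & I j.+1 (upd r' i j.+1%:Z) M'])) ->
  (forall r M, r i = N%:Z -> r h = N%:Z -> I N r M -> Q r M) ->
  triple (For i h c) r M (\sum_(j < N) (T j + 13) + 10) (N * K) Q.
Proof.
move=> hi hN I0 IS IN.
(* The while rule counts iterations left, hence the reversed index. 13 is the increment (6) plus
   guard and jumps (7); 10 is the initialization (3) plus the last guard (7). *)
have -> : (\sum_(j < N) (T j + 13) + 10 =
           3 + (\sum_(j < N) (T (N - j.+1) + 6 + (5 + 2)) + (5 + 2)))%N.
  rewrite [in LHS](reindex_inj rev_ord_inj) /= addnC [in RHS]addnCA addnC; congr (_ + _)%N.
  by apply: eq_bigr => j _; rewrite -addnA.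
apply: triple_bounded => hr hM; have hNU : (N <= U)%N by have := hr h; rewrite hN.
apply: (@triple_seq _ _ _ _ _ _ 3 0).
apply: triple_asg => //=.
pose I' n r M := exists j, [/\ (j + n = N)%N, r i = j%:Z, r h = N%:Z & I j r M].
apply: (@triple_while _ _ (ESub (EV h) (EV i)) _ _ _ _ (fun j => T (N - j.+1) + 6)%N _ _ I').
- by exists 0%N; rewrite add0n /upd eqxx (negbTE hi).
- move=> n r' M' [j [hj ri rh hI]] /=; split; first by rewrite ri rh; lia.
  rewrite -[K]addn0; apply: (@triple_seq _ _ _ _ _ _ _ K 6).
  have hjN : (j < N)%N by lia.
  have -> : (N - n.+1 = j)%N by lia.
  apply: (triple_le (IS _ _ _ hjN ri rh hI)) => // r2 M2 [r2i r2h hI2].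
  have e1 : r2 i + 1 = j.+1%:Z by rewrite r2i; lia.
  apply: (@triple_asg _ _ i (EAdd (EV i) (EC 1))); rewrite /= e1; first by lia.
  by exists j.+1; rewrite {1 2}/upd eqxx (negbTE hi); split=> //; lia.
- move=> r' M' [j [hj ri rh hI]] /=; rewrite addn0 in hj; subst j.
  by rewrite ri rh subrr; split=> //; apply: IN.
Qed.

Lemma triple_for i h c N T K r M Q (I : nat -> (nat -> int) -> (nat -> int) -> Prop) :
  h != i -> r h = N%:Z -> I 0%N (upd r i 0) M ->
  (forall j r M, (j < N)%N -> r i = j%:Z -> r h = N%:Z -> I j r M ->
     triple c r M T K (fun r' M' => [/\ r' i = j%:Z, r' h = N%:Z & I j.+1 (upd r' i j.+1%:Z) M'])) ->
  (forall r M, r i = N%:Z -> r h = N%:Z -> I N r M -> Q r M) ->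
  triple (For i h c) r M (N * (T + 13) + 10) (N * K) Q.
Proof.
move=> h1 h2 h3 h4 h5; rewrite -[X in (X * (T + 13))%N]card_ord -sum_nat_const.
exact: (@triple_for_sum _ _ _ _ (fun=> T) _ _ _ _ I).
Qed.

(** For loops whose invariant concerns memory only: registers outside [xs] are those of the start of
    the loop. *)
Lemma triple_for_mem xs i h c N T K r M Q (I : nat -> (nat -> int) -> Prop) :
  i \in xs -> h \notin xs -> r h = N%:Z -> I 0%N M ->
  (forall j r' M', (j < N)%N -> agree xs r r' -> r' i = j%:Z -> I j M' ->
     triple c r' M' T K (fun r2 M2 => [/\ agree xs r r2, r2 i = j%:Z & I j.+1 M2])) ->
  (forall r' M', agree xs r r' -> I N M' -> Q r' M') ->
  triple (For i h c) r M (N * (T + 13) + 10) (N * K) Q.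
Proof.
move=> hi hh hN I0 IS IN.
have ih : h != i by apply: contraNneq hh => ->.
apply: (@triple_for _ _ _ _ _ _ _ _ _ (fun j r' M' => agree xs r r' /\ I j M')) => //.
- by split=> //; apply: agree_upd.
- move=> j r' M' hj ri rh [ag hI]; apply: (triple_le (IS _ _ _ hj ag ri hI)) => // r2 M2 [h1 h2 h3].
  by split=> //; [rewrite h1|split=> //; apply: agree_upd].
- by move=> r' M' _ _ [h1 h2]; apply: IN.
Qed.
End Loops.

(** Work space is allocated upwards, so preservation of all cells below an address serves as frame
    condition. *)
Definition keep (w : nat) (M M' : nat -> int) := forall y, (y < w)%N -> M' y = M y.

Lemma keep_trans w M1 M2 M3 : keep w M1 M2 -> keep w M2 M3 -> keep w M1 M3.
Proof. by move=> h1 h2 y hy; rewrite h2 ?h1. Qed.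

Lemma keep_le w w' M M' : (w' <= w)%N -> keep w M M' -> keep w' M M'.
Proof. by move=> hw h y hy; apply: h; apply: leq_trans hw. Qed.

Definition block (M : nat -> int) (b l : nat) (f : nat -> int) :=
  forall x, (x < l)%N -> M (b + x)%N = f x.

Lemma block_keep w M M' b l f : (b + l <= w)%N -> keep w M M' -> block M b l f -> block M' b l f.
Proof. by move=> hw hk h x hx; rewrite hk ?h //; lia. Qed.

(** * The multiplication of matrices stored by blocks *)

Lemma sum_ord_mul (V : nmodType) a b (F : nat -> V) :
  \sum_(i < a * b) F i = \sum_(i < a) \sum_(j < b) F (i * b + j)%N.
Proof.
elim: a => [|a IH]; first by rewrite !big_ord0.
rewrite big_ord_recr /= -IH -(big_mkord xpredT F) -(big_mkord xpredT F).
rewrite mulSnr (@big_cat_nat _ _ _ (a * b)) ?leq_addr //=; congr (_ + _).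
rewrite -[X in \sum_(X <= _ < _) _]add0n big_addn addKn big_mkord.
by apply: eq_bigr => j _; rewrite addnC.
Qed.

Section BlockTransforms.
Variables (q p s : nat).
Hypothesis s0 : (0 < s)%N.
Hypothesis q0 : (0 < q)%N.
Hypothesis p0 : (0 < p)%N.

Definition side L := (q ^ L * s)%N.
Definition msize L := ((q * q) ^ L * (s * s))%N.
Definition psize L := (p ^ L * (s * s))%N.

(* A matrix of side q ^ L s is stored as its q * q blocks, each of them stored
   recursively; pos gives the position of an entry. *)
Fixpoint pos L (i j : nat) : nat :=
  if L is L'.+1 then
    ((i %/ side L' * q + j %/ side L') * msize L' + pos L' (i %% side L') (j %% side L'))%N
  else (i * s + j)%N.

(** The L-th tensor power of the p x (q * q) matrix [al]: segment [t] of the output encodes the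
    combination [al t] of the blocks of [f], that is, the left or right factor of the t-th recursive
    call. *)
Fixpoint enc (al : nat -> nat -> int) L (f : nat -> int) (y : nat) : int :=
  if L is L'.+1 then
    enc al L' (fun x => linear_form (q * q) (al (y %/ psize L')%N) (fun c => f (c * msize L' + x)%N))
      (y %% psize L')
  else f y.

(** The arrays are sequences of s x s matrices stored by rows, multiplied pairwise; [y %% s] is the
    column because [s] divides [s * s]. *)
Definition leaf (E F : nat -> int) (y : nat) : int :=
  \sum_(j < s) E (y %/ (s * s) * (s * s) + y %% (s * s) %/ s * s + j)%N *
               F (y %/ (s * s) * (s * s) + (j * s + y %% s))%N.

(** The L-th tensor power of [ga], from the products back to the blocks. *)
Fixpoint dec (ga : nat -> nat -> int) L (h : nat -> int) (x : nat) : int :=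
  if L is L'.+1 then
    linear_form p (ga (x %/ msize L')%N)
      (fun t => dec ga L' (fun y => h (t * psize L' + y)%N) (x %% msize L'))
  else h x.

Lemma sideE L : side L = (q ^ L * s)%N. Proof. by []. Qed.
Lemma msizeE L : msize L = ((q * q) ^ L * (s * s))%N. Proof. by []. Qed.
Lemma psizeE L : psize L = (p ^ L * (s * s))%N. Proof. by []. Qed.

Lemma side_gt0 L : (0 < side L)%N. Proof. by rewrite muln_gt0 expn_gt0 q0. Qed.
Lemma msize_gt0 L : (0 < msize L)%N. Proof. by rewrite !muln_gt0 expn_gt0 muln_gt0 q0 s0. Qed.
Lemma psize_gt0 L : (0 < psize L)%N. Proof. by rewrite !muln_gt0 expn_gt0 p0 s0. Qed.
Lemma sideS L : side L.+1 = (q * side L)%N. Proof. by rewrite /side expnS mulnA. Qed.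
Lemma msizeS L : msize L.+1 = (q * q * msize L)%N. Proof. by rewrite /msize expnS !mulnA. Qed.
Lemma psizeS L : psize L.+1 = (p * psize L)%N. Proof. by rewrite /psize expnS !mulnA. Qed.
Lemma msize_side L : msize L = (side L * side L)%N.
Proof. by rewrite /msize /side expnMn; ring. Qed.

Lemma pos_lt L i j : (i < side L)%N -> (j < side L)%N -> (pos L i j < msize L)%N.
Proof.
clear p0; elim: L i j => [|L IH] i j hi hj /=.
  by move: hi hj; rewrite /msize /side !mul1n; nia.
have [di dj] : (i %/ side L < q)%N /\ (j %/ side L < q)%N.
  by rewrite !ltn_divLR ?side_gt0 // -sideS.
have := IH (i %% side L)%N (j %% side L)%N; rewrite !ltn_mod side_gt0 msizeS => /(_ isT isT).
have hX : (i %/ side L * q + j %/ side L < q * q)%N by nia.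
by move: (q * q)%N hX => Q hX; nia.
Qed.

Lemma pos_inj L i j i' j' : (i < side L)%N -> (j < side L)%N -> (i' < side L)%N -> (j' < side L)%N ->
  pos L i j = pos L i' j' -> i = i' /\ j = j'.
Proof.
elim: L i j i' j' => [|L IH] i j i' j' hi hj hi' hj' /=.
  have e : side 0 = s by rewrite /side mul1n.
  rewrite e in hi hj hi' hj'; move/eqP; rewrite eq_mulnD // => /andP[/eqP -> /eqP ->] //.
have dv k : (k < side L.+1 -> k %/ side L < q)%N by move=> h; rewrite ltn_divLR ?side_gt0 // -sideS.
have md k : (k %% side L < side L)%N by rewrite ltn_mod side_gt0.
move/eqP; rewrite eq_mulnD ?pos_lt // => /andP[+ /eqP /IH]; rewrite eq_mulnD ?dv //.
move=> /andP[/eqP e1 /eqP e2] /(_ (md _) (md _) (md _) (md _)) [e3 e4].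
by rewrite (divn_eq i (side L)) (divn_eq j (side L)) e1 e2 e3 e4 -!divn_eq.
Qed.

Lemma encS al L f t y : (y < psize L)%N ->
  enc al L.+1 f (t * psize L + y) =
  enc al L (fun x => linear_form (q * q) (al t) (fun c => f (c * msize L + x)%N)) y.
Proof.
move=> hy; rewrite /= modnMDl modn_small //.
by rewrite divnMDl ?psize_gt0 // divn_small // addn0.
Qed.

Lemma decS ga L h c x : (x < msize L)%N ->
  dec ga L.+1 h (c * msize L + x) =
  linear_form p (ga c) (fun t => dec ga L (fun y => h (t * psize L + y)%N) x).
Proof.
move=> hx; rewrite /= modnMDl modn_small //.
by rewrite divnMDl ?msize_gt0 // divn_small // addn0.
Qed.

Lemma enc_ext al L f f' y : (forall x, (x < msize L)%N -> f x = f' x) -> (y < psize L)%N ->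
  enc al L f y = enc al L f' y.
Proof.
elim: L f f' y => [|L IH] f f' y hf hy /=.
  by apply: hf; move: hy; rewrite /psize /msize !expn0.
apply: IH; last by rewrite ltn_mod psize_gt0.
move=> x hx; apply: eq_bigr => c _; rewrite hf // msizeS.
by have := ltn_ord c; nia.
Qed.

Lemma dec_ext ga L h h' x : (forall y, (y < psize L)%N -> h y = h' y) -> (x < msize L)%N ->
  dec ga L h x = dec ga L h' x.
Proof.
elim: L h h' x => [|L IH] h h' x hh hx /=.
  by apply: hh; move: hx; rewrite /psize /msize !expn0.
apply: eq_bigr => t _; congr (_ * _); apply: IH; last by rewrite ltn_mod msize_gt0.
by move=> y hy; apply: hh; rewrite psizeS; have := ltn_ord t; nia.
Qed.

Lemma leaf_idx y j Z : (j < s)%N -> (y < Z * (s * s))%N ->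
  (y %/ (s * s) * (s * s) + y %% (s * s) %/ s * s + j < Z * (s * s))%N /\
  (y %/ (s * s) * (s * s) + (j * s + y %% s) < Z * (s * s))%N.
Proof.
clear q0 p0 => hj hy; have ss0 : (0 < s * s)%N by rewrite muln_gt0 s0.
have h1 : (y %/ (s * s) < Z)%N by rewrite ltn_divLR.
have h2 : (y %% (s * s) %/ s < s)%N by rewrite ltn_divLR // ltn_mod.
have h3 : (y %% s < s)%N by rewrite ltn_mod.
move: (y %/ (s * s))%N (y %% (s * s) %/ s)%N (y %% s)%N h1 h2 h3 => a b c h1 h2 h3.
have h4 : (b * s + j < s * s)%N by nia.
have h5 : (j * s + c < s * s)%N by nia.
by move: (s * s)%N (b * s)%N (j * s)%N h4 h5 => m bb jj h4 h5; split; nia.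
Qed.

Lemma leaf_ext Z E F E' F' y : (forall x, (x < Z * (s * s))%N -> E x = E' x) ->
  (forall x, (x < Z * (s * s))%N -> F x = F' x) -> (y < Z * (s * s))%N -> leaf E F y = leaf E' F' y.
Proof.
move=> hE hF hy; apply: eq_bigr => j _; have [h1 h2] := leaf_idx (ltn_ord j) hy.
by rewrite hE ?hF.
Qed.

Lemma leaf_shift E F Z y :
  leaf E F (Z * (s * s) + y) = leaf (fun x => E (Z * (s * s) + x)%N) (fun x => F (Z * (s * s) + x)%N) y.
Proof.
have ss0 : (0 < s * s)%N by rewrite muln_gt0 s0.
rewrite /leaf; apply: eq_bigr => j _.
have e : ((Z * (s * s) + y) %% s = y %% s)%N by rewrite mulnA modnMDl.
rewrite divnMDl // modnMDl e mulnDl.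
by congr (E _ * F _); rewrite !addnA.
Qed.

(** Scalars suffice for the bilinear identity: once the sum over the products is exchanged with that
    over the inner index [j], the identity is applied, for each [j], to the entries at one fixed
    position of every block. Each level contributes a factor [D]. *)
Lemma product_correct (al be ga : nat -> nat -> int) (D : int) L f g i k :
  bilinear_algorithm q p al be ga D -> (i < side L)%N -> (k < side L)%N ->
  dec ga L (leaf (enc al L f) (enc be L g)) (pos L i k) =
  D ^+ L * \sum_(j < side L) f (pos L i j) * g (pos L j k).
Proof.
move=> HB; elim: L f g i k => [|L IH] f g i k hi hk.
  have e : side 0 = s by rewrite /side mul1n.
  rewrite e in hi hk *; have hik : (i * s + k < s * s)%N by nia.
  rewrite expr0 mul1r /= /leaf; apply: eq_bigr => j _.
  rewrite divn_small // modn_small // mul0n !add0n divnMDl // divn_small // addn0.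
  by rewrite modnMDl [(k %% s)%N]modn_small.
have dv x : (x < side L.+1 -> x %/ side L < q)%N by move=> h; rewrite ltn_divLR ?side_gt0 // -sideS.
have md x : (x %% side L < side L)%N by rewrite ltn_mod side_gt0.
set I := (i %/ side L)%N; set i' := (i %% side L)%N; set K := (k %/ side L)%N; set k' := (k %% side L)%N.
have hx : (pos L i' k' < msize L)%N by rewrite pos_lt // md.
rewrite [pos L.+1 i k]/= -/I -/K -/i' -/k' decS //.
pose ft t x := linear_form (q * q) (al t) (fun c => f (c * msize L + x)%N).
pose gt t x := linear_form (q * q) (be t) (fun c => g (c * msize L + x)%N).
transitivity (\sum_(t < p) ga (I * q + K)%N t * (D ^+ L * \sum_(j < side L) ft t (pos L i' j) * gt t (pos L j k'))).
  apply: eq_bigr => t _; congr (_ * _); rewrite -IH ?md //; apply: dec_ext hx => y hy.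
  have -> : (t * psize L + y = (t * p ^ L) * (s * s) + y)%N by rewrite /psize mulnA.
  rewrite leaf_shift; apply: (@leaf_ext (p ^ L)) hy => x hx'; rewrite -mulnA -/(psize L) encS //.
have swap : \sum_(t < p) ga (I * q + K)%N t * (D ^+ L * \sum_(j < side L) ft t (pos L i' j) * gt t (pos L j k')) =
   D ^+ L * \sum_(j < side L) \sum_(t < p) ga (I * q + K)%N t * (ft t (pos L i' j) * gt t (pos L j k')).
  rewrite exchange_big /= mulr_sumr; apply: eq_bigr => t _.
  by rewrite -mulr_sumr mulrCA.
rewrite swap exprSr -mulrA; congr (_ * _).
under eq_bigr do rewrite HB ?dv //.
rewrite -mulr_sumr; congr (_ * _).
rewrite sideS (sum_ord_mul q (side L) (fun j => f (pos L.+1 i j) * g (pos L.+1 j k))) exchange_big /=; apply: eq_bigr => J _; apply: eq_bigr => j _.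
by rewrite !divnMDl ?side_gt0 // !modnMDl (divn_small (ltn_ord j)) (modn_small (ltn_ord j)) addn0.
Qed.
End BlockTransforms.

(** * The program for one linear transform *)

Fixpoint unroll (n : nat) (f : nat -> cmd) : cmd :=
  if n is n'.+1 then CSeq (unroll n' f) (f n') else CSkip.

Fixpoint esum (n : nat) (f : nat -> expr) : expr :=
  if n is n'.+1 then EAdd (esum n' f) (f n') else EC 0.

Lemma eval_esum r M n f : eval r M (esum n f) = \sum_(i < n) eval r M (f i).
Proof. by elim: n => [|n IH] /=; rewrite ?big_ord0 // big_ord_recr /= IH. Qed.

Definition cell (v w k c S x : nat) : expr :=
  EAdd (EV v) (EAdd (EMul (EAdd (EMul (EV w) (EC k%:Z)) (EC c%:Z)) (EV S)) (EV x)).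

(* The array at address r_40, of shape r_42 x a x r_43, is multiplied along its
   second index by the b x a matrix cf. *)
Definition xform (cf : nat -> nat -> int) (a b : nat) : cmd :=
  For 44 42 (For 45 43 (unroll b (fun j =>
    CSto (cell 41 44 b j 43 45)
      (esum a (fun c => EMul (EC (cf j c)) (ELoad (cell 40 44 a c 43 45))))))).

(** The loops over the size of the base algorithm are unrolled with the coefficients as constants,
    so this depends on the base algorithm only. *)
Definition xform_cost cf a b : nat :=
  clen (unroll b (fun j =>
    CSto (cell 41 44 b j 43 45)
      (esum a (fun c => EMul (EC (cf j c)) (ELoad (cell 40 44 a c 43 45)))))).

Lemma leq_absz_add (a b : int) : (`|(a + b)%R| <= `|a| + `|b|)%N.
Proof. lia. Qed.

Lemma absz_linear_form (a A B : nat) (cf f : nat -> int) :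
  (\sum_(c < a) `|cf c| <= A)%N -> (forall c, (c < a)%N -> (`|f c| <= B)%N) ->
  (`|linear_form a cf f| <= A * B)%N.
Proof.
move=> hA hB; apply: leq_trans (_ : (\sum_(c < a) `|cf c| * B <= _)%N); last first.
  by rewrite -big_distrl leq_mul2r hA orbT.
rewrite /linear_form; elim: a {hA} hB => [|a IH] hB; first by rewrite !big_ord0.
rewrite !big_ord_recr /=.
have h1 : (`|(\sum_(i < a) cf i * f i)%R| <= \sum_(i < a) `|cf i| * B)%N.
  by apply: IH => c hc; apply: hB; lia.
have h2 : (`|(cf a * f a)%R| <= `|cf a| * B)%N by rewrite abszM leq_mul2l hB ?orbT.
exact: leq_trans (leq_absz_add _ _) (leq_add h1 h2).
Qed.

Section Transform.
Variables (U s : nat).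
Notation triple := (triple U s).

Lemma triple_unroll n f r M (I : nat -> (nat -> int) -> (nat -> int) -> Prop) :
  I 0%N r M ->
  (forall j r M, (j < n)%N -> I j r M -> triple (f j) r M (clen (f j)) 0 (I j.+1)) ->
  triple (unroll n f) r M (clen (unroll n f)) 0 (I n).
Proof.
move=> I0; elim: n => [|n IH] IS /=; first exact: triple_skip.
apply: (@triple_seq _ _ _ _ _ _ _ 0 _ 0).
apply: (@triple_le _ _ _ _ _ _ _ _ _ _ (I n) (IH _)) => // [j r' M' hj|r' M' hI].
  by apply: IS; lia.
exact: IS.
Qed.

Lemma index_inj S a b x y : (x < S)%N -> (y < S)%N -> (a * S + x = b * S + y)%N -> a = b /\ x = y.
Proof. by move=> hx hy /eqP; rewrite eq_mulnD // => /andP[/eqP -> /eqP ->]. Qed.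

Lemma leq_index G b S g j x : (g < G)%N -> (j < b)%N -> (x < S)%N ->
  ((g * b + j) * S + x < G * b * S)%N.
Proof.
move=> hg hj hx; have h : (g * b + j < G * b)%N by nia.
by move: (g * b + j)%N (G * b)%N h => u v h; nia.
Qed.

Lemma triple_xform (cf : nat -> nat -> int) a b src dst G S A B (f r M : nat -> int) :
  r 40 = src%:Z -> r 41 = dst%:Z -> r 42 = G%:Z -> r 43 = S%:Z ->
  block M src (G * a * S) f -> (src + G * a * S <= dst)%N -> 
  (forall x, (x < G * a * S)%N -> (`|f x| <= B)%N) ->
  (forall j, (j < b)%N -> \sum_(c < a) `|cf j c| <= A)%N -> (A * B <= U)%N ->
  triple (xform cf a b) r M (G * (S * (xform_cost cf a b + 13) + 10 + 13) + 10) 0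
    (fun r' M' => [/\ agree [:: 44; 45]%N r r', keep dst M M' &
       forall g j x, (g < G)%N -> (j < b)%N -> (x < S)%N ->
         M' (dst + ((g * b + j) * S + x))%N =
         linear_form a (cf j) (fun c => f ((g * a + c) * S + x)%N)]).
Proof.
move=> r40 r41 r42 r43 hf hd hB hA hU.
pose V g j x := linear_form a (cf j) (fun c => f ((g * a + c) * S + x)%N).
(* [D] is the set of index triples already written. They are visited in the lexicographic order of
   (g, x, j), the innermost loop over [j] being the unrolled one. *)
pose I (D : nat -> nat -> nat -> bool) M' := keep dst M M' /\ forall g j x,
  (g < G)%N -> (j < b)%N -> (x < S)%N -> D g j x -> M' (dst + ((g * b + j) * S + x))%N = V g j x.
have Isub (D D' : nat -> nat -> nat -> bool) M' :
    (forall g j x, (j < b)%N -> (x < S)%N -> D' g j x -> D g j x) -> I D M' -> I D' M'.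
  by move=> hD [h1 h2]; split=> // g j x hg hj hx hD'; apply: h2 => //; apply: hD.
rewrite /xform -[X in triple _ _ _ _ X _](muln0 G).
apply: (@triple_for_mem _ _ [:: 44; 45]%N _ _ _ G _ 0 _ _ _
  (fun g => I (fun g' _ _ => (g' < g)%N))) => //.
- move=> g r1 M1 hg ag1 r1g hI.
  rewrite -[X in triple _ _ _ _ X _](muln0 S).
  apply: (@triple_for_mem _ _ [:: 45]%N _ _ _ S _ 0 _ _ _
    (fun x => I (fun g' _ x' => (g' < g) || (g' == g) && (x' < x))%N)) => //.
  + by rewrite ag1.
  + apply: Isub hI => g' j' x' _ _; rewrite ltn0 andbF orbF //.
  + move=> x r2 M2 hx ag2 r2x hI2.
    have e40 : r2 40%N = src%:Z by rewrite ag2 // ag1.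
    have e41 : r2 41%N = dst%:Z by rewrite ag2 // ag1.
    have e43 : r2 43%N = S%:Z by rewrite ag2 // ag1.
    have e44 : r2 44%N = g%:Z by rewrite ag2.
    apply: (@triple_le _ _ _ _ _ _ _ _ _ _ (fun r3 M3 => r3 = r2 /\
      I (fun g' j' x' => (g' < g) || (g' == g) && ((x' < x) || (x' == x) && (j' < b)))%N M3)); last first.
    * move=> r3 M3 [-> hI3]; split=> //.
      apply: Isub hI3 => g' j' x' hj' _ /orP[->//|/andP[/eqP -> hx']].
      by rewrite eqxx hj' andbT /=; move: hx'; rewrite ltnS leq_eqVlt orbC => ->; rewrite orbT.
    * exact: leqnn.
    * exact: leqnn.
    apply: (@triple_unroll _ _ _ _ (fun j r3 M3 => r3 = r2 /\
      I (fun g' j' x' => (g' < g) || (g' == g) && ((x' < x) || (x' == x) && (j' < j)))%N M3)).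
      split=> //; apply: Isub hI2 => g' j' x' _ _ /orP[->//|/andP[-> /orP[->|]]]; rewrite ?orbT //.
      by rewrite ltn0 andbF.
    move=> j r3 M3 hj [-> {r3} [k3 hI3]].
    have eD : eval r2 M3 (cell 41 44 b j 43 45) = (dst + ((g * b + j) * S + x))%N%:Z.
      by rewrite /= e41 e43 e44 r2x !PoszD !PoszM !PoszD !PoszM.
    have hidx c : (c < a)%N -> ((g * a + c) * S + x < G * a * S)%N by move=> hc; apply: leq_index.
    have eV : eval r2 M3 (esum a (fun c => EMul (EC (cf j c)) (ELoad (cell 40 44 a c 43 45)))) = V g j x.
      rewrite eval_esum; apply: eq_bigr => c _.
      have eL : eval r2 M3 (cell 40 44 a c 43 45) = (src + ((g * a + c) * S + x))%N%:Z.
        by rewrite /= e40 e43 e44 r2x !PoszD !PoszM !PoszD !PoszM.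
      rewrite -[LHS]/(cf j c * M3 `|eval r2 M3 (cell 40 44 a c 43 45)|%N) eL.
      have := hidx c (ltn_ord c); set ix := ((g * a + c) * S + x)%N => hix.
      by rewrite absz_nat k3 ?hf //; lia.
    apply: triple_sto.
      rewrite eV; apply: leq_trans hU; apply: absz_linear_form (hA j hj) _ => c hc.
      by apply: hB; apply: hidx.
    split=> //; rewrite eV eD absz_nat; split.
      by move=> y hy; rewrite /upd; case: eqP => [e|_]; [lia|apply: k3].
    move=> g' j' x' hg' hj' hx' hD; rewrite /upd eqn_add2l.
    case: eqP => [/(index_inj hx' hx)[/(index_inj hj' hj)[-> ->] ->] //|ne].
    apply: hI3 => //; move: hD ne.
    case: (ltngtP g' g) => //= ->; case: (ltngtP x' x) => //= ->; rewrite ltnS leq_eqVlt.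
    by case: (j' =P j) => [-> _ ne|_ /=]; [case: ne|move=> ->].
  + move=> r2 M2 ag2 hI2; split.
    * by apply: agree_trans ag1 (agree_sub _ ag2) => y; rewrite !inE => ->; rewrite orbT.
    * by rewrite ag2.
    * apply: Isub hI2 => g' j' x' _ hx'; rewrite ltnS leq_eqVlt hx' andbT orbC //.
- move=> r' M' ag [k hI]; split=> // g j x hg hj hx; exact: hI.
Qed.
End Transform.

Definition seqc : seq cmd -> cmd := foldr CSeq CSkip.

(** The sum satisfies S_(L+1) = a S_L + b ^ L, and a + 1 <= b. With [a = q * q] and [b = p], all
    levels together cost no more than the leaves, without a factor L. *)
Lemma geometric_sum_le a b L : (a < b)%N -> (\sum_(j < L) b ^ j * a ^ (L - j.+1) <= b ^ L)%N.
Proof.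
move=> hab; elim: L => [|L IH]; first by rewrite big_ord0.
rewrite big_ord_recr /= subnn muln1.
have -> : (\sum_(i < L) b ^ i * a ^ (L.+1 - i.+1) = a * \sum_(i < L) b ^ i * a ^ (L - i.+1))%N.
  rewrite big_distrr /=; apply: eq_bigr => i _.
  by rewrite subSS mulnCA -expnS subnSK.
by rewrite expnS; nia.
Qed.

Lemma geometric_sum_rev_le a b L : (a < b)%N -> (\sum_(j < L) b ^ (L - j.+1) * a ^ j <= b ^ L)%N.
Proof.
move=> hab; apply: leq_trans (geometric_sum_le L hab); apply: eq_leq.
rewrite [RHS](reindex_inj rev_ord_inj) /=; apply: eq_bigr => j _.
by congr (_ * _ ^ _)%N; have := ltn_ord j; lia.
Qed.

Lemma leq_expn2 a b e : (a <= b -> a ^ e <= b ^ e)%N.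
Proof. by case: e => // e; rewrite leq_exp2r. Qed.

Lemma absz_sum n B (F : nat -> int) : (forall i, (i < n)%N -> (`|F i| <= B)%N) ->
  (`|(\sum_(i < n) F i)%R| <= n * B)%N.
Proof.
move=> hF; rewrite (eq_bigr (fun i : 'I_n => 1 * F i)) => [|i _]; last by rewrite mul1r.
by apply: (@absz_linear_form n n B (fun=> 1) F) => //; rewrite sum_nat_const card_ord muln1.
Qed.

Lemma ltn_mulD a b S x : (a < b -> x < S -> a * S + x < b * S)%N.
Proof. by nia. Qed.

(** * Encoding, leaf products and decoding as programs *)

Section Multiply.
Variables (q p : nat).
Hypothesis q0 : (0 < q)%N.
Hypothesis qp : (q * q < p)%N.

Let p0 : (0 < p)%N. Proof. exact: leq_ltn_trans qp. Qed.

(** [r_40] is the current array, [r_31] the first free address, [r_33] the number of segments and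
    [r_34] their size. Each level writes its output at the free address and moves on. *)
Definition encode (al : nat -> nat -> int) : cmd :=
  CSeq (seqc [:: CAsg 33 (EC 1); CAsg 34 (EV 5)])
  (For 32 3
    (CSeq (seqc [:: CAsg 34 (EDiv (EV 34) (EC (q * q)%N%:Z)); CAsg 41 (EV 31); CAsg 42 (EV 33);
                    CAsg 43 (EV 34)])
    (CSeq (xform al (q * q) p)
          (seqc [:: CAsg 33 (EMul (EV 33) (EC p%:Z)); CAsg 40 (EV 31);
                    CAsg 31 (EAdd (EV 31) (EMul (EV 33) (EV 34)))])))).

Definition decode (ga : nat -> nat -> int) : cmd :=
  CSeq (seqc [:: CAsg 33 (EV 7); CAsg 34 (EV 2)])
  (For 32 3
    (CSeq (seqc [:: CAsg 33 (EDiv (EV 33) (EC p%:Z)); CAsg 41 (EV 31); CAsg 42 (EV 33);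
                    CAsg 43 (EV 34)])
    (CSeq (xform ga p (q * q))
          (seqc [:: CAsg 34 (EMul (EV 34) (EC (q * q)%N%:Z)); CAsg 40 (EV 31);
                    CAsg 31 (EAdd (EV 31) (EMul (EV 33) (EV 34)))])))).

Definition leaves : cmd :=
  CSeq (For 32 7
    (let at_leaf v := EAdd (EV v) (EMul (EV 32) (EV 2)) in
     CTen (at_leaf 22) (at_leaf 23) (at_leaf 31) (EV 1)))
  (seqc [:: CAsg 40 (EV 31); CAsg 31 (EAdd (EV 31) (EV 6))]).

Definition work_vars : seq nat := [:: 31; 32; 33; 34; 40; 41; 42; 43; 44; 45]%N.

Section Run.
Variables (U s : nat).
Hypothesis s0 : (0 < s)%N.
Notation triple := (triple U s).
Notation msize := (msize q s).
Notation psize := (psize p s).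

Lemma leq_exp_msize_psize j L : (j <= L)%N -> (p ^ j * msize (L - j) <= psize L)%N.
Proof.
move=> hj; rewrite !psizeE !msizeE -{2}(subnKC hj) expnD -mulnA leq_mul2l leq_mul2r.
by rewrite leq_expn2 ?orbT // ltnW.
Qed.

Lemma triple_encode (cf : nat -> nat -> int) src w L A B (f r M : nat -> int) :
  r 3%N = L%:Z -> r 5%N = (msize L)%:Z -> r 40%N = src%:Z -> r 31%N = w%:Z ->
  block M src (msize L) f -> (src + msize L <= w)%N ->
  (forall x, (x < msize L)%N -> (`|f x| <= B)%N) ->
  (forall t, (t < p)%N -> \sum_(c < q * q) `|cf t c| <= A)%N -> (0 < A)%N ->
  (A ^ L * B <= U)%N -> (w + L * psize L <= U)%N -> (psize L <= U)%N ->
  triple (encode cf) r M (psize L * (xform_cost cf (q * q) p + 200) + 20) 0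
    (fun r' M' => [/\ agree work_vars r r', keep w M M' &
       exists a w', [/\ r' 40%N = a%:Z /\ r' 31%N = w'%:Z, (a + psize L <= w')%N,
         (w <= w' <= w + L * psize L)%N, block M' a (psize L) (enc q p s cf L f) &
         forall y, (y < psize L)%N -> (`|enc q p s cf L f y| <= A ^ L * B)%N]]).
Proof.
move=> r3 r5 r40 r31 hf hsrc hB hA A0 hAU hwU hpU.
(* After [j] levels, from the top down, [cur] consists of [p ^ j] blocks of level [L - j]; encoding
   the T-th of them yields the T-th segment of the final array. Each level multiplies the bound by
   [A]. *)
pose I j r' M' := [/\ agree work_vars r r', keep w M M', r' 33%N = (p ^ j)%N%:Z,
  r' 34%N = (msize (L - j))%:Z & exists a w' cur, [/\ r' 40%N = a%:Z /\ r' 31%N = w'%:Z,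
  (a + p ^ j * msize (L - j) <= w')%N /\ (w <= w' <= w + j * psize L)%N,
  block M' a (p ^ j * msize (L - j)) cur,
  forall x, (x < p ^ j * msize (L - j))%N -> (`|cur x| <= A ^ j * B)%N &
  forall T y, (T < p ^ j)%N -> (y < psize (L - j))%N ->
    enc q p s cf L f (T * psize (L - j) + y) =
    enc q p s cf (L - j) (fun x => cur (T * msize (L - j) + x)%N) y]].
have msL : (msize L <= psize L)%N by have := leq_exp_msize_psize (leq0n L); rewrite expn0 mul1n subn0.
set cx := xform_cost _ _ _.
pose T j := (clen (seqc [:: CAsg 34 (EDiv (EV 34) (EC (q * q)%N%:Z)); CAsg 41 (EV 31); CAsg 42 (EV 33); CAsg 43 (EV 34)])
   + ((p ^ j * (msize (L - j.+1) * (cx + 13) + 10 + 13) + 10) + clen (seqc [:: CAsg 33 (EMul (EV 33) (EC p%:Z)); CAsg 40 (EV 31);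
                    CAsg 31 (EAdd (EV 31) (EMul (EV 33) (EV 34)))])))%N.
(* The constants 150 and 200 absorb the overhead of the loops, as every level has at least one
   segment of at least one cell. *)
have hcost : (7 + (\sum_(j < L) (T j + 13) + 10) <= psize L * (cx + 200) + 20)%N.
  have hT j : (j < L)%N -> (T j + 13 <= (p ^ j * (q * q) ^ (L - j.+1)) * (s * s * (cx + 150)))%N.
    move=> hj; have h1 : (0 < p ^ j)%N by rewrite expn_gt0 p0.
    have h2 := msize_gt0 s0 q0 (L - j.+1).
    have -> : (p ^ j * (q * q) ^ (L - j.+1) * (s * s * (cx + 150)) =
      p ^ j * (msize (L - j.+1) * (cx + 150)))%N by rewrite !msizeE !mulnA.
    rewrite /T /=; move: (p ^ j)%N (msize (L - j.+1)) h1 h2 => G S h1 h2.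
    by rewrite !mulnDr; move: (S * cx)%N => Sc; nia.
  have : (\sum_(j < L) (T j + 13) <= psize L * (cx + 150))%N.
    apply: (@leq_trans (\sum_(j < L) p ^ j * (q * q) ^ (L - j.+1) * (s * s * (cx + 150)))%N).
      by apply: leq_sum => j _; apply: hT.
    rewrite -big_distrl /= !psizeE -[leqRHS]mulnA leq_mul2r geometric_sum_le ?orbT //.
  have := psize_gt0 s0 p0 L; move: (psize L) (\sum_(j < L) _)%N => Z X Z0 hX.
  by rewrite mulnDr in hX *; lia.
apply: (triple_le (K' := 0 + L * 0) _ hcost) => [|//|r' M' h]; [|by rewrite muln0|exact: h].
apply: triple_seq; apply: triple_run => //= hr hM; split.
  have := psize_gt0 s0 p0 L; rewrite /upd /= r5; move: (psize L) (msize L) hpU msL; lia.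
apply: (@triple_for_sum _ _ _ _ _ _ T _ _ _ _ I) => //.
- split=> //.
  + by do !apply: agree_upd.
  + by rewrite /upd /= r5 subn0.
  exists src, w, f; rewrite expn0 mul1n subn0 mul1n mul0n addn0; split=> //.
  + by rewrite leqnn.
  + by move=> t y; rewrite ltnS leqn0 => /eqP -> hy.
- move=> j r' M' hj rj rL [ag hk r33 r34 [a [w' [cur [[r40' r31'] [ha hw'] hcur hb henc]]]]].
  have eL : (L - j = (L - j.+1).+1)%N by lia.
  move: rj r34 ha hcur hb henc; rewrite eL; set l := (L - j.+1)%N => rj r34 ha hcur hb henc.
  have qq0 : (0 < q * q)%N by rewrite muln_gt0 q0.
  have hl : (p ^ j * p * msize l <= psize L)%N by rewrite -expnSr leq_exp_msize_psize.
  have hA1 : (A * (A ^ j * B) <= U)%N.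
    by apply: leq_trans hAU; rewrite mulnA -expnS leq_mul2r leq_pexp2l ?orbT.
  have hw2 : (w' + p ^ j * p * msize l <= w + j.+1 * psize L)%N by rewrite mulSn; lia.
  have hw3 : (w + j.+1 * psize L <= U)%N.
    by apply: leq_trans hwU; rewrite leq_add2l leq_mul2r hj orbT.
  have l_gt0 := msize_gt0 s0 q0 l; have pj_gt0 : (0 < p ^ j)%N by rewrite expn_gt0 p0.
  have hpj : (p ^ j <= p ^ j * p * msize l)%N by rewrite -mulnA leq_pmulr // muln_gt0 p0.
  have hml : (msize l <= p ^ j * p * msize l)%N by rewrite leq_pmull // muln_gt0 pj_gt0.
  have hpj1 : (p ^ j * p <= p ^ j * p * msize l)%N by rewrite leq_pmulr.
  have ediv : ((msize l.+1)%:Z %/ (q * q)%N%:Z)%Z = (msize l)%:Z.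
    by rewrite divz_nat msizeS mulKn.
  apply: (@triple_seq _ _ _ _ _ _ _ 0 _ 0); apply: triple_run => // hr' hM'; split.
    by rewrite /= /upd /= r34 r31' r33 ediv !absz_nat; repeat split => //; lia.
  rewrite /= /upd /= r31' r33 r34 ediv.
  apply: (@triple_seq _ _ _ _ _ _ _ 0 _ 0).
  apply: (triple_le (triple_xform s (cf := cf) (src := a) (dst := w') (G := p ^ j)
     (S := msize l) (A := A) (B := A ^ j * B) (f := cur) _ _ _ _ _ _ _ _ _)) => //=.
  + by rewrite -mulnA -msizeS.
  + by rewrite -mulnA -msizeS.
  + by rewrite -mulnA -msizeS.
  move=> r2 M2 [ag2 hk2 hval].
  have e31 : r2 31%N = w'%:Z by rewrite ag2.
  have e33 : r2 33%N = (p ^ j)%N%:Z by rewrite ag2.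
  have e34 : r2 34%N = (msize l)%:Z by rewrite ag2.
  have e3 : r2 3%N = L%:Z by rewrite ag2.
  have e32 : r2 32%N = j%:Z by rewrite ag2.
  have es : w'%:Z + (p ^ j)%N%:Z * p%:Z * (msize l)%:Z = (w' + p ^ j * p * msize l)%N%:Z.
    by rewrite !PoszD !PoszM.
  apply: triple_run => // hr2 hM2; split.
    by rewrite /= /upd /= e33 e31 e34 es !absz_nat; repeat split => //; lia.
  rewrite /= /upd /= e33 e31 e34 es e32 e3; split=> //; split.
  + move=> x hx.
    have hn k : k \in work_vars -> (x == k) = false by move=> hk'; apply: contraNF hx => /eqP ->.
    rewrite !hn // ag2; first by rewrite !hn // ag.
    by rewrite !inE !hn.
  + by have /andP[hww' _] := hw'; apply: keep_trans hk (keep_le hww' hk2).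
  + by rewrite expnSr.
  + by [].
  exists w', (w' + p ^ j * p * msize l)%N, (fun x => M2 (w' + x)%N).
  rewrite expnSr; split=> //.
  + by rewrite leqnn; split=> //; lia.
  + move=> x hx; have hX : (x %/ msize l < p ^ j * p)%N by rewrite ltn_divLR.
    have := hval (x %/ msize l %/ p)%N (x %/ msize l %% p)%N (x %% msize l)%N.
    rewrite -!divn_eq !ltn_mod ltn_divLR // hX => -> //.
    rewrite expnS -mulnA; apply: absz_linear_form (hA _ _) _; first by rewrite ltn_mod.
    move=> c hc; apply: hb; rewrite msizeS (mulnA (p ^ j)%N); apply: leq_index => //.
    by rewrite ltn_divLR // ltn_divLR // mulnAC.
    by rewrite ltn_mod.
  + move=> T' y hT hy.
    have hg : (T' %/ p < p ^ j)%N by rewrite ltn_divLR.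
    have -> : (T' * psize l + y = T' %/ p * psize l.+1 + (T' %% p * psize l + y))%N.
      by rewrite {1}(divn_eq T' p) psizeS; ring.
    rewrite henc //; last by rewrite psizeS ltn_mulD // ltn_mod.
    rewrite encS //; apply: enc_ext => // x hx.
    have := hval (T' %/ p)%N (T' %% p)%N x hg; rewrite ltn_mod -divn_eq => -> //.
    by apply: eq_bigr => c _; congr (_ * cur _); rewrite msizeS; ring.
- move=> r' M' rL r3' [ag hk r33 r34 [a [w' [cur [h1 [ha hw'] hcur hb henc]]]]]; split=> //.
  move: ha hw' hcur hb henc; rewrite subnn => ha hw' hcur hb henc.
  have ecur y : (y < psize L)%N -> enc q p s cf L f y = cur y.
    have e0 : psize 0 = msize 0 by rewrite !psizeE !msizeE !expn0.
    move=> hy; have hd := divn_eq y (psize 0); rewrite {1}hd henc //.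
    + by rewrite /= -e0 -hd.
    + by rewrite ltn_divLR ?psize_gt0 // !psizeE expn0 mul1n.
    + by rewrite ltn_mod psize_gt0.
  have eL : (p ^ L * msize 0 = psize L)%N by rewrite !psizeE !msizeE expn0 mul1n.
  rewrite eL in ha hcur hb.
  exists a, w'; split=> // [x hx|y hy]; first by rewrite ecur // hcur.
  by rewrite ecur // hb.
Qed.
(** Decoding goes from the leaves up. The conclusion [src <= a] is for L = 0, where the result is
    the input array itself and so lies below [w]. *)
Lemma triple_decode (cf : nat -> nat -> int) src w L A B (h r M : nat -> int) :
  r 3%N = L%:Z -> r 7%N = (p ^ L)%N%:Z -> r 2%N = (s * s)%N%:Z -> r 40%N = src%:Z -> r 31%N = w%:Z ->
  block M src (psize L) h -> (src + psize L <= w)%N ->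
  (forall x, (x < psize L)%N -> (`|h x| <= B)%N) ->
  (forall c, (c < q * q)%N -> \sum_(t < p) `|cf c t| <= A)%N -> (0 < A)%N ->
  (A ^ L * B <= U)%N -> (w + L * psize L <= U)%N -> (psize L <= U)%N ->
  triple (decode cf) r M (psize L * (xform_cost cf p (q * q) + 200) + 20) 0
    (fun r' M' => [/\ agree work_vars r r', keep w M M' &
       exists a w', [/\ r' 40%N = a%:Z /\ r' 31%N = w'%:Z, (a + msize L <= w')%N,
         (w <= w' <= w + L * psize L)%N /\ (src <= a)%N & block M' a (msize L) (dec q p s cf L h)]]).
Proof.
move=> r3 r7 r2 r40 r31 hf hsrc hB hA A0 hAU hwU hpU.
(* After [j] levels each of the [p ^ (L - j)] segments is completely decoded as a matrix of level
   [j]. *)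
pose I j r' M' := [/\ agree work_vars r r', keep w M M', r' 33%N = (p ^ (L - j))%N%:Z,
  r' 34%N = (msize j)%:Z & exists a w' cur, [/\ r' 40%N = a%:Z /\ r' 31%N = w'%:Z,
  (a + p ^ (L - j) * msize j <= w')%N /\ (w <= w' <= w + j * psize L)%N /\ (src <= a)%N,
  block M' a (p ^ (L - j) * msize j) cur,
  forall x, (x < p ^ (L - j) * msize j)%N -> (`|cur x| <= A ^ j * B)%N &
  forall T x, (T < p ^ (L - j))%N -> (x < msize j)%N ->
    cur (T * msize j + x)%N = dec q p s cf j (fun y => h (T * psize j + y)%N) x]].
have ss_le : (s * s <= psize L)%N by rewrite !psizeE leq_pmull // expn_gt0 p0.
have pL_le : (p ^ L <= psize L)%N by rewrite !psizeE leq_pmulr // muln_gt0 s0.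
set cx := xform_cost _ _ _.
pose T j := (clen (seqc [:: CAsg 33 (EDiv (EV 33) (EC p%:Z)); CAsg 41 (EV 31); CAsg 42 (EV 33); CAsg 43 (EV 34)])
   + ((p ^ (L - j.+1) * (msize j * (cx + 13) + 10 + 13) + 10) + clen (seqc [:: CAsg 34 (EMul (EV 34) (EC (q * q)%N%:Z)); CAsg 40 (EV 31);
                    CAsg 31 (EAdd (EV 31) (EMul (EV 33) (EV 34)))])))%N.
have hcost : (8 + (\sum_(j < L) (T j + 13) + 10) <= psize L * (cx + 200) + 20)%N.
  have hT j : (j < L)%N -> (T j + 13 <= (p ^ (L - j.+1) * (q * q) ^ j) * (s * s * (cx + 150)))%N.
    move=> hj; have h1 : (0 < p ^ (L - j.+1))%N by rewrite expn_gt0 p0.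
    have h2 := msize_gt0 s0 q0 j.
    have -> : (p ^ (L - j.+1) * (q * q) ^ j * (s * s * (cx + 150)) =
      p ^ (L - j.+1) * (msize j * (cx + 150)))%N by rewrite !msizeE !mulnA.
    rewrite /T /=; move: (p ^ _)%N (msize j) h1 h2 => G S h1 h2.
    by rewrite !mulnDr; move: (S * cx)%N => Sc; nia.
  have : (\sum_(j < L) (T j + 13) <= psize L * (cx + 150))%N.
    apply: (@leq_trans (\sum_(j < L) p ^ (L - j.+1) * (q * q) ^ j * (s * s * (cx + 150)))%N).
      by apply: leq_sum => j _; apply: hT.
    rewrite -big_distrl /= !psizeE -[leqRHS]mulnA leq_mul2r geometric_sum_rev_le ?orbT //.
  have := psize_gt0 s0 p0 L; move: (psize L) (\sum_(j < L) _)%N => Z X Z0 hX.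
  by rewrite mulnDr in hX *; lia.
apply: (triple_le (K' := 0 + L * 0) _ hcost) => [|//|r' M' h']; [|by rewrite muln0|exact: h'].
apply: triple_seq; apply: triple_run => //= hr hM; split.
  by rewrite /upd /= r7 r2; move: (psize L) (p ^ L)%N (s * s)%N hpU ss_le pL_le; lia.
apply: (@triple_for_sum _ _ _ _ _ _ T _ _ _ _ I) => //.
- split=> //.
  + by do !apply: agree_upd.
  + by rewrite /upd /= r7 subn0.
  + by rewrite /upd /= r2 !msizeE expn0 mul1n.
  have e : (p ^ L * msize 0 = psize L)%N by rewrite !msizeE expn0 mul1n.
  exists src, w, h; rewrite subn0 e mul1n mul0n addn0; split=> //.
  + by rewrite leqnn.

- move=> j r' M' hj rj rL [ag hk r33 r34 [a [w' [cur [[r40' r31'] [ha [hw' hsa]] hcur hb henc]]]]].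
  have eL : (L - j = (L - j.+1).+1)%N by lia.
  have eLl : (L - (L - j.+1) = j.+1)%N by lia.
  have hlL : (L - j.+1 <= L)%N by lia.
  have := leq_exp_msize_psize hlL; rewrite eLl.
  move: rj r33 ha hcur hb henc; rewrite eL; set l := (L - j.+1)%N => rj r33 ha hcur hb henc hl.
  have qq0 : (0 < q * q)%N by rewrite muln_gt0 q0.
  have hA1 : (A * (A ^ j * B) <= U)%N.
    by apply: leq_trans hAU; rewrite mulnA -expnS leq_mul2r leq_pexp2l ?orbT.
  have hw2 : (w' + p ^ l * msize j.+1 <= w + j.+1 * psize L)%N by rewrite mulSn; lia.
  have hw3 : (w + j.+1 * psize L <= U)%N.
    by apply: leq_trans hwU; rewrite leq_add2l leq_mul2r hj orbT.
  have l_gt0 := msize_gt0 s0 q0 j; have pj_gt0 : (0 < p ^ l)%N by rewrite expn_gt0 p0.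
  have l1_gt0 := msize_gt0 s0 q0 j.+1.
  have hpj : (p ^ l <= p ^ l * msize j.+1)%N by rewrite leq_pmulr.
  have hml1 : (msize j.+1 <= p ^ l * msize j.+1)%N by rewrite leq_pmull.
  have hml : (msize j <= msize j.+1)%N by rewrite msizeS leq_pmull.
  have ediv : ((p ^ l.+1)%N%:Z %/ p%:Z)%Z = (p ^ l)%N%:Z by rewrite divz_nat expnS mulKn.
  apply: (@triple_seq _ _ _ _ _ _ _ 0 _ 0); apply: triple_run => // hr' hM'; split.
    by rewrite /= /upd /= r34 r31' r33 ediv !absz_nat; repeat split => //; lia.
  rewrite /= /upd /= r31' r33 r34 ediv.
  apply: (@triple_seq _ _ _ _ _ _ _ 0 _ 0).
  apply: (triple_le (triple_xform s (cf := cf) (src := a) (dst := w') (G := p ^ l)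
     (S := msize j) (A := A) (B := A ^ j * B) (f := cur) _ _ _ _ _ _ _ _ _)) => //=.
  + by rewrite -expnSr.
  + by rewrite -expnSr.
  + by rewrite -expnSr.
  move=> r2' M2 [ag2 hk2 hval].
  have e31 : r2' 31%N = w'%:Z by rewrite ag2.
  have e33 : r2' 33%N = (p ^ l)%N%:Z by rewrite ag2.
  have e34 : r2' 34%N = (msize j)%:Z by rewrite ag2.
  have e3 : r2' 3%N = L%:Z by rewrite ag2.
  have e32 : r2' 32%N = j%:Z by rewrite ag2.
  have em : (msize j)%:Z * (q * q)%N%:Z = (msize j.+1)%:Z by rewrite -PoszM mulnC -msizeS.
  have es : w'%:Z + (p ^ l)%N%:Z * (msize j.+1)%:Z = (w' + p ^ l * msize j.+1)%N%:Z.
    by rewrite !PoszD !PoszM.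
  apply: triple_run => // hr2 hM2; split.
    by rewrite /= /upd /= e33 e31 e34 em es !absz_nat; repeat split => //; lia.
  rewrite /= /upd /= e33 e31 e34 em es e32 e3; split=> //; split.
  + move=> x hx.
    have hn k : k \in work_vars -> (x == k) = false by move=> hk'; apply: contraNF hx => /eqP ->.
    rewrite !hn // ag2; first by rewrite !hn // ag.
    by rewrite !inE !hn.
  + by have /andP[hww' _] := hw'; apply: keep_trans hk (keep_le hww' hk2).
  + by [].
  + by [].
  exists w', (w' + p ^ l * msize j.+1)%N, (fun x => M2 (w' + x)%N).
  split=> //.
  + by rewrite leqnn; split=> //; split; lia.
  + move=> x; rewrite msizeS mulnA => hx; have hX : (x %/ msize j < p ^ l * (q * q))%N by rewrite ltn_divLR.
    have := hval (x %/ msize j %/ (q * q))%N (x %/ msize j %% (q * q))%N (x %% msize j)%N.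
    rewrite -!divn_eq !ltn_mod ltn_divLR // hX => -> //.
    rewrite expnS -mulnA; apply: absz_linear_form (hA _ _) _; first by rewrite ltn_mod.
    move=> c hc; apply: hb; rewrite expnSr; apply: leq_index => //.
      by rewrite ltn_divLR // ltn_divLR // -mulnA.
    by rewrite ltn_mod.
  + move=> T' x hT hx.
    have hx' : (x = x %/ msize j * msize j + x %% msize j)%N by rewrite -divn_eq.
    have hd : (x %/ msize j < q * q)%N by rewrite ltn_divLR // -msizeS.
    have hr1 : (x %% msize j < msize j)%N by rewrite ltn_mod.
    have -> : (T' * msize j.+1 + x = (T' * (q * q) + x %/ msize j) * msize j + x %% msize j)%N.
      by rewrite {1}hx' msizeS; ring.
    rewrite hval // {3}hx' decS //; apply: eq_bigr => t _; congr (_ * _).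
    rewrite henc //; first by apply: dec_ext => // y hy; congr h; rewrite psizeS; ring.
    by rewrite expnSr ltn_mulD.
- move=> r' M' rL r3' [ag hk r33 r34 [a [w' [cur [h1 [ha [hw' hsa]] hcur hb henc]]]]]; split=> //.
  move: ha hcur hb henc; rewrite subnn expn0 mul1n => ha hcur hb henc.
  exists a, w'; split=> // x hx; rewrite hcur // -[x in cur x]add0n -(mul0n (msize L)) henc //.
Qed.
(** Every call has the least number of rows, [s], and costs [s * s] besides the latency: [psize L]
    for the [p ^ L] calls. *)
Lemma triple_leaves a b w L B (E F r M : nat -> int) :
  r 1%N = s%:Z -> r 2%N = (s * s)%N%:Z -> r 6%N = (psize L)%:Z -> r 7%N = (p ^ L)%N%:Z ->
  r 22%N = a%:Z -> r 23%N = b%:Z -> r 31%N = w%:Z ->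
  block M a (psize L) E -> block M b (psize L) F -> (a + psize L <= w)%N -> (b + psize L <= w)%N ->
  (forall x, (x < psize L)%N -> (`|E x| <= B)%N) -> (forall x, (x < psize L)%N -> (`|F x| <= B)%N) ->
  (s * (B * B) <= U)%N -> (w + psize L <= U)%N ->
  triple leaves r M (psize L * 100 + 30) (p ^ L)
    (fun r' M' => [/\ agree work_vars r r', keep w M M', r' 40%N = w%:Z,
       r' 31%N = (w + psize L)%N%:Z & block M' w (psize L) (leaf s E F)]).
Proof.
move=> r1 r2 r6 r7 r22 r23 r31 hE hF ha hb bE bF hsU hwU.
pose I j M' := keep w M M' /\ block M' w (j * (s * s)) (leaf s E F).
have ss0 : (0 < s * s)%N by rewrite muln_gt0 s0.
have leafB y : (y < psize L)%N -> (`|leaf s E F y| <= U)%N.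
  move=> hy; apply: leq_trans hsU; rewrite /leaf.
  apply: (@absz_sum _ _ (fun j => E (y %/ (s * s) * (s * s) + y %% (s * s) %/ s * s + j)%N *
    F (y %/ (s * s) * (s * s) + (j * s + y %% s))%N)) => j hj; rewrite abszM.
  by have [h1 h2] := leaf_idx s0 hj hy; rewrite leq_mul ?bE ?bF.
have hpL : (p ^ L <= psize L)%N by rewrite !psizeE leq_pmulr.
rewrite -[X in triple _ _ _ _ X _]addn0.
apply: (@triple_le _ _ _ _ _ _ _ _ ((p ^ L * ((55 + s * s) + 13) + 10) + 14) (p ^ L * 1 + 0)); last by move=> r' M' h; exact: h.
- apply: triple_seq.
  apply: (@triple_for_mem _ _ [:: 32]%N _ _ _ (p ^ L) _ 1 _ _ _ I) => //.
  + move=> j r' M' hj ag rj [hk hbl].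
    have e n : n != 32%N -> r' n = r n by move=> hn; rewrite ag // !inE.
    have adr v c : v != 32%N -> r v = c%:Z ->
        `|eval r' M' (EAdd (EV v) (EMul (EV 32) (EV 2)))|%N = (c + j * (s * s))%N.
      by move=> hv rv; rewrite /= e // rv rj e // r2 -PoszM -PoszD.
    have hjZ x : (x < s * s)%N -> (j * (s * s) + x < psize L)%N.
      by move=> hx; rewrite !psizeE ltn_mulD.
    have ent x : (x < s * s)%N ->
        tensor_entry s M' (a + j * (s * s)) (b + j * (s * s)) x = leaf s E F (j * (s * s) + x).
      move=> hx; rewrite leaf_shift // /leaf /tensor_entry; apply: eq_bigr => k _.
      have [|h1 h2] := @leaf_idx s s0 x k 1 (ltn_ord k); first by rewrite mul1n.
      rewrite mul1n divn_small // modn_small // mul0n !add0n in h1 h2 *.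
      have -> : (a + j * (s * s) + x %/ s * s + k = a + (j * (s * s) + (x %/ s * s + k)))%N by rewrite !addnA.
      have -> : (b + j * (s * s) + k * s + x %% s = b + (j * (s * s) + (k * s + x %% s)))%N by rewrite !addnA.
      have {}h1 := hjZ _ h1; have {}h2 := hjZ _ h2.
      have k1 : (a + (j * (s * s) + (x %/ s * s + k)) < w)%N by apply: leq_trans ha; rewrite ltn_add2l.
      have k2 : (b + (j * (s * s) + (k * s + x %% s)) < w)%N by apply: leq_trans hb; rewrite ltn_add2l.
      by rewrite hk // hk // hE // hF.
    have e1 : `|eval r' M' (EV 1)|%N = s by rewrite /= e // r1.
    have e31 := adr 31%N w isT r31; have e22 := adr 22%N a isT r22; have e23 := adr 23%N b isT r23.
    apply: (@triple_le _ _ _ _ _ _ _ _ _ _ _ (@triple_ten _ _ _ _ _ _ r' M' (fun r2 M2 => r2 = r' /\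
      M2 = tensor_write s M' (a + j * (s * s)) (b + j * (s * s)) (w + j * (s * s)) s) _ _ _)).
    * by rewrite e1.
    * by rewrite e1 e22 e23 => x hx; rewrite ent ?leafB ?hjZ.
    * by rewrite e1 e22 e23 e31.
    * by rewrite e1 leq_add2r.
    * by [].
    * move=> r2' M2 [-> ->]; split=> //; split.
        move=> y hy; rewrite /tensor_write; case: ifP => [|_]; last exact: hk.
        by move=> /andP[h1 _]; lia.
      move=> x hx; rewrite /tensor_write; case: ifP => [/andP[h1 h2]|h].
        have -> : (w + x - (w + j * (s * s)) = x - j * (s * s))%N by lia.
        by rewrite ent ?subnKC //; lia.
      by apply: hbl; move: hx h; rewrite mulSn; lia.
  + move=> r' M' ag [hk hbl].
    have e n : n != 32%N -> r' n = r n by move=> hn; rewrite ag // !inE.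
    apply: triple_run => // hr hM; split.
      by rewrite /= /upd /= !e // r31 r6 -PoszD !absz_nat; repeat split=> //; lia.
    rewrite /= /upd /= !e // r31 r6 -PoszD; split=> //.
    move=> x hx; have hn k : k \in work_vars -> (x == k) = false.
      by move=> hk'; apply: contraNF hx => /eqP ->.
    by rewrite !hn // ag // !inE hn.
- have e : (p ^ L * (s * s) = psize L)%N by [].
  by move: e hpL (psize_gt0 s0 p0 L); clear; move: (s * s)%N (p ^ L)%N (psize L) => m P Z; rewrite !mulnDr; lia.
- by rewrite muln1 !addn0.
Qed.
End Run.
End Multiply.

Lemma notin_eq (T : eqType) (xs : seq T) x y : x \notin xs -> y \in xs -> (x == y) = false.
Proof. by move=> hx hy; apply: contraNF hx => /eqP ->. Qed.

(** * The complete product *)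

Section Product.
Variables (q p : nat) (al be ga : nat -> nat -> int) (D : nat).
Hypothesis q0 : (0 < q)%N.
Hypothesis qp : (q * q < p)%N.
Hypothesis HB : bilinear_algorithm q p al be ga D%:Z.

(** Operands at [r_20] and [r_21], result address in [r_30]. Every call restarts its allocation at
    [r_9], so a product must be consumed or copied before the next one. *)
Definition multiply : cmd :=
  CSeq (seqc [:: CAsg 31 (EV 9); CAsg 40 (EV 20)])
  (CSeq (encode q p al)
  (CSeq (seqc [:: CAsg 22 (EV 40); CAsg 40 (EV 21)])
  (CSeq (encode q p be)
  (CSeq (seqc [:: CAsg 23 (EV 40)])
  (CSeq leaves
  (CSeq (decode q p ga) (seqc [:: CAsg 30 (EV 40)]))))))).

Definition multiply_vars : seq nat := [:: 22; 23; 30]%N ++ work_vars.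

Definition multiply_cost : nat :=
  xform_cost al (q * q) p + xform_cost be (q * q) p + xform_cost ga p (q * q) + 1000.

Definition is_product (n : nat) (pos : nat -> nat -> nat) (c : int) (f g h : nat -> int) :=
  forall i k, (i < n)%N -> (k < n)%N ->
    h (pos i k) = c * \sum_(j < n) f (pos i j) * g (pos j k).

(** Entries are at most A ^ L B after encoding, s (A ^ L B) ^ 2 after the leaves and A ^ L times
    that after decoding. The three transforms take at most L z cells each and the leaves z, whence
    (3 L + 1) z. *)
Lemma triple_multiply U s L w xa xb A B (f g r M : nat -> int) : (0 < s)%N ->
  let m := msize q s L in let z := psize p s L in
  r 1%N = s%:Z -> r 2%N = (s * s)%N%:Z -> r 3%N = L%:Z -> r 5%N = m%:Z -> r 6%N = z%:Z ->
  r 7%N = (p ^ L)%N%:Z -> r 9%N = w%:Z -> r 20%N = xa%:Z -> r 21%N = xb%:Z ->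
  block M xa m f -> block M xb m g -> (xa + m <= w)%N -> (xb + m <= w)%N ->
  (forall x, (x < m)%N -> (`|f x| <= B)%N) -> (forall x, (x < m)%N -> (`|g x| <= B)%N) ->
  (forall t, (t < p)%N -> \sum_(c < q * q) `|al t c| <= A)%N ->
  (forall t, (t < p)%N -> \sum_(c < q * q) `|be t c| <= A)%N ->
  (forall c, (c < q * q)%N -> \sum_(t < p) `|ga c t| <= A)%N -> (0 < A)%N ->
  (A ^ L * B <= U)%N -> (A ^ L * (s * ((A ^ L * B) * (A ^ L * B))) <= U)%N ->
  (w + (3 * L + 1) * z <= U)%N -> (z <= U)%N ->
  triple U s multiply r M (z * multiply_cost) (p ^ L) (fun r' M' =>
    [/\ agree multiply_vars r r', keep w M M' &
      exists a h, [/\ r' 30%N = a%:Z, (w <= a)%N, block M' a m h &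
        is_product (side q s L) (pos q s L) (D ^ L)%N%:Z f g h]]).
Proof.
move=> s0 m z r1 r2 r3 r5 r6 r7 r9 r20 r21 hf hg ha hb bf bg hal hbe hga A0 hU1 hU2 hwU hzU.
have p0 : (0 < p)%N by exact: leq_ltn_trans qp.
have z0 : (0 < z)%N by exact: psize_gt0.
have {}hwU : (w + (L * z + L * z + L * z + z) <= U)%N.
  by move: hwU; rewrite mulnDl mul1n -mulnA; move: (L * z)%N; clear; lia.
have wU : (w <= U)%N by apply: leq_trans hwU; rewrite leq_addr.
have cost : (8 + ((z * (xform_cost al (q * q) p + 200) + 20) + (8 + ((z * (xform_cost be (q * q) p + 200) + 20)
   + (4 + ((z * 100 + 30) + ((z * (xform_cost ga p (q * q) + 200) + 20) + 4)))))) <= z * multiply_cost)%N.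
  rewrite /multiply_cost !mulnDr; move: (z * xform_cost al _ _)%N (z * xform_cost be _ _)%N (z * xform_cost ga _ _)%N.
  by lia.
apply: (@triple_le _ _ _ _ _ _ _ _ _ (0 + (0 + (0 + (0 + (0 + (p ^ L + (0 + 0))))))) _ _ cost) => [||r' M' h]; last exact: h.
  2: by rewrite !addn0.
apply: triple_seq; apply: triple_run => // hr hM; split.
  by rewrite /= /upd /= r9 r20; repeat split=> //; lia.
rewrite /= /upd /= r9 r20.
set r0' := (X in triple _ _ _ X).
have ag0 : agree multiply_vars r r0' by move=> x hx; rewrite /r0' !(notin_eq hx).
have sub : {subset work_vars <= multiply_vars} by move=> x hx; rewrite mem_cat hx orbT.
apply: triple_seq.
apply: (triple_le (triple_encode q0 qp s0 (cf := al) (src := xa) (w := w) (L := L) (A := A) (B := B) (f := f) _ _ _ _ _ _ _ _ _ _ _ _)) => //.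
- by move: hwU; rewrite -/z; lia.
move=> r1' M1 [ag1 hk1 [a [w1 [[r40 r31] ha1 hw1 hA bA]]]].
have {}ag1 := agree_trans ag0 (agree_sub sub ag1).
have e1 x : x \notin multiply_vars -> r1' x = r x by exact: ag1.
have hw1' : (w <= w1)%N by have /andP[] := hw1.
have w1U : (w1 <= w + L * z)%N by have /andP[] := hw1.
apply: triple_seq; apply: triple_run => // hr1 hM1; split.
  by rewrite /= /upd /= r40 e1 // r21; repeat split=> //; move: (hr1 40%N); rewrite r40; lia.
rewrite /= /upd /= r40 e1 // r21.
set r2' := (X in triple _ _ _ X).
have ag2 : agree multiply_vars r r2'.
  by apply: agree_trans ag1 _ => x hx; rewrite /r2' !(notin_eq hx).
apply: triple_seq.
apply: (triple_le (triple_encode q0 qp s0 (cf := be) (src := xb) (w := w1) (L := L) (A := A) (B := B) (f := g) _ _ _ _ _ _ _ _ _ _ _ _)) => //.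
- by rewrite ag2.
- by rewrite ag2.
- exact: block_keep hb hk1 hg.
- exact: leq_trans hb hw1'.
- by move: hwU w1U; rewrite -/z; move: (L * z)%N => Lz; lia.
move=> r3' M3 [ag3 hk3 [b [w3 [[s40 s31] hb3 hw3 hB bB]]]].
have s22 : r3' 22%N = a%:Z by rewrite ag3.
have {}ag3 := agree_trans ag2 (agree_sub sub ag3).
have e3 x : x \notin multiply_vars -> r3' x = r x by exact: ag3.
have hw3' : (w1 <= w3)%N by have /andP[] := hw3.
have w3U : (w3 <= w1 + L * z)%N by have /andP[] := hw3.
apply: triple_seq; apply: triple_run => // hr3 hM3; split.
  by rewrite /= /upd /= s40; move: (hr3 40%N); rewrite s40.
rewrite /= /upd /= s40.
set r4' := (X in triple _ _ _ X).
have ag4 : agree multiply_vars r r4'.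
  by apply: agree_trans ag3 _ => x hx; rewrite /r4' !(notin_eq hx).
apply: triple_seq.
apply: (triple_le (triple_leaves q0 qp s0 (a := a) (b := b) (w := w3) (L := L) (B := (A ^ L * B)%N)
   (E := enc q p s al L f) (F := enc q p s be L g) _ _ _ _ _ _ _ _ _ _ _ _ _ _ _)) => //; rewrite ?ag4 //.
- exact: block_keep ha1 hk3 hA.
- exact: leq_trans ha1 hw3'.
- by apply: leq_trans hU2; rewrite leq_pmull // expn_gt0 A0.
- by move: hwU w1U w3U; rewrite -/z; move: (L * z)%N => Lz; lia.
move=> r5' M5 [ag5 hk5 t40 t31 hleaf].
have {}ag5 := agree_trans ag4 (agree_sub sub ag5).
have bleaf y : (y < z)%N -> (`|leaf s (enc q p s al L f) (enc q p s be L g) y| <= s * (A ^ L * B * (A ^ L * B)))%N.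
  move=> hy; apply: (@absz_sum _ _ (fun j =>
    enc q p s al L f (y %/ (s * s) * (s * s) + y %% (s * s) %/ s * s + j)%N *
    enc q p s be L g (y %/ (s * s) * (s * s) + (j * s + y %% s))%N)) => j hj; rewrite abszM.
  by have [h1 h2] := leaf_idx s0 hj hy; rewrite leq_mul ?bA ?bB.
apply: triple_seq.
apply: (triple_le (triple_decode q0 qp s0 (cf := ga) (src := w3) (w := (w3 + z)%N) (L := L) (A := A)
   (B := (s * (A ^ L * B * (A ^ L * B)))%N) (h := leaf s (enc q p s al L f) (enc q p s be L g))
   _ _ _ _ _ _ _ _ _ _ _ _ _)) => //; rewrite ?ag5 //.
- by move: hwU w1U w3U; rewrite -/z; move: (L * z)%N => Lz; lia.
move=> r6' M6 [ag6 hk6 [c [w6 [[u40 u31] hc6 [hw6 hsc] hdec]]]].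
have {}ag6 := agree_trans ag5 (agree_sub sub ag6).
apply: triple_run => // hr6 hM6; split.
  by rewrite /= u40; move: (hr6 40%N); rewrite u40.
rewrite /= u40; split.
- exact: agree_upd.
- apply: keep_trans hk1 _; apply: keep_trans (keep_le hw1' hk3) _.
  apply: keep_trans (keep_le (leq_trans hw1' hw3') hk5) (keep_le _ hk6); lia.
exists c, (dec q p s ga L (leaf s (enc q p s al L f) (enc q p s be L g))); split=> //.
- by lia.
move=> i k hi hk; rewrite -[X in _ = X * _]natz natrX natz; exact: product_correct.
Qed.
End Product.

(** * Parameters and block positions computed at run time *)

Section Setup.
Variables (q p : nat).
Hypothesis q1 : (1 < q)%N.
Hypothesis qp : (q * q < p)%N.

Let q0 : (0 < q)%N. Proof. exact: ltnW. Qed.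
Let p0 : (0 < p)%N. Proof. exact: leq_ltn_trans qp. Qed.

(* Memory is divided into regions of r_6 cells: the graph and the result, the
   all-one matrix, the current distance matrix, the lam + 1 reachability matrices,
   one spare matrix and the work space of the multiplications. *)
Definition params (n s L lam : nat) (r : nat -> int) : Prop :=
  [/\ r 0%N = n%:Z /\ r 1%N = s%:Z, r 2%N = (s * s)%N%:Z /\ r 3%N = L%:Z,
      r 4%N = (side q s L)%:Z /\ r 5%N = (msize q s L)%:Z,
      r 6%N = (psize p s L)%:Z /\ r 7%N = (p ^ L)%N%:Z &
      r 8%N = lam%:Z /\ r 9%N = ((5 + lam) * psize p s L)%N%:Z].

Lemma params_agree xs n s L lam r r' : all (leq 10) xs -> agree xs r r' ->
  params n s L lam r -> params n s L lam r'.
Proof.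
move=> hxs ag; have e x : (x < 10)%N -> r' x = r x.
  by move=> hx; apply: ag; apply/negP => /(allP hxs); lia.
by case=> -[? ?] [? ?] [? ?] [? ?] [? ?]; rewrite /params !e.
Qed.

(** Only n and s are given: the first loop finds the depth [L] together with q ^ L s, (q * q) ^ L (s
    * s) and p ^ L, the second one finds [lam]. *)
Definition setup : cmd :=
  CSeq (seqc [:: CAsg 2 (EMul (EV 1) (EV 1)); CAsg 3 (EC 0); CAsg 4 (EV 1); CAsg 5 (EV 2); CAsg 7 (EC 1)])
  (CSeq (CWhile (ESub (EV 0) (EV 4))
    (seqc [:: CAsg 3 (EAdd (EV 3) (EC 1)); CAsg 4 (EMul (EV 4) (EC q%:Z));
              CAsg 5 (EMul (EV 5) (EC (q * q)%N%:Z)); CAsg 7 (EMul (EV 7) (EC p%:Z))]))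
  (CSeq (seqc [:: CAsg 6 (EMul (EV 7) (EV 2)); CAsg 8 (EC 0); CAsg 10 (EC 1)])
  (CSeq (CWhile (ESub (EV 0) (EV 10))
    (seqc [:: CAsg 8 (EAdd (EV 8) (EC 1)); CAsg 10 (EMul (EV 10) (EC 2))]))
    (seqc [:: CAsg 9 (EMul (EAdd (EC 5) (EV 8)) (EV 6))])))).

Lemma triple_setup U s n L lam r M : (0 < s)%N ->
  r 0%N = n%:Z -> r 1%N = s%:Z ->
  (forall j, (j < L)%N -> (side q s j < n)%N) -> (n <= side q s L)%N ->
  (forall j, (j < lam)%N -> (2 ^ j < n)%N) -> (n <= 2 ^ lam)%N ->
  (side q s L <= U)%N -> (2 ^ lam <= U)%N -> ((5 + lam) * psize p s L <= U)%N ->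
  triple U s setup r M (L * 100 + lam * 100 + 100) 0 (fun r' M' => params n s L lam r' /\ M' = M).
Proof.
move=> s0 r0 r1 hL1 hL2 hl1 hl2 hsU h2U hzU.
have zL : (psize p s L <= U)%N by apply: leq_trans hzU; rewrite leq_pmull.
have sd j : (j <= L)%N -> (side q s j <= side q s L)%N.
  by move=> hj; rewrite leq_mul2r leq_pexp2l ?orbT.
have pz j : (j <= L)%N -> (psize p s j <= psize p s L)%N.
  by move=> hj; rewrite leq_mul2r leq_pexp2l ?orbT.
have mz j : (j <= L)%N -> (msize q s j <= psize p s L)%N.
  move=> hj; apply: leq_trans (pz j hj); rewrite leq_mul2r leq_expn2 ?orbT //; exact: ltnW.
have ss_le : (s * s <= U)%N by apply: leq_trans zL; rewrite !psizeE leq_pmull // expn_gt0 p0.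
have pe j : (j <= L)%N -> (p ^ j <= U)%N.
  move=> hj; apply: leq_trans (leq_trans (pz j hj) zL); rewrite leq_pmulr // muln_gt0 s0 //.
have L_lam : (L <= side q s L)%N.
  by apply: leq_trans (ltnW (ltn_expl L q1)) _; rewrite leq_pmulr.
have LU : (L <= U)%N by exact: leq_trans L_lam hsU.
have lamU : (lam <= U)%N by exact: leq_trans (ltnW (ltn_expl lam (ltnSn 1))) h2U.
have s_le : (s <= U)%N by apply: leq_trans ss_le; rewrite leq_pmulr.
have U0 : (0 < U)%N by rewrite (leq_trans s0).
apply: (@triple_le _ _ _ _ _ _ _ _ (21 + ((\sum_(i < L) (24 + (5 + 2)) + (5 + 2)) + (13 + ((\sum_(i < lam) (12 + (5 + 2)) + (5 + 2)) + 10)))) (0 + (L * 0 + (0 + (lam * 0 + 0))))); last by move=> r' M' h; exact: h.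
apply: triple_seq; apply: triple_run => //= hr hM; split.
  by rewrite /= /upd /= r1 -PoszM; repeat split=> //; lia.
pose I1 k r' M' := exists j, [/\ (j + k = L)%N, M' = M /\ r' 0%N = n%:Z,
  [/\ r' 1%N = s%:Z, r' 2%N = (s * s)%N%:Z & r' 3%N = j%:Z] &
  [/\ r' 4%N = (side q s j)%:Z, r' 5%N = (msize q s j)%:Z & r' 7%N = (p ^ j)%N%:Z]].
apply: triple_seq.
apply: (@triple_while _ _ (ESub (EV 0) (EV 4)) _ L _ _ (fun=> 24) 0 _ I1).
- exists 0%N; rewrite /upd /= r0 r1 !sideE !msizeE !expn0 !mul1n -PoszM; split=> //; split.
- move=> k r' M' [j [hj [-> h0] [h1 h2 h3] [h4 h5 h7]]]; split.
    by rewrite /= h0 h4; have := hL1 j; lia.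
  have hjL : (j.+1 <= L)%N by lia.
  have a1 := sd _ hjL; have a2 := mz _ hjL; have a3 := pe _ hjL.
  have e4 : (side q s j)%:Z * q%:Z = (side q s j.+1)%:Z by rewrite -PoszM sideS mulnC.
  have e5 : (msize q s j)%:Z * (q * q)%N%:Z = (msize q s j.+1)%:Z by rewrite -PoszM msizeS mulnC.
  have e7 : (p ^ j)%N%:Z * p%:Z = (p ^ j.+1)%N%:Z by rewrite -PoszM expnSr.
  have e3 : j%:Z + 1 = j.+1%:Z by rewrite -PoszD addn1.
  apply: triple_run => // hr' hM'; split.
    by rewrite /= /upd /= h3 h4 h5 h7 e3 e4 e5 e7 !absz_nat; repeat split=> //; lia.
  exists j.+1; rewrite /= /upd /= h3 h4 h5 h7 e3 e4 e5 e7; split=> //; lia.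
move=> r' M' [j [hj [-> h0] [h1 h2 h3] [h4 h5 h7]]]; rewrite addn0 in hj; subst j.
split; first by rewrite /= h0 h4; lia.
have e6 : (p ^ L)%N%:Z * (s * s)%N%:Z = (psize p s L)%:Z by rewrite -PoszM.
apply: triple_seq; apply: triple_run => //= hr' hM'; split.
  by rewrite /upd /= h7 h2 e6 !absz_nat; repeat split=> //; lia.
pose I2 k r2 M2 := exists j, [/\ (j + k = lam)%N, M2 = M, r2 8%N = j%:Z, r2 10%N = (2 ^ j)%N%:Z &
  forall x, (x < 8)%N -> r2 x = if x == 6%N then (psize p s L)%:Z else r' x].
apply: triple_seq.
apply: (@triple_while _ _ (ESub (EV 0) (EV 10)) _ lam _ _ (fun=> 12) 0 _ I2).
- exists 0%N; rewrite /upd /= h7 h2 e6; split=> // x; do 10 (case: x => [|x] //).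
- move=> k r2 M2 [j [hj -> k8 k10 kx]]; split.
    by rewrite /= kx //= h0 k10; have := hl1 j; move: (2 ^ j)%N hj; clear; lia.
  have e8 : j%:Z + 1 = j.+1%:Z by rewrite -PoszD addn1.
  have e10 : (2 ^ j)%N%:Z * 2 = (2 ^ j.+1)%N%:Z by rewrite -PoszM expnSr.
  have hj2 : (2 ^ j.+1 <= 2 ^ lam)%N by rewrite leq_pexp2l //; lia.
  apply: triple_run => // hr2 hM2; split.
    by rewrite /= /upd /= k8 k10 e8 e10 !absz_nat; repeat split=> //; lia.
  exists j.+1; rewrite /= /upd /= k8 k10 e8 e10; split=> //; first by lia.
  by move=> x hx; rewrite -kx //; do 8 (case: x hx => [|x] // hx).
move=> r2 M2 [j [hj -> k8 k10 kx]]; rewrite addn0 in hj; subst j.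
split; first by rewrite /= kx //= h0 k10; move: (2 ^ lam)%N hl2; clear; lia.
have e9 : (5 + lam%:Z) * (psize p s L)%:Z = ((5 + lam) * psize p s L)%N%:Z by rewrite PoszM PoszD.
apply: triple_run => // hr2 hM2; split.
  by rewrite /= k8 kx //= e9 !absz_nat.
rewrite /= k8 (kx 6%N) //= e9; split=> //; rewrite /params /upd /= k8.
by rewrite (kx 0%N) ?(kx 1%N) ?(kx 2%N) ?(kx 3%N) ?(kx 4%N) ?(kx 5%N) ?(kx 6%N) ?(kx 7%N).
all: rewrite ?muln0 //.
rewrite !sum_nat_const !card_ord; lia.
Qed.

(** Unfolds [pos] from the top level down: [r_15] accumulates the offset, [r_16] and [r_17] are the
    coordinates inside the current block, [r_18] and [r_19] its side and size. *)
Definition position : cmd :=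
  CSeq (seqc [:: CAsg 15 (EC 0); CAsg 16 (EV 13); CAsg 17 (EV 14); CAsg 18 (EV 4); CAsg 19 (EV 5)])
  (CSeq (For 12 3 (seqc
    [:: CAsg 18 (EDiv (EV 18) (EC q%:Z)); CAsg 19 (EDiv (EV 19) (EC (q * q)%N%:Z));
        CAsg 15 (EAdd (EV 15) (EMul (EAdd (EMul (EDiv (EV 16) (EV 18)) (EC q%:Z))
                                          (EDiv (EV 17) (EV 18))) (EV 19)));
        CAsg 16 (ESub (EV 16) (EMul (EDiv (EV 16) (EV 18)) (EV 18)));
        CAsg 17 (ESub (EV 17) (EMul (EDiv (EV 17) (EV 18)) (EV 18)))]))
   (seqc [:: CAsg 15 (EAdd (EV 15) (EAdd (EMul (EV 16) (EV 1)) (EV 17)))])).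

Definition position_vars : seq nat := [:: 12; 15; 16; 17; 18; 19]%N.

Lemma subz_div (a b : nat) : a%:Z - (a %/ b)%N%:Z * b%:Z = (a %% b)%N%:Z.
Proof. by rewrite {1}(divn_eq a b) PoszD PoszM addrC addKr. Qed.

Lemma triple_position U s n L lam i j r M : (0 < s)%N -> params n s L lam r ->
  r 13%N = i%:Z -> r 14%N = j%:Z -> (i < side q s L)%N -> (j < side q s L)%N ->
  (msize q s L <= U)%N ->
  triple U s position r M (L * 72 + 60) 0 (fun r' M' =>
    [/\ agree position_vars r r', M' = M & r' 15%N = (pos q s L i j)%:Z]).
Proof.
move=> s0 hp r13 r14 hi hj hU.
have [[_ r1] [_ r3] [r4 r5] _ _] := hp.
have sdm : (side q s L <= msize q s L)%N by rewrite msize_side leq_pmulr // side_gt0.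
apply: (@triple_le _ _ _ _ _ _ _ _ (19 + ((L * (59 + 13) + 10) + 13)) (0 + (L * 0 + 0))); last by move=> r' M' h; exact: h.
2: by lia.
2: by rewrite muln0.
apply: triple_seq; apply: triple_run => //= hr hM; split.
  rewrite /upd /= r13 r14 r4 r5 !absz_nat; have := side_gt0 s0 q0 L.
  by move: (side q s L) (msize q s L) hi hj hU sdm; clear; lia.
rewrite /upd /= r13 r14 r4 r5.
pose I k r' M' := [/\ agree position_vars r r', M' = M &
  exists a x y, [/\ r' 15%N = a%:Z, r' 16%N = x%:Z /\ (x < side q s (L - k))%N,
    r' 17%N = y%:Z /\ (y < side q s (L - k))%N,
    r' 18%N = (side q s (L - k))%:Z /\ r' 19%N = (msize q s (L - k))%:Z &
    (a + pos q s (L - k) x y = pos q s L i j)%N]].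
apply: triple_seq.
apply: (@triple_for _ _ _ _ _ L _ _ _ _ _ I) => //.
- split=> //; first by move=> x hx; rewrite /upd !(notin_eq hx).
  by exists 0%N, i, j; rewrite subn0; split.
- move=> k r' M' hk rk rL [ag -> [a [x [y [h15 [h16 hx] [h17 hy] [h18 h19] hpos]]]]].
  have eL : (L - k = (L - k.+1).+1)%N by lia.
  move: hx hy h18 h19 hpos; rewrite eL; set l := (L - k.+1)%N => hx hy h18 h19 hpos.
  have sl0 := side_gt0 s0 q0 l.
  have e18 : ((side q s l.+1)%:Z %/ q%:Z)%Z = (side q s l)%:Z by rewrite divz_nat sideS mulKn.
  have e19 : ((msize q s l.+1)%:Z %/ (q * q)%N%:Z)%Z = (msize q s l)%:Z.
    by rewrite divz_nat msizeS mulKn // muln_gt0 q0.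
  set pp := ((x %/ side q s l * q + y %/ side q s l) * msize q s l)%N.
  have e15 : a%:Z + ((x %/ side q s l)%N%:Z * q%:Z + (y %/ side q s l)%N%:Z) * (msize q s l)%:Z = (a + pp)%N%:Z.
    by rewrite /pp !PoszD !PoszM !PoszD !PoszM.
  have hposU : (a + pp <= U)%N.
    have h := pos_lt s0 q0 hi hj; apply: leq_trans (leq_trans (ltnW h) hU).
    by rewrite -hpos /= leq_add2l leq_addr.
  have lL : (l.+1 <= L)%N by rewrite -eL leq_subr.
  have sl : (side q s l.+1 <= U)%N.
    apply: leq_trans (leq_trans sdm hU); rewrite leq_mul2r leq_pexp2l ?orbT //.
  have sl' : (side q s l <= U)%N by apply: leq_trans sl; rewrite sideS leq_pmull.
  have ml : (msize q s l <= U)%N.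
    by apply: leq_trans hU; rewrite leq_mul2r leq_pexp2l ?orbT ?muln_gt0 ?q0 // ltnW.
  have rx : (x %% side q s l < side q s l)%N by rewrite ltn_mod.
  have ry : (y %% side q s l < side q s l)%N by rewrite ltn_mod.
  apply: triple_run => // hr' hM'; split.
    rewrite /= /upd /= h15 h16 h17 h18 h19 e18 e19 !divz_nat e15 !subz_div !absz_nat.
    by repeat split=> //; [exact: leq_trans (ltnW rx) sl'|exact: leq_trans (ltnW ry) sl'].
  rewrite /= /upd /= h15 h16 h17 h18 h19 e18 e19 !divz_nat e15 !subz_div; split=> //; split=> //.
    by move=> z hz; rewrite !(notin_eq hz) // ag.
  exists (a + pp)%N, (x %% side q s l)%N, (y %% side q s l)%N; split=> //.
  by rewrite -hpos /= -/pp addnA.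
move=> r' M' rL r3' [ag -> [a [x [y [h15 [h16 hx] [h17 hy] [h18 h19]]]]]]; rewrite subnn => hpos.
have r1' : r' 1%N = s%:Z by rewrite ag.
have e : a%:Z + (x%:Z * s%:Z + y%:Z) = (pos q s L i j)%:Z by rewrite -hpos /= !PoszD PoszM.
apply: triple_run => //= hr' hM'; rewrite h15 h16 h17 r1' e; split.
  by rewrite absz_nat; split=> //; apply: leq_trans (ltnW (pos_lt s0 q0 hi hj)) hU.
by split=> //; apply: agree_upd.
Qed.
End Setup.

(** * Array and matrix loops *)

Definition blit (b l : nat) (g M : nat -> int) (y : nat) : int :=
  if (b <= y < b + l)%N then g (y - b)%N else M y.

Lemma blit_in b l g M x : (x < l)%N -> blit b l g M (b + x)%N = g x.
Proof. by move=> hx; rewrite /blit leq_addr ltn_add2l hx addKn. Qed.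

Lemma blit_out b l g M y : (y < b)%N || (b + l <= y)%N -> blit b l g M y = M y.
Proof. by rewrite /blit; case: ifP => //; lia. Qed.

(** Entrywise operations do not depend on the order of the entries, so they work directly on the
    block layout. *)
Definition emap (d v : expr) : cmd := For 11 5 (CSto (EAdd d (EV 11)) v).

Definition emap_cost (d v : expr) : nat := (clen (CSto (EAdd d (EV 11)) v) + 13)%N.

(** When cell [x] is computed only the cells of smaller index have been overwritten, so the
    destination may be one of the sources. *)
Lemma triple_emap U s d v N b g r M : r 5%N = N%:Z ->
  (forall x r' M', (x < N)%N -> agree [:: 11]%N r r' -> r' 11%N = x%:Z ->
     (forall y, (y < b)%N || (b + x <= y)%N -> M' y = M y) ->
     eval r' M' d = b%:Z /\ eval r' M' v = g x) ->
  (forall x, (x < N)%N -> (`|g x| <= U)%N) ->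
  triple U s (emap d v) r M (N * emap_cost d v + 10) 0
    (fun r' M' => agree [:: 11]%N r r' /\ forall y, M' y = blit b N g M y).
Proof.
move=> r5 hev hg; rewrite -[X in triple _ _ _ _ _ _ X](muln0 N).
apply: (@triple_for_mem _ _ [:: 11]%N _ _ _ N _ 0 _ _ _
  (fun x M' => forall y, M' y = blit b x g M y)) => //.
- by move=> y; rewrite blit_out //; lia.
- move=> x r' M' hx ag rx hM.
  have [|eD eV] := hev x r' M' hx ag rx.
    by move=> y hy; rewrite hM blit_out.
  apply: triple_sto; rewrite eV; first exact: hg.
  split=> // y; rewrite /= eD rx -PoszD absz_nat /upd; case: eqP => [->|ne].
    by rewrite blit_in.
  rewrite hM /blit; have -> : (b <= y < b + x.+1)%N = (b <= y < b + x)%N.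
    by move/eqP: ne; lia.
  by [].
Qed.

Section PositionLoop.
Variables (q p : nat).
Hypothesis q1 : (1 < q)%N.
Hypothesis qp : (q * q < p)%N.

Definition position_loop (body : cmd) : cmd := For 13 0 (For 14 0 (CSeq (position q) body)).

Definition position_loop_vars : seq nat := [:: 13; 14]%N ++ position_vars.

Lemma triple_position_loop U s n L lam body r M T (I : nat -> nat -> (nat -> int) -> Prop) :
  (0 < s)%N -> params q p n s L lam r -> (n <= side q s L)%N -> (msize q s L <= U)%N ->
  I 0%N 0%N M -> (forall i M, I i n M -> I i.+1 0%N M) ->
  (forall i j r' M', (i < n)%N -> (j < n)%N -> agree position_loop_vars r r' ->
     r' 13%N = i%:Z -> r' 14%N = j%:Z -> r' 15%N = (pos q s L i j)%:Z -> I i j M' ->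
     triple U s body r' M' T 0 (fun r2 M2 => r2 = r' /\ I i j.+1 M2)) ->
  triple U s (position_loop body) r M (n * (n * ((L * 72 + 60 + T) + 13) + 10 + 13) + 10) 0
    (fun r' M' => agree position_loop_vars r r' /\ I n 0%N M').
Proof.
move=> s0 hp hn hU I0 In IS; have [[r0 _] _ _ _ _] := hp.
rewrite -[X in triple _ _ _ _ _ _ X](muln0 n).
apply: (@triple_for_mem _ _ position_loop_vars _ _ _ n _ 0 _ _ _ (fun i => I i 0%N)) => //.
move=> i r1 M1 hi ag1 r1i I1.
rewrite -[X in triple _ _ _ _ _ _ X](muln0 n).
apply: (@triple_for_mem _ _ (14%N :: position_vars) _ _ _ n _ 0 _ _ _ (fun j => I i j)) => //.
- by rewrite ag1.
- move=> j r2 M2 hj ag2 r2j I2; rewrite -[X in triple _ _ _ _ _ _ X](addn0 0).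
  have sub2 : {subset (14%N :: position_vars) <= position_loop_vars} by move=> x; rewrite !inE; lia.
  have ag2' := agree_trans ag1 (agree_sub sub2 ag2).
  have hp2 : params q p n s L lam r2 by apply: (params_agree q1 qp) ag2' hp.
  apply: triple_seq.
  apply: (triple_le (triple_position q1 qp (i := i) (j := j) s0 hp2 _ r2j _ _ hU)) => //.
  + by rewrite ag2.
  + exact: leq_trans hi hn.
  + exact: leq_trans hj hn.
  move=> r3 M3 [ag3 -> r3p].
  have sub3 : {subset position_vars <= position_loop_vars} by move=> x; rewrite !inE; lia.
  have sub3' : {subset position_vars <= 14%N :: position_vars} by move=> x; rewrite !inE; lia.
  have ag3' := agree_trans ag2' (agree_sub sub3 ag3).
  apply: (triple_le (IS i j r3 M2 hi hj ag3' _ _ r3p I2)) => //.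
  + by rewrite ag3 // ag2.
  + by rewrite ag3.
  + move=> r4 M4 [-> I4]; split=> //; last by rewrite ag3.
    exact: agree_trans ag2 (agree_sub sub3' ag3).
- move=> r2 M2 ag2 I2; split.
  + have sub2 : {subset (14%N :: position_vars) <= position_loop_vars} by move=> x; rewrite !inE; lia.
    exact: agree_trans ag1 (agree_sub sub2 ag2).
  + by rewrite ag2.
  + exact: In.
Qed.
End PositionLoop.

(** * Distances at scale 2 ^ l *)

Section Seidel.
Variables (n lam : nat) (a : rel nat).
Hypothesis asym : symmetric a.

(** Vertices are natural numbers, because the matrices are padded beyond [n]; intermediate vertices
    stay below [n]. *)
Fixpoint within d x y : bool :=
  if d is d'.+1 then within d' x y || has (fun z => within d' x z && a z y) (iota 0 n)
  else x == y.

Hypothesis within_lam : forall d x y, (x < n)%N -> (y < n)%N -> within d x y -> within (2 ^ lam) x y.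

Lemma within_leq d d' x y : (d <= d')%N -> within d x y -> within d' x y.
Proof. by move=> /subnK <-; elim: (d' - d)%N => //= k IH /IH ->. Qed.

Lemma within_cat d d' x y z : within d x z -> within d' z y -> within (d + d') x y.
Proof.
move=> hxz; elim: d' y => [|d' IH] y /=; first by rewrite addn0 => /eqP <-.
rewrite addnS /= => /orP[/IH -> //|/hasP[w hw /andP[/IH h1 h2]]].
by apply/orP; right; apply/hasP; exists w => //; rewrite h1.
Qed.

Lemma within_split d d' x y : (y < n)%N -> within (d + d') x y ->
  exists z, [/\ (z < n)%N, within d x z & within d' z y].
Proof.
elim: d' y => [|d' IH] y hy; first by rewrite addn0; exists y; rewrite /= eqxx.
rewrite addnS /= => /orP[/(IH y hy)[z [h1 h2 h3]]|/hasP[w]].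
  by exists z; rewrite h3.
rewrite mem_iota /= add0n => hw /andP[/(IH w hw)[z [h1 h2 h3]] haw].
exists z; split=> //; apply/orP; right; apply/hasP; exists w; first by rewrite mem_iota.
by rewrite h3.
Qed.

Lemma within_sym d x y : (x < n)%N -> (y < n)%N -> within d x y -> within d y x.
Proof.
move=> hx; elim: d y => [|d IH] y hy /=; first by rewrite eq_sym.
case/orP => [/(IH _ hy) -> //|/hasP[w]]; rewrite mem_iota /= add0n => hw /andP[/(IH _ hw) h1 h2].
have h3 : within 1 y w.
  by rewrite /=; apply/orP; right; apply/hasP; exists y; rewrite ?mem_iota ?add0n //= eqxx asym.
exact: within_cat h3 h1.
Qed.

Definition reach_mat k i j : int := (((i < n) && (j < n) && within (2 ^ k) i j)%N : nat)%:Z.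

(* ceil(dist / 2 ^ l), and 0 for an infinite distance *)
Definition ceil_dist l i j : nat :=
  if ((i < n) && (j < n) && within (2 ^ lam) i j)%N
  then find (fun t => within (t * 2 ^ l) i j) (iota 0 (2 ^ lam).+1) else 0.

Lemma ceil_distP l i j : (i < n)%N -> (j < n)%N -> within (2 ^ lam) i j ->
  within (ceil_dist l i j * 2 ^ l) i j /\
  forall t, within (t * 2 ^ l) i j -> (ceil_dist l i j <= t)%N.
Proof.
move=> hi hj hij; rewrite /ceil_dist hi hj hij; set P := fun t => within (t * 2 ^ l) i j.
change (within (find P (iota 0 (2 ^ lam).+1) * 2 ^ l) i j /\ forall t, within (t * 2 ^ l) i j -> (find P (iota 0 (2 ^ lam).+1) <= t)%N).
set N := (2 ^ lam).+1.
have hP : has P (iota 0 N).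
  apply/hasP; exists (2 ^ lam)%N; first by rewrite mem_iota add0n ltnS leqnn.
  by apply: within_leq hij; rewrite leq_pmulr // expn_gt0.
have hlt := hP; rewrite has_find size_iota in hlt.
split; first by have := nth_find 0%N hP; rewrite nth_iota ?add0n.
move=> t ht; rewrite leqNgt; apply/negP => hlt2.
by have := before_find 0%N hlt2; rewrite nth_iota ?(ltn_trans hlt2) // add0n /P ht.
Qed.

Lemma ceil_dist_out l i j : ~~ ((i < n) && (j < n) && within (2 ^ lam) i j)%N -> ceil_dist l i j = 0%N.
Proof. by rewrite /ceil_dist => /negbTE ->. Qed.

(** Division by 0 gives 0, so [S %/ S] is the support of [S]; the terms are nonnegative and cannot
    cancel, and a walk of length at most 2 ^ (k + 1) splits into two halves. *)
Lemma reach_mat_square (N : nat) (c : int) k i j : (n <= N)%N -> 0 < c ->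
  let S := c * \sum_(h < N) reach_mat k i h * reach_mat k h j in
  reach_mat k.+1 i j = (S %/ S)%Z.
Proof.
move=> hN c0 S.
have term h : reach_mat k i h * reach_mat k h j =
    ((((i < n) && (j < n))%N && [&& (h < n)%N, within (2 ^ k) i h & within (2 ^ k) h j] : bool) : nat)%:Z.
  by rewrite /reach_mat -PoszM mulnb; do 5 case: (_ < _)%N => //=; rewrite ?andbF.
have S_ge0 h : 0 <= reach_mat k i h * reach_mat k h j by rewrite term.
rewrite {1}/reach_mat expnS mul2n -addnn.
case hw: ((i < n) && (j < n) && within _ i j)%N; last first.
  suff -> : S = 0 by [].
  rewrite /S big1 ?mulr0 // => h _; rewrite term.
  case: ((i < n)%N && (j < n)%N) hw => //= hw.
  by case: and3P => // -[_ h1 h2]; rewrite (within_cat h1 h2) in hw.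
have [hij /within_split] := andP hw; have [hi hj] := andP hij.
move=> /(_ hj)[h [hn h1 h2]].
suff S0 : S != 0 by rewrite divzz S0.
have hhN := leq_trans hn hN.
rewrite /S mulf_neq0 ?gt_eqF // (bigD1 (Ordinal hhN)) //= term hij hn h1 h2 /=.
by apply: ltr_pwDl => //; apply: sumr_ge0 => ? _.
Qed.

(** At the coarsest scale a finite distance becomes 0 on the diagonal and 1 elsewhere: this starts
    the refinement. *)
Lemma ceil_dist_top i j :
  (ceil_dist lam i j)%:Z = reach_mat lam i j - (((i < n) && (j < n) && (i == j))%N : nat)%:Z.
Proof.
rewrite /reach_mat; case hw: ((i < n) && (j < n) && within (2 ^ lam) i j)%N; last first.
  rewrite ceil_dist_out ?hw //; case: eqP hw => [->|]; last by rewrite !andbF.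
  case: (j < n)%N => //=; rewrite (within_leq (leq0n _)) //=.
have [/andP[hi hj] hij] := andP hw; have [h1 h2] := ceil_distP lam hi hj hij.
rewrite hi hj /=; case: eqP => [e|ne].
  by have := h2 0%N; rewrite mul0n /= e eqxx leqn0 => /(_ isT)/eqP ->.
have := h2 1%N; rewrite mul1n hij => /(_ isT).
by case: (ceil_dist lam i j) h1 => [/= /eqP //|[|]].
Qed.

(* Seidel's parity test: the distance at scale 2 ^ l is odd iff some h near j
   is strictly closer to i at scale 2 ^ l.+1. *)
Lemma ceil_dist_refine (N : nat) (c : int) l i j : (n <= N)%N -> 0 < c ->
  let T h := (ceil_dist l.+1 i h)%:Z in
  let v := c * (\sum_(h < N) T h * reach_mat l h j) -
           T j * (c * \sum_(h < N) 1 * reach_mat l h j) in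
  (ceil_dist l i j)%:Z = 2 * T j + (v %/ (v * v + 1))%Z.
Proof.
move=> hN c0 T v.
(* The product with the all-one matrix counts the vertices near [j], so [v] sums the differences
   [T h - T j] over them, up to the factor [c]. *)
have vE : v = c * \sum_(h < N) (T h - T j) * reach_mat l h j.
  rewrite /v mulrCA -mulrBr mulr_sumr -sumrB; congr (_ * _); apply: eq_bigr => h _.
  by rewrite mul1r mulrBl.
have div_pos : 0 <= v -> (v %/ (v * v + 1))%Z = 0 by move=> h; rewrite divz_small //; nia.
have div_neg : v < 0 -> (v %/ (v * v + 1))%Z = -1.
  move=> h; have {1}-> : v = -1 * (v * v + 1) + (v * v + v + 1) by ring.
  by rewrite divzMDl ?[X in _ + X]divz_small; nia.
(* Infinite distance: the vertices near [j] are not reachable from [i] either, so all [T h] that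
   count are 0 and [v = 0]. *)
case hw: ((i < n) && (j < n) && within (2 ^ lam) i j)%N; last first.
  rewrite ceil_dist_out ?hw // /T (ceil_dist_out l.+1) ?hw // in vE *.
  suff v0 : v = 0 by rewrite v0.
  rewrite vE big1 ?mulr0 // => h _; rewrite subr0 /reach_mat.
  case hj: ((h < n) && (j < n) && within (2 ^ l) h j)%N; rewrite ?mulr0 // mulr1.
  rewrite ceil_dist_out //; apply/negP => /andP[/andP[hi hn] h1].
  have [/andP[_ hjn] h2] := andP hj.
  move: hw; rewrite hi hjn /= => /negP; apply; apply: (@within_lam (2 ^ lam + 2 ^ l)) => //.
  exact: within_cat h1 h2.
have [/andP[hi hj] hij] := andP hw.
have [t1 t2] := ceil_distP l.+1 hi hj hij; have [u1 u2] := ceil_distP l hi hj hij.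
have near h : (h < n)%N -> within (2 ^ l) h j -> within (2 ^ lam) i h.
  move=> hh hw'; apply: (@within_lam (2 ^ lam + 2 ^ l)) => //.
  exact: within_cat hij (within_sym hh hj hw').
rewrite /T in vE *; set t := ceil_dist l.+1 i j in t1 t2 vE *; set u := ceil_dist l i j in u1 u2 *.
have e2 x : (x * 2 ^ l.+1 = x.*2 * 2 ^ l)%N by rewrite expnS mulnA muln2.
have hu1 : (u <= t.*2)%N by apply: u2; rewrite -e2.
have hu2 : (t.*2 <= u.+1)%N.
  rewrite leqNgt; apply/negP => hlt.
  have := t2 t.-1; rewrite e2 => /(_ (within_leq _ u1)).
  rewrite leq_mul2r; have -> : (u <= t.-1.*2)%N by rewrite -!muln2 in hlt *; lia.
  by rewrite orbT => /(_ isT); move: hlt; rewrite -muln2; lia.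
(* Now [u] is 2 t or 2 t - 1. In the even case a vertex [h] near [j] with [T h < t] would give u <=
   2 (t - 1) + 1, so no difference is negative. *)
have [e|ne] := eqVneq u t.*2.
  rewrite div_pos ?addr0; first by rewrite e -muln2 PoszM mulrC.
  rewrite vE pmulr_rge0 //; apply: sumr_ge0 => h _; rewrite /reach_mat.
  case hh: ((h < n) && (j < n) && within (2 ^ l) h j)%N; rewrite ?mulr0 // mulr1 subr_ge0.
  have [/andP[hn _] hhj] := andP hh.
  have [w1 _] := ceil_distP l.+1 hi hn (near h hn hhj).
  rewrite lez_nat leqNgt; apply/negP => hlt.
  have := u2 (ceil_dist l.+1 i h).*2.+1; rewrite e leqNgt => /(_ _) /negP; apply.
    by rewrite mulSn addnC -e2; apply: within_cat w1 hhj.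
  by rewrite -!muln2; lia.
have eu : u.+1 = t.*2 by apply/eqP; rewrite eqn_leq hu2 ltn_neqAle ne hu1.
rewrite div_neg; first by rewrite -muln2 in eu; lia.
rewrite vE pmulr_rlt0 //.
(* In the odd case all [h] near [j] are at distance at most (u + 1) 2 ^ l = t 2 ^ (l + 1) from [i],
   so no difference is positive; a vertex [z] on a shortest walk, one step of length 2 ^ l before
   [j], makes one negative. *)
have [k ek] : exists k, t = k.+1 by case: (t) eu => // k _; exists k.
have eu' : u = (k.*2 + 1)%N by move: eu; rewrite ek doubleS addn1 => -[].
have le_t h : (h < n)%N -> within (2 ^ l) h j -> (ceil_dist l.+1 i h <= t)%N.
  move=> hn hhj; have [_ w2] := ceil_distP l.+1 hi hn (near h hn hhj).
  apply: w2; rewrite e2 -eu mulSn addnC; apply: within_cat u1 _; exact: within_sym.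
have [z [hz z1 z2]] : exists z, [/\ (z < n)%N, within (k * 2 ^ l.+1) i z & within (2 ^ l) z j].
  by apply: within_split => //; move: u1; rewrite eu' mulnDl mul1n e2.
have lt_z : (ceil_dist l.+1 i z < t)%N.
  have [_ w2] := ceil_distP l.+1 hi hz (near z hz z2).
  by rewrite ek ltnS w2.
have zN := leq_trans hz hN.
rewrite (bigD1 (Ordinal zN)) //= -oppr_gt0 opprD -sumrN; apply: ltr_pwDl.
  by rewrite /reach_mat hz hj z2 mulr1 oppr_gt0 subr_lt0 ltz_nat.
apply: sumr_ge0 => h _; rewrite /reach_mat.
case hh: ((h < n) && (j < n) && within (2 ^ l) h j)%N; rewrite ?mulr0 ?oppr0 // mulr1.
have [/andP[hn _] hhj] := andP hh.
by rewrite oppr_ge0 subr_le0 lez_nat le_t.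
Qed.
End Seidel.

(** * The all pairs shortest distances program *)

Definition region (k : expr) : expr := EMul k (EV 6).

(** Expressions have no comparison; division by 0 gives 0 on the diagonal and 1 results
    elsewhere. *)
Definition neq_expr (x y : nat) : expr :=
  EDiv (EMul (ESub (EV x) (EV y)) (ESub (EV x) (EV y)))
       (EMul (ESub (EV x) (EV y)) (ESub (EV x) (EV y))).

Lemma eval_neq r M x y (i j : nat) : r x = i%:Z -> r y = j%:Z ->
  eval r M (neq_expr x y) = (i != j)%:Z.
Proof.
move=> rx ry; rewrite /= rx ry divzz mulf_eq0 orbb subr_eq0 eqz_nat.
by case: eqP.
Qed.

Definition entry (row col dim : nat) : expr := EAdd (EMul (EV row) (EV dim)) (EV col).

(** Region 2 receives minus the identity, to which [start] adds R_lam as in [ceil_dist_top]; region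
    3 receives R_0, the adjacency matrix plus the identity. *)
Definition scatter_body : cmd := seqc
  [:: CSto (EAdd (region (EC 2)) (EV 15)) (ESub (neq_expr 13 14) (EC 1));
      CSto (EAdd (region (EC 3)) (EV 15))
           (EAdd (ELoad (entry 13 14 0)) (ESub (EC 1) (neq_expr 13 14)))].

(** Adding R_lam - 1 leaves a finite distance unchanged and turns the 0 of an unreachable pair into
    -1. *)
Definition gather_body : cmd := seqc
  [:: CSto (entry 13 14 0)
        (ESub (EAdd (ELoad (EAdd (region (EC 2)) (EV 15)))
                    (ELoad (EAdd (region (EAdd (EC 3) (EV 8))) (EV 15)))) (EC 1))].

Lemma triple_sto2 U s d1 v1 d2 v2 r M Q :
  let M1 := upd M `|eval r M d1|%N (eval r M v1) in
  (`|eval r M v1| <= U)%N -> (`|eval r M1 v2| <= U)%N ->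
  Q r (upd M1 `|eval r M1 d2|%N (eval r M1 v2)) ->
  triple U s (seqc [:: CSto d1 v1; CSto d2 v2]) r M (clen (seqc [:: CSto d1 v1; CSto d2 v2])) 0 Q.
Proof. by move=> M1 h1 h2 hQ; apply: triple_run. Qed.

Section Seidel.
Variables (q p : nat) (al be ga : nat -> nat -> int) (D : nat).
Hypothesis q1 : (1 < q)%N.
Hypothesis qp : (q * q < p)%N.
Hypothesis HB : bilinear_algorithm q p al be ga D%:Z.
Hypothesis D0 : (0 < D)%N.

Definition ones : cmd := emap (region (EC 1)) (EC 1).

Definition square_entry : expr := ELoad (EAdd (EV 30) (EV 11)).

Definition squares : cmd :=
  For 10 8 (CSeq (seqc [:: CAsg 20 (region (EAdd (EC 3) (EV 10))); CAsg 21 (EV 20)])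
           (CSeq (multiply q p al be ga)
                 (emap (region (EAdd (EC 4) (EV 10))) (EDiv square_entry square_entry)))).

Definition start : cmd :=
  emap (region (EC 2)) (EAdd (ELoad (EAdd (region (EC 2)) (EV 11)))
                             (ELoad (EAdd (region (EAdd (EC 3) (EV 8))) (EV 11)))).

Definition parity_entry : expr :=
  ESub (ELoad (EAdd (region (EAdd (EC 4) (EV 8))) (EV 11)))
       (EMul (ELoad (EAdd (region (EC 2)) (EV 11))) (ELoad (EAdd (EV 30) (EV 11)))).

(** Iteration [j] goes to scale l = lam - j - 1, whose R_l is in region 3 + l = 2 + lam - j. The
    first product is copied to the spare region 4 + lam, because the second one reuses the work
    space. *)
Definition refine : cmd :=
  For 10 8
    (CSeq (seqc [:: CAsg 20 (region (EC 2));
                    CAsg 21 (region (ESub (EAdd (EC 2) (EV 8)) (EV 10)))])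
    (CSeq (multiply q p al be ga)
    (CSeq (emap (region (EAdd (EC 4) (EV 8))) (ELoad (EAdd (EV 30) (EV 11))))
    (CSeq (seqc [:: CAsg 20 (EV 6)])
    (CSeq (multiply q p al be ga)
          (emap (region (EC 2))
            (EAdd (EMul (EC 2) (ELoad (EAdd (region (EC 2)) (EV 11))))
                  (EDiv parity_entry (EAdd (EMul parity_entry parity_entry) (EC 1)))))))))).

Section Run.
Variables (U s n L lam A : nat) (a : rel nat).
Notation side := (side q s).
Notation msize := (msize q s).
Notation psize := (psize p s).
Notation pos := (pos q s).
Notation triple := (triple U s).
Notation params := (params q p n s L lam).
Hypothesis s0 : (0 < s)%N.
Hypothesis nL : (n <= side L)%N.
Hypothesis asym : symmetric a.
Hypothesis airr : irreflexive a.
Hypothesis within_lam : forall d x y, (x < n)%N -> (y < n)%N -> within n a d x y -> within n a (2 ^ lam) x y.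
Hypothesis hal : forall t, (t < p)%N -> (\sum_(c < q * q) `|al t c| <= A)%N.
Hypothesis hbe : forall t, (t < p)%N -> (\sum_(c < q * q) `|be t c| <= A)%N.
Hypothesis hga : forall c, (c < q * q)%N -> (\sum_(t < p) `|ga c t| <= A)%N.
Hypothesis A0 : (0 < A)%N.
Hypothesis BU : (2 ^ lam.+2 + 2 <= U)%N.
Hypothesis encU : (A ^ L * 2 ^ lam.+2 <= U)%N.
Hypothesis decU : (A ^ L * (s * ((A ^ L * 2 ^ lam.+2) * (A ^ L * 2 ^ lam.+2))) <= U)%N.
Hypothesis workU : ((5 + lam) * psize L + (3 * L + 1) * psize L <= U)%N.

Let N := msize L.
Let Z := psize L.
Let w0 := ((5 + lam) * Z)%N.

Let q0 : (0 < q)%N. Proof. exact: ltnW. Qed.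
Let p0 : (0 < p)%N. Proof. exact: leq_ltn_trans qp. Qed.
Let Z0 : (0 < Z)%N. Proof. exact: psize_gt0. Qed.
Let NZ : (N <= Z)%N. Proof. by rewrite leq_mul2r leq_expn2 ?orbT // ltnW. Qed.
Let w0U : (w0 <= U)%N. Proof. by apply: leq_trans workU; rewrite leq_addr. Qed.
Let ZU : (Z <= U)%N. Proof. by apply: leq_trans w0U; rewrite leq_pmull. Qed.
Let nnN : (n * n <= N)%N. Proof. by rewrite /N msize_side leq_mul. Qed.

(** The bound is stated for all cells, separately from the entries: [pos] is only shown to be
    injective, so it would not follow from a bound on [F]. *)
Definition mat (M : nat -> int) (k : nat) (F : nat -> nat -> int) (B : nat) : Prop :=
  (forall i j, (i < side L)%N -> (j < side L)%N -> M (k * Z + pos L i j)%N = F i j) /\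
  (forall x, (x < N)%N -> (`|M (k * Z + x)%N| <= B)%N).

Lemma mat_eq M M' k F B : (forall x, (x < N)%N -> M' (k * Z + x)%N = M (k * Z + x)%N) ->
  mat M k F B -> mat M' k F B.
Proof.
move=> h [h1 h2]; split=> [i j hi hj|x hx]; last by rewrite h ?h2.
by rewrite h ?h1 ?pos_lt.
Qed.

Lemma mat_le M k F B B' : (B <= B')%N -> mat M k F B -> mat M k F B'.
Proof. by move=> h [h1 h2]; split=> // x hx; apply: leq_trans (h2 x hx) h. Qed.

Lemma region_lt k x : (k < 5 + lam)%N -> (x < N)%N -> (k * Z + x < w0)%N.
Proof. by move=> hk hx; apply: ltn_mulD => //; apply: leq_trans NZ. Qed.

Lemma region_eq k k' x y : (x < N)%N -> (y < N)%N ->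
  (k * Z + x == k' * Z + y)%N = (k == k') && (x == y).
Proof. by move=> hx hy; rewrite eq_mulnD //; apply: leq_trans NZ. Qed.

Lemma mat_keep M M' k F B : (k < 5 + lam)%N -> keep w0 M M' -> mat M k F B -> mat M' k F B.
Proof. by move=> hk hw; apply: mat_eq => x hx; rewrite hw // region_lt. Qed.

Lemma mat_blit M M' k k' g F B : (forall y, M' y = blit (k * Z) N g M y) -> k' != k ->
  mat M k' F B -> mat M' k' F B.
Proof.
move=> h ne; apply: mat_eq => x hx; rewrite h blit_out //.
have hxZ := leq_trans hx NZ.
case: (ltngtP k' k) ne => // hk _; apply/orP; [left|right].
  by apply: (@leq_trans (k'.+1 * Z)); rewrite ?leq_mul2r ?hk ?orbT // mulSnr ltn_add2l.
apply: (@leq_trans (k.+1 * Z)); first by rewrite mulSnr leq_add2l.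
by rewrite (leq_trans _ (leq_addr _ _)) // leq_mul2r hk orbT.
Qed.

Lemma mat_blit_same M M' k g F B : (forall y, M' y = blit (k * Z) N g M y) ->
  (forall i j, (i < side L)%N -> (j < side L)%N -> g (pos L i j) = F i j) ->
  (forall x, (x < N)%N -> (`|g x| <= B)%N) -> mat M' k F B.
Proof.
move=> h h1 h2; split=> [i j hi hj|x hx]; rewrite h blit_in ?h1 ?h2 //.
exact: pos_lt.
Qed.

Lemma triple_multiply_regions x y F G r M : params r ->
  r 20%N = (x * Z)%N%:Z -> r 21%N = (y * Z)%N%:Z -> (x < 5 + lam)%N -> (y < 5 + lam)%N ->
  mat M x F (2 ^ lam.+2) -> mat M y G (2 ^ lam.+2) ->
  triple (multiply q p al be ga) r M (Z * multiply_cost q p al be ga) (p ^ L) (fun r' M' =>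
    [/\ agree multiply_vars r r', keep w0 M M' &
      exists b, [/\ r' 30%N = b%:Z, (w0 <= b)%N & forall i k, (i < side L)%N -> (k < side L)%N ->
        M' (b + pos L i k)%N = (D ^ L)%N%:Z * \sum_(j < side L) F i j * G j k]]).
Proof.
move=> [[_ r1] [r2 r3] [_ r5] [r6 r7] [_ r9]] r20 r21 hx hy [F1 F2] [G1 G2].
have hle k : (k < 5 + lam)%N -> (k * Z + N <= w0)%N.
  by move=> hk; apply: (@leq_trans (k.+1 * Z)); rewrite ?leq_mul2r ?hk ?orbT // mulSnr leq_add2l.
apply: (triple_le (triple_multiply q0 qp HB (s := s) (L := L) (w := w0) (xa := x * Z) (xb := y * Z)
  (f := fun u => M (x * Z + u)%N) (g := fun u => M (y * Z + u)%N) s0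
  r1 r2 r3 r5 r6 r7 r9 r20 r21 _ _ (hle _ hx) (hle _ hy) F2 G2 hal hbe hga A0 encU decU workU ZU)) => //.
move=> r' M' [ag hk [b [h [e30 hb hh prod]]]]; split=> //; exists b; split=> // i k hi hk'.
rewrite hh ?pos_lt // prod //; congr (_ * _); apply: eq_bigr => j _.
by rewrite F1 ?G1.
Qed.

Lemma mat_ext M k F G B : (forall i j, (i < side L)%N -> (j < side L)%N -> F i j = G i j) ->
  mat M k F B -> mat M k G B.
Proof. by move=> h [h1 h2]; split=> // i j hi hj; rewrite h1 ?h. Qed.

Lemma mat_upd M k F B i j v : (i < side L)%N -> (j < side L)%N -> (`|v| <= B)%N -> mat M k F B ->
  mat (upd M (k * Z + pos L i j)%N v) k (fun x y => if (x == i) && (y == j) then v else F x y) B.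
Proof.
move=> hi hj hv [h1 h2]; split=> [x y hx hy|x hx]; rewrite /upd region_eq ?pos_lt // eqxx /=.
  case: eqP => [/(pos_inj s0 q0 hx hy hi hj)[-> ->]|ne]; first by rewrite !eqxx.
  by rewrite h1 //; case: eqP => // ex; case: eqP => // ey; rewrite ex ey in ne.
by case: eqP => // _; apply: h2.
Qed.

Lemma mat_upd_other M k k' F B i j v : (i < side L)%N -> (j < side L)%N -> k' != k ->
  mat M k' F B -> mat (upd M (k * Z + pos L i j)%N v) k' F B.
Proof.
move=> hi hj ne; apply: mat_eq => x hx.
by rewrite /upd region_eq ?pos_lt // (negbTE ne).
Qed.

Definition identity_mat (i j : nat) : int := (((i < n) && (j < n) && (i == j))%N : nat)%:Z.

Definition visited (i j x y : nat) : bool :=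
  ((x < n) && (y < n) && ((x < i) || (x == i) && (y < j)))%N.

Lemma visitedS i j x y : (i < n)%N -> (j < n)%N ->
  visited i j.+1 x y = ((x == i) && (y == j)) || visited i j x y.
Proof. by rewrite /visited; lia. Qed.

Lemma visited_row i x y : visited i n x y = visited i.+1 0 x y.
Proof. by rewrite /visited; lia. Qed.

Lemma visited_all x y : visited n 0 x y = (x < n)%N && (y < n)%N.
Proof. by rewrite /visited; lia. Qed.

Lemma params_vars r : params r -> [/\ r 0%N = n%:Z, r 6%N = Z%:Z, r 5%N = N%:Z & r 8%N = lam%:Z].
Proof. by case=> -[? ?] _ [_ ?] [? _] [? _]. Qed.

Lemma triple_scatter r M : params r ->
  (forall i j, (i < n)%N -> (j < n)%N -> M (i * n + j)%N = (a i j : nat)%:Z) ->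
  (forall y, (n * n <= y)%N -> M y = 0) ->
  triple (position_loop q scatter_body) r M
    (n * (n * ((L * 72 + 60 + clen scatter_body) + 13) + 10 + 13) + 10) 0
    (fun r' M' => [/\ agree position_loop_vars r r',
       mat M' 2 (fun i j => - identity_mat i j) 1 & mat M' 3 (reach_mat n a 0) 2]).
Proof.
move=> hp hM hM0.
have U2 : (2 <= U)%N by apply: leq_trans BU; rewrite addnC leq_addr.
pose J i j M' := [/\ keep (2 * Z) M M',
  mat M' 2 (fun x y => if visited i j x y then - identity_mat x y else 0) 1 &
  mat M' 3 (fun x y => if visited i j x y then reach_mat n a 0 x y else 0) 2].
have zero k : (1 < k)%N -> (forall x, M (k * Z + x)%N = 0).
  move=> hk x; apply: hM0; apply: leq_trans (leq_addr _ _).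
  by apply: leq_trans nnN _; apply: leq_trans NZ _; rewrite leq_pmull // ltnW.
apply: (triple_le (triple_position_loop q1 qp (I := J) (body := scatter_body) (T := clen scatter_body) s0 hp nL (leq_trans NZ ZU) _ _ _)) => //.
- have vis x y : visited 0 0 x y = false by rewrite /visited; lia.
  by split=> //; split=> [x y hx hy|x hx]; rewrite zero ?vis.
- move=> i M' [k1 k2 k3]; split=> //.
    by apply: mat_ext k2 => x y _ _; rewrite visited_row.
  by apply: mat_ext k3 => x y _ _; rewrite visited_row.
- move=> i j r' M' hi hj ag ri rj rp [k1 k2 k3].
  have [h0 h6 _ _] := params_vars hp.
  have e0 : r' 0%N = n%:Z by rewrite ag.
  have e6 : r' 6%N = Z%:Z by rewrite ag.
  have a2 M1 : `|eval r' M1 (EAdd (region (EC 2)) (EV 15))|%N = (2 * Z + pos L i j)%N.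
    by rewrite /= e6 rp -PoszM -PoszD.
  have a3 M1 : `|eval r' M1 (EAdd (region (EC 3)) (EV 15))|%N = (3 * Z + pos L i j)%N.
    by rewrite /= e6 rp -PoszM -PoszD.
  have ae M1 : `|eval r' M1 (entry 13 14 0)|%N = (i * n + j)%N.
    by rewrite /= ri rj e0 -PoszM -PoszD.
  have hs : (i < side L)%N by exact: leq_trans hi nL.
  have hs' : (j < side L)%N by exact: leq_trans hj nL.
  have hadr : (i * n + j < Z)%N by apply: leq_trans (leq_trans (ltn_mulD hi hj) nnN) NZ.
  have v2 M1 : eval r' M1 (ESub (neq_expr 13 14) (EC 1)) = - identity_mat i j.
    rewrite -[LHS]/(eval r' M1 (neq_expr 13 14) - 1) (eval_neq _ ri rj) /identity_mat hi hj /=.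
    by case: eqP.
  set M1 := upd M' (2 * Z + pos L i j)%N (- identity_mat i j).
  have k1' : keep (2 * Z) M M1.
    by move=> y hy; rewrite /M1 /upd; case: eqP => [e|_]; [move: hy; rewrite e; lia|exact: k1].
  have v3 : eval r' M1 (EAdd (ELoad (entry 13 14 0)) (ESub (EC 1) (neq_expr 13 14))) = reach_mat n a 0 i j.
    rewrite -[LHS]/(M1 `|eval r' M1 (entry 13 14 0)|%N + (1 - eval r' M1 (neq_expr 13 14))).
    rewrite ae (eval_neq _ ri rj) k1'; last by apply: leq_trans hadr _; rewrite leq_pmull.
    rewrite hM // /reach_mat hi hj expn0 /=.
    have -> : has (fun z => (i == z) && a z j) (iota 0 n) = a i j.
      apply/hasP/idP => [[z _ /andP[/eqP <-]] //|haij]; exists i; rewrite ?mem_iota //.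
      by rewrite eqxx.
    (* Irreflexivity keeps the diagonal of the adjacency matrix plus the identity equal to 1. *)
    by case: eqP => [->|_]; rewrite ?airr //; case: (a i j).
  have b2 : (`|(- identity_mat i j)%R| <= 1)%N by rewrite /identity_mat; case: (_ && _).
  have b3 : (`|reach_mat n a 0 i j| <= 2)%N by rewrite /reach_mat; case: (_ && _).
  apply: triple_sto2; rewrite v2.
  - exact: leq_trans b2 (ltnW U2).
  - by rewrite a2 -/M1 v3; exact: leq_trans b3 U2.
  split=> //; rewrite a2 -/M1 a3 v3.
  split.
  + by move=> y hy; rewrite /upd; case: eqP => [e|_]; [move: hy; rewrite e; lia|exact: k1'].
  + apply: mat_upd_other => //; apply: mat_ext (mat_upd hs hs' b2 k2) => x y _ _.
    by rewrite visitedS //; case: eqP => [->|] //; case: eqP => [->|].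
  + apply: mat_ext (mat_upd hs hs' b3 (mat_upd_other _ hs hs' _ k3)) => // x y _ _.
    by rewrite visitedS //; case: eqP => [->|] //; case: eqP => [->|].
move=> r' M' [ag [_ k2 k3]]; split=> //.
  apply: mat_ext k2 => x y _ _; rewrite visited_all /identity_mat.
  by case: (x < n)%N; case: (y < n)%N.
apply: mat_ext k3 => x y _ _; rewrite visited_all /reach_mat.
by case: (x < n)%N; case: (y < n)%N.
Qed.

Definition seidel_vars : seq nat := [:: 10; 11; 20; 21]%N ++ multiply_vars.

Lemma seidel_params r r' : agree seidel_vars r r' -> params r -> params r'.
Proof. by move=> ag; apply: (params_agree q1 qp) ag. Qed.

Lemma multiply_seidel : {subset multiply_vars <= seidel_vars}.
Proof. by move=> x hx; rewrite mem_cat hx orbT. Qed.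

Lemma emap_seidel : {subset [:: 11]%N <= seidel_vars}.
Proof. by move=> x; rewrite !inE => /eqP ->. Qed.

Definition square_cost : nat := emap_cost (region (EAdd (EC 4) (EV 10))) (EDiv square_entry square_entry).

Lemma absz_divzz_le (x : int) : (`|(x %/ x)%Z| <= 1)%N.
Proof. by rewrite divzz; case: eqP. Qed.

Lemma triple_squares r M : params r -> mat M 3 (reach_mat n a 0) 2 ->
  triple squares r M (lam * ((19 + (Z * multiply_cost q p al be ga + (N * square_cost + 10))) + 13) + 10) (lam * p ^ L)
    (fun r' M' => [/\ agree seidel_vars r r',
       forall k, (k <= lam)%N -> mat M' (3 + k) (reach_mat n a k) 2 &
       forall k F B, (k < 3)%N -> mat M k F B -> mat M' k F B]).
Proof.
move=> hp hR0; have [h0 h6 h5 h8] := params_vars hp.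
pose I j M' := (forall k, (k <= j)%N -> mat M' (3 + k) (reach_mat n a k) 2) /\
  (forall k F B, (k < 3)%N -> mat M k F B -> mat M' k F B).
have B2 : (2 <= 2 ^ lam.+2)%N by rewrite -{1}(expn1 2) leq_pexp2l.
apply: (@triple_for_mem _ _ seidel_vars _ _ _ lam _ (p ^ L) _ _ _ I) => //.
- by split=> // k; rewrite leqn0 => /eqP ->.
- move=> j r1 M1 hj ag1 rj [hR hk].
  have hp1 := seidel_params ag1 hp.
  have [e0 e6 e5 e8] := params_vars hp1.
  have lt3 : (3 + j < 5 + lam)%N by lia.
  have lt4 : (4 + j < 5 + lam)%N by lia.
  have e3 : (3 + j%:Z) * Z%:Z = ((3 + j) * Z)%N%:Z by rewrite PoszM PoszD.
  have hU : ((3 + j) * Z <= U)%N by apply: leq_trans w0U; rewrite leq_mul2r (ltnW lt3) orbT.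
  rewrite -[(p ^ L)%N]/(0 + p ^ L)%N; apply: triple_seq; apply: triple_run => // hr hM; split.
    by rewrite /= /upd /= rj e6 e3 !absz_nat.
  rewrite /= /upd /= rj e6 e3; set r2 := (X in triple _ X _).
  have ag2 : agree seidel_vars r r2.
    by apply: agree_trans ag1 _ => x hx; rewrite /r2 !(notin_eq hx).
  have hp2 := seidel_params ag2 hp.
  rewrite -[(p ^ L)%N]addn0; apply: triple_seq.
  have hRj := mat_le B2 (hR j (leqnn j)).
  apply: (triple_le (triple_multiply_regions hp2 (erefl _) (erefl _) lt3 lt3 hRj hRj)) => //.
  move=> r3 M3 [ag3 hk3 [b [e30 hb prod]]].
  have ag3' := agree_trans ag2 (agree_sub multiply_seidel ag3).
  have [f0 f6 f5 f8] := params_vars (seidel_params ag3' hp).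
  have f10 : r3 10%N = j%:Z by rewrite ag3.
  pose g x := (M3 (b + x)%N %/ M3 (b + x)%N)%Z.
  apply: (triple_le (triple_emap (N := N) (b := (4 + j) * Z) (g := g) s f5 _ _)) => //.
  + move=> x r4 M4 hx ag4 rx hM4; rewrite /= !(ag4 10%N) // !(ag4 6%N) // !(ag4 30%N) // f10 f6 e30 rx.
    rewrite -PoszD absz_nat hM4 /g; first by split=> //; rewrite PoszM PoszD.
    apply/orP; right; rewrite leq_add2r; apply: leq_trans hb; rewrite leq_mul2r (ltnW lt4) orbT //.
  + by move=> x hx; apply: leq_trans (absz_divzz_le _) _; apply: leq_trans BU; rewrite addnC.
  move=> r4 M4 [ag4 hM4]; split.
  + exact: agree_trans ag3' (agree_sub emap_seidel ag4).
  + by rewrite ag4.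
  split=> [k|k F B k3 hF].
    rewrite leq_eqVlt => /orP[/eqP ->|hkj]; last first.
      have ne : (3 + k)%N != (4 + j)%N by lia.
      by apply: mat_blit hM4 ne _; apply: mat_keep hk3 (hR k _); lia.
    rewrite -[(3 + j.+1)%N]/(4 + j)%N; apply: mat_blit_same hM4 _ _ => [x y hx hy|x hx].
      by rewrite /g prod // -(@reach_mat_square n a (side L)) // ltz_nat expn_gt0 D0.
    exact: leq_trans (absz_divzz_le _) _.
  have ne : k != (4 + j)%N by lia.
  apply: mat_blit hM4 ne _; apply: mat_keep hk3 _; [lia|exact: hk].
- by move=> r' M' ag [h1 h2].
Qed.

Definition ceil_mat (l i j : nat) : int := (ceil_dist n lam a l i j)%:Z.

Definition start_cost : nat := emap_cost (region (EC 2)) (EAdd (ELoad (EAdd (region (EC 2)) (EV 11)))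
                             (ELoad (EAdd (region (EAdd (EC 3) (EV 8))) (EV 11)))).

Lemma triple_start r M : params r -> mat M 2 (fun i j => - identity_mat i j) 1 ->
  mat M (3 + lam) (reach_mat n a lam) 2 ->
  triple start r M (N * start_cost + 10) 0
    (fun r' M' => [/\ agree seidel_vars r r', mat M' 2 (ceil_mat lam) 3 &
       forall k F B, k != 2%N -> mat M k F B -> mat M' k F B]).
Proof.
move=> hp hI hR; have [h0 h6 h5 h8] := params_vars hp.
pose g x := M (2 * Z + x)%N + M ((3 + lam) * Z + x)%N.
have gB x : (x < N)%N -> (`|g x| <= 3)%N.
  by move=> hx; apply: leq_trans (leq_absz_add _ _) (leq_add (hI.2 x hx) (hR.2 x hx)).
apply: (triple_le (triple_emap (N := N) (b := 2 * Z) (g := g) s h5 _ _)) => //.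
- move=> x r4 M4 hx ag4 rx hM4; rewrite /= !(ag4 6%N) // !(ag4 8%N) // h6 h8 rx.
  have -> : 2 * Z%:Z + x%:Z = (2 * Z + x)%N%:Z by rewrite PoszD PoszM.
  have -> : (3 + lam%:Z) * Z%:Z + x%:Z = ((3 + lam) * Z + x)%N%:Z by rewrite PoszD PoszM PoszD.
  rewrite !absz_nat !hM4; first by split=> //; rewrite PoszM.
    by apply/orP; right; rewrite leq_add2r leq_mul2r orbC.
  by rewrite leqnn orbT.
- move=> x hx; apply: leq_trans (gB x hx) _; apply: leq_trans BU.
  by rewrite -[3%N]/(1 + 2)%N leq_add2r expn_gt0.
move=> r4 M4 [ag4 hM4]; split.
- exact: agree_sub emap_seidel ag4.
- apply: mat_blit_same hM4 _ gB => x y hx hy.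
  by rewrite /g hI.1 // hR.1 // /ceil_mat ceil_dist_top addrC.
- by move=> k F B ne; apply: mat_blit hM4 ne.
Qed.

Definition copy_cost : nat :=
  emap_cost (region (EAdd (EC 4) (EV 8))) (ELoad (EAdd (EV 30) (EV 11))).
Definition parity_cost : nat :=
  emap_cost (region (EC 2)) (EAdd (EMul (EC 2) (ELoad (EAdd (region (EC 2)) (EV 11))))
                  (EDiv parity_entry (EAdd (EMul parity_entry parity_entry) (EC 1)))).

Lemma absz_parity_le (v : int) : (`|(v %/ (v * v + 1))%Z| <= 1)%N.
Proof.
have [h|h] := leP 0 v; first by rewrite divz_small //; nia.
have {1}-> : v = -1 * (v * v + 1) + (v * v + v + 1) by ring.
by rewrite divzMDl ?[X in _ + X]divz_small; nia.
Qed.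

Lemma triple_refine r M : params r -> mat M 1 (fun _ _ => 1) 1 -> mat M 2 (ceil_mat lam) 3 ->
  (forall k, (k <= lam)%N -> mat M (3 + k) (reach_mat n a k) 2) ->
  triple refine r M
    (lam * ((22 + (Z * multiply_cost q p al be ga + ((N * copy_cost + 10) + (4 +
       (Z * multiply_cost q p al be ga + (N * parity_cost + 10)))))) + 13) + 10) (lam * (p ^ L + p ^ L))
    (fun r' M' => [/\ agree seidel_vars r r', mat M' 2 (ceil_mat 0) (2 ^ lam.+2) &
       mat M' (3 + lam) (reach_mat n a lam) 2]).
Proof.
move=> hp hJ hT hR; have [h0 h6 h5 h8] := params_vars hp.
have B2 : (2 <= 2 ^ lam.+2)%N by rewrite -{1}(expn1 2) leq_pexp2l.
(* A refinement sends x to at most 2 x + 1, which maps 2 ^ k - 1 to 2 ^ (k + 1) - 1; the initial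
   bound 3 is 2 ^ 2 - 1. This is the origin of 2 ^ (lam + 2). *)
pose I j M' := [/\ mat M' 1 (fun _ _ => 1) 1,
  mat M' 2 (ceil_mat (lam - j)) (2 ^ j.+2).-1 &
  forall k, (k <= lam)%N -> mat M' (3 + k) (reach_mat n a k) 2].
apply: (@triple_for_mem _ _ seidel_vars _ _ _ lam _ (p ^ L + p ^ L) _ _ _ I) => //.
- by split=> //; rewrite subn0.
- move=> j r1 M1 hj ag1 rj [hJ1 hT1 hR1].
  have hp1 := seidel_params ag1 hp.
  have [e0 e6 e5 e8] := params_vars hp1.
  have eL : (lam - j = (lam - j.+1).+1)%N by rewrite subnSK.
  move: hT1; rewrite eL; set l := (lam - j.+1)%N => hT1.
  have hl : (l <= lam)%N by rewrite /l leq_subr.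
  have lt3 : (3 + l < 5 + lam)%N by move: hl; clear; lia.
  have hBj : (2 ^ j.+3 <= 2 ^ lam.+2)%N by rewrite leq_pexp2l.
  have hU k : (k < 5 + lam)%N -> (k * Z <= U)%N.
    by move=> hk; apply: leq_trans w0U; rewrite leq_mul2r (ltnW hk) orbT.
  have e2 : 2 * Z%:Z = (2 * Z)%N%:Z by rewrite PoszM.
  have e3 : (2 + lam%:Z - j%:Z) * Z%:Z = ((3 + l) * Z)%N%:Z.
    by rewrite PoszM PoszD; congr (_ * _); move: hj; rewrite /l; clear; lia.
  rewrite -[X in triple _ _ _ _ X _]add0n; apply: triple_seq; apply: triple_run => // hr hM; split.
    by rewrite /= /upd /= rj e6 e8 e2 e3 !absz_nat; split; rewrite ?hU.
  rewrite /= /upd /= rj e6 e8 e2 e3; set r2 := (X in triple _ X _).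
  have ag2 : agree seidel_vars r r2.
    by apply: agree_trans ag1 _ => x hx; rewrite /r2 !(notin_eq hx).
  have hp2 := seidel_params ag2 hp.
  apply: triple_seq.
  have hT1' : mat M1 2 (ceil_mat l.+1) (2 ^ lam.+2).
    apply: mat_le hT1; apply: leq_trans (leq_pred _) _; apply: leq_trans hBj.
    by rewrite leq_pexp2l.
  have hJ1' : mat M1 1 (fun _ _ => 1) (2 ^ lam.+2) by apply: mat_le hJ1; exact: ltnW.
  have hRl := mat_le B2 (hR1 l hl).
  apply: (triple_le (triple_multiply_regions hp2 (erefl _) (erefl _) (x := 2) isT lt3 hT1' hRl)) => //.
  move=> r3 M3 [ag3 hk3 [b [e30 hb prod]]].
  have ag3' := agree_trans ag2 (agree_sub multiply_seidel ag3).
  have [f0 f6 f5 f8] := params_vars (seidel_params ag3' hp).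
  have f10 : r3 10%N = j%:Z by rewrite ag3.
  have f21 : r3 21%N = ((3 + l) * Z)%N%:Z by rewrite ag3.
  (* The copied product is a stored array, so its cells are at most [U], and no finer bound is
     carried. The parity test squares such values inside one expression, where [csize] covers
     them. *)
  apply: triple_bounded => _ hM3.
  rewrite -[X in triple _ _ _ _ X _]add0n; apply: triple_seq.
  apply: (triple_le (triple_emap (N := N) (b := (4 + lam) * Z) (g := fun x => M3 (b + x)%N) s f5 _ _)) => //.
    move=> x r4 M4 hx ag4 rx hM4; rewrite /= !(ag4 8%N) // !(ag4 6%N) // !(ag4 30%N) // f8 f6 e30 rx.
    rewrite -PoszD absz_nat hM4; first by split=> //; rewrite PoszM PoszD.
    by apply/orP; right; rewrite leq_add2r; apply: leq_trans hb; rewrite leq_mul2r leqnSn orbT.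
  move=> r4 M4 [ag4 hM4].
  have ag4' := agree_trans ag3' (agree_sub emap_seidel ag4).
  have [g0 g6 g5 g8] := params_vars (seidel_params ag4' hp).
  have g10 : r4 10%N = j%:Z by rewrite ag4.
  have g21 : r4 21%N = ((3 + l) * Z)%N%:Z by rewrite ag4.
  have ne k : (k < 4 + lam)%N -> k != (4 + lam)%N by move=> h; rewrite neq_ltn h.
  have hX4 : mat M4 (4 + lam) (fun i k => (D ^ L)%N%:Z * \sum_(h < side L) ceil_mat l.+1 i h * reach_mat n a l h k) U.
    by apply: mat_blit_same hM4 _ _ => [x y hx hy|x hx]; [rewrite prod|exact: hM3].
  have keep4 k F B : (k < 4 + lam)%N -> mat M1 k F B -> mat M4 k F B.
    by move=> hk hF; apply: mat_blit hM4 (ne _ hk) (mat_keep (ltnW _) hk3 hF).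
  rewrite -[X in triple _ _ _ _ X _]add0n; apply: triple_seq; apply: triple_run => // hr4 hM4b; split.
    by rewrite /= g6 !absz_nat.
  rewrite /= g6; set r5 := (X in triple _ X _).
  have ag5 : agree seidel_vars r r5.
    by apply: agree_trans ag4' _; apply: agree_upd.
  have hp5 := seidel_params ag5 hp.
  rewrite -[X in triple _ _ _ _ X _]addn0; apply: triple_seq.
  have r5_20 : r5 20%N = (1 * Z)%N%:Z by rewrite mul1n.
  have hJ4 : mat M4 1 (fun _ _ => 1) (2 ^ lam.+2) by exact: keep4.
  have hR4 : mat M4 (3 + l) (reach_mat n a l) (2 ^ lam.+2) by apply: keep4; rewrite // ltnS.
  apply: (triple_le (triple_multiply_regions hp5 r5_20 g21 isT lt3 hJ4 hR4)) => //.
  move=> r6 M6 [ag6 hk6 [b6 [i30 hb6 prod6]]].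
  have ag6' := agree_trans ag5 (agree_sub multiply_seidel ag6).
  have [i0 i6 i5 i8] := params_vars (seidel_params ag6' hp).
  have i10 : r6 10%N = j%:Z by rewrite ag6.
  have hT6 : mat M6 2 (ceil_mat l.+1) (2 ^ j.+2).-1 by apply: mat_keep hk6 _ => //; apply: keep4.
  have hX6 : mat M6 (4 + lam) (fun i k => (D ^ L)%N%:Z * \sum_(h < side L) ceil_mat l.+1 i h * reach_mat n a l h k) U.
    by apply: mat_keep hk6 hX4.
  pose v x := M6 ((4 + lam) * Z + x)%N - M6 (2 * Z + x)%N * M6 (b6 + x)%N.
  pose g x := 2 * M6 (2 * Z + x)%N + (v x %/ (v x * v x + 1))%Z.
  have gB x : (x < N)%N -> (`|g x| <= (2 ^ j.+3).-1)%N.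
    move=> hx; have h1 := hT6.2 x hx; have h2 := absz_parity_le (v x).
    have h3 := expn_gt0 2 j.+2; rewrite /g expnS; move: h1 h2 h3.
    move: (M6 (2 * Z + x)%N) (v x %/ (v x * v x + 1))%Z (2 ^ j.+2)%N; clear; lia.
  apply: (triple_le (triple_emap (N := N) (b := 2 * Z) (g := g) s i5 _ _)) => //.
  + move=> x r7 M7 hx ag7 rx hM7.
    have x2 : 2 * Z%:Z + x%:Z = (2 * Z + x)%N%:Z by rewrite PoszD PoszM.
    have x4 : (4 + lam%:Z) * Z%:Z + x%:Z = ((4 + lam) * Z + x)%N%:Z by rewrite PoszD PoszM PoszD.
    rewrite /= !(ag7 8%N) // !(ag7 6%N) // !(ag7 30%N) // i6 i8 i30 rx x2 x4 -PoszD !absz_nat.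
    rewrite !hM7; first by rewrite -/(v x) e2.
    * by apply/orP; right; rewrite leq_add2r; apply: leq_trans hb6; rewrite leq_mul2r orbC.
    * by apply/orP; right; rewrite leq_add2r leq_mul2r orbC.
    * by rewrite leqnn orbT.
  + move=> x hx; apply: leq_trans (gB x hx) _; apply: leq_trans (leq_pred _) _.
    by apply: leq_trans hBj _; apply: leq_trans BU; rewrite leq_addr.
  move=> r7 M7 [ag7 hM7]; split.
  + exact: agree_trans ag6' (agree_sub emap_seidel ag7).
  + by rewrite ag7.
  split.
  + by apply: mat_blit hM7 _ _ => //; apply: mat_keep hk6 _ => //; apply: keep4.
  + apply: mat_blit_same hM7 _ gB => x y hx hy.
    rewrite /g /v hT6.1 // hX6.1 // prod6 //; apply/esym.
    by apply: (ceil_dist_refine asym within_lam); rewrite // ltz_nat expn_gt0 D0.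
  + move=> k hk; apply: mat_blit hM7 _ _ => //; apply: mat_keep hk6 _; first by move: hk; clear; lia.
    by apply: keep4; [rewrite ltnS|exact: hR1].
- move=> r' M' ag [_ h2 h3]; split=> //; last exact: h3.
  by rewrite subnn in h2; apply: mat_le h2; apply: leq_pred.
Qed.

Lemma triple_gather r M : params r -> mat M 2 (ceil_mat 0) (2 ^ lam.+2) ->
  mat M (3 + lam) (reach_mat n a lam) 2 ->
  triple (position_loop q gather_body) r M
    (n * (n * ((L * 72 + 60 + clen gather_body) + 13) + 10 + 13) + 10) 0
    (fun r' M' => forall i j, (i < n)%N -> (j < n)%N ->
       M' (i * n + j)%N = ceil_mat 0 i j + reach_mat n a lam i j - 1).
Proof.
move=> hp hT hR.
pose J i j (M' : nat -> int) := (forall y, (Z <= y)%N -> M' y = M y) /\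
  forall x y, visited i j x y -> M' (x * n + y)%N = ceil_mat 0 x y + reach_mat n a lam x y - 1.
apply: (triple_le (triple_position_loop q1 qp (I := J) (body := gather_body) (T := clen gather_body) s0 hp nL (leq_trans NZ ZU) _ _ _)) => //.
- by split=> // x y; rewrite /visited; lia.
- by move=> i M' [k1 k2]; split=> // x y; rewrite -visited_row; apply: k2.
- move=> i j r' M' hi hj ag ri rj rp [k1 k2].
  have [h0 h6 _ h8] := params_vars hp.
  have e0 : r' 0%N = n%:Z by rewrite ag.
  have e6 : r' 6%N = Z%:Z by rewrite ag.
  have e8 : r' 8%N = lam%:Z by rewrite ag.
  have hs : (i < side L)%N by exact: leq_trans hi nL.
  have hs' : (j < side L)%N by exact: leq_trans hj nL.
  have x2 : 2 * Z%:Z + (pos L i j)%:Z = (2 * Z + pos L i j)%N%:Z by rewrite PoszD PoszM.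
  have x3 : (3 + lam%:Z) * Z%:Z + (pos L i j)%:Z = ((3 + lam) * Z + pos L i j)%N%:Z.
    by rewrite PoszD PoszM PoszD.
  have xe : i%:Z * n%:Z + j%:Z = (i * n + j)%N%:Z by rewrite PoszD PoszM.
  have hZ k : (0 < k)%N -> (Z <= k * Z + pos L i j)%N.
    by move=> hk; apply: leq_trans (leq_addr _ _); rewrite leq_pmull.
  have v : eval r' M' (ESub (EAdd (ELoad (EAdd (region (EC 2)) (EV 15)))
                    (ELoad (EAdd (region (EAdd (EC 3) (EV 8))) (EV 15)))) (EC 1)) =
      ceil_mat 0 i j + reach_mat n a lam i j - 1.
    by rewrite /= e6 e8 rp x2 x3 !absz_nat !k1 ?hZ // hT.1 // hR.1.
  have vB : (`|(ceil_mat 0 i j + reach_mat n a lam i j - 1)%R| <= U)%N.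
    apply: leq_trans BU; have := hT.2 _ (pos_lt s0 q0 hs hs'); rewrite hT.1 //.
    have : (reach_mat n a lam i j = 0) \/ (reach_mat n a lam i j = 1).
      by rewrite /reach_mat; case: (_ && _); [right|left].
    rewrite /ceil_mat; move: (ceil_dist _ _ _ _ _ _) (2 ^ lam.+2)%N (reach_mat _ _ _ _ _); clear; lia.
  apply: triple_run => // _ _; rewrite /gather_body /=; split.
    by split=> //; move: v => /= ->.
  split=> //; move: v => /= ->; rewrite ri rj e0 xe absz_nat.
  have hadr : (i * n + j < Z)%N by apply: leq_trans (leq_trans (ltn_mulD hi hj) nnN) NZ.
  split=> [y hy|x y].
    by rewrite /upd; case: eqP => [e|_]; [move: hy; rewrite e leqNgt hadr|exact: k1].
  rewrite visitedS // => /orP[/andP[/eqP -> /eqP ->]|hv]; first by rewrite /upd eqxx.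
  have /andP[/andP[hx hy] _] := hv.
  rewrite /upd eq_mulnD //; case: andP => [[/eqP -> /eqP ->] //|_].
  exact: k2.
- by move=> r' M' [_ [_ h]] i j hi hj; apply: h; rewrite visited_all hi hj.
Qed.
End Run.
End Seidel.

Definition seidel (q p : nat) (al be ga : nat -> nat -> int) : cmd :=
  CSeq (setup q p) (CSeq (position_loop q scatter_body) (CSeq ones
  (CSeq (squares q p al be ga) (CSeq start
  (CSeq (refine q p al be ga) (position_loop q gather_body)))))).

Definition seidel_cost (q p : nat) (al be ga : nat -> nat -> int) : nat :=
  (1000 + clen scatter_body + clen gather_body + emap_cost (region (EC 1)) (EC 1) + square_cost +
   start_cost + 3 * multiply_cost q p al be ga + copy_cost + parity_cost)%N.

Lemma seidel_cost_le n L lam N Z cs cg co sq st mc cp pc :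
  (0 < lam)%N -> (0 < Z)%N -> (0 < n)%N -> (L <= lam)%N -> (N <= Z)%N -> (n * n <= N)%N ->
  ((L * 100 + lam * 100 + 100) + ((n * (n * ((L * 72 + 60 + cs) + 13) + 10 + 13) + 10) + ((N * co + 10) +
   ((lam * ((19 + (Z * mc + (N * sq + 10))) + 13) + 10) + ((N * st + 10) +
   ((lam * ((22 + (Z * mc + ((N * cp + 10) + (4 + (Z * mc + (N * pc + 10)))))) + 13) + 10) +
   (n * (n * ((L * 72 + 60 + cg) + 13) + 10 + 13) + 10))))))
   <= lam * Z * (1000 + cs + cg + co + sq + st + 3 * mc + cp + pc))%N.
Proof.
move=> l0 z0 n0 hL hN hn.
have hZ : (Z <= lam * Z)%N by rewrite leq_pmull.
have hl : (lam <= lam * Z)%N by rewrite leq_pmulr.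
have hlN : (lam * N <= lam * Z)%N by rewrite leq_mul2l hN orbT.
have hnn : (n * n <= lam * Z)%N by apply: leq_trans hn (leq_trans hN hZ).
have hn1 : (n <= n * n)%N by rewrite leq_pmulr.
have hnL : (n * n * L <= lam * Z)%N by rewrite mulnC leq_mul // (leq_trans hn).
have hNP := leq_trans hN hZ.
have f1 : (n * n * cs <= lam * Z * cs)%N by rewrite leq_mul2r hnn orbT.
have f2 : (n * n * cg <= lam * Z * cg)%N by rewrite leq_mul2r hnn orbT.
have f3 : (N * co <= lam * Z * co)%N by rewrite leq_mul2r hNP orbT.
have f4 : (N * st <= lam * Z * st)%N by rewrite leq_mul2r hNP orbT.
have f5 : (lam * N * sq <= lam * Z * sq)%N by rewrite leq_mul2r hlN orbT.
have f6 : (lam * N * cp <= lam * Z * cp)%N by rewrite leq_mul2r hlN orbT.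
have f7 : (lam * N * pc <= lam * Z * pc)%N by rewrite leq_mul2r hlN orbT.
by clear hN hn; lia.
Qed.

Section Main.
Variables (q p : nat) (al be ga : nat -> nat -> int) (D : nat).
Hypothesis q1 : (1 < q)%N.
Hypothesis qp : (q * q < p)%N.
Hypothesis HB : bilinear_algorithm q p al be ga D%:Z.
Hypothesis D0 : (0 < D)%N.

(** The 3 lam p ^ L tensor calls are those of lam squarings and of 2 lam products in the
    refinements. *)
Lemma triple_seidel U s n L lam A (a : rel nat) r M :
  (0 < s)%N -> (0 < n)%N -> (0 < lam)%N -> (L <= lam)%N ->
  (forall j, (j < L)%N -> (side q s j < n)%N) -> (n <= side q s L)%N ->
  (forall j, (j < lam)%N -> (2 ^ j < n)%N) -> (n <= 2 ^ lam)%N ->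
  symmetric a -> irreflexive a ->
  (forall d x y, (x < n)%N -> (y < n)%N -> within n a d x y -> within n a (2 ^ lam) x y) ->
  (forall t, (t < p)%N -> (\sum_(c < q * q) `|al t c| <= A)%N) ->
  (forall t, (t < p)%N -> (\sum_(c < q * q) `|be t c| <= A)%N) ->
  (forall c, (c < q * q)%N -> (\sum_(t < p) `|ga c t| <= A)%N) -> (0 < A)%N ->
  (2 ^ lam.+2 + 2 <= U)%N -> (A ^ L * 2 ^ lam.+2 <= U)%N ->
  (A ^ L * (s * ((A ^ L * 2 ^ lam.+2) * (A ^ L * 2 ^ lam.+2))) <= U)%N ->
  ((5 + lam) * psize p s L + (3 * L + 1) * psize p s L <= U)%N ->
  r 0%N = n%:Z -> r 1%N = s%:Z ->
  (forall i j, (i < n)%N -> (j < n)%N -> M (i * n + j)%N = (a i j : nat)%:Z) ->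
  (forall y, (n * n <= y)%N -> M y = 0) ->
  triple U s (seidel q p al be ga) r M (lam * psize p s L * seidel_cost q p al be ga) (3 * lam * p ^ L)
    (fun r' M' => forall i j, (i < n)%N -> (j < n)%N ->
       M' (i * n + j)%N = (ceil_dist n lam a 0 i j)%:Z + reach_mat n a lam i j - 1).
Proof.
move=> s0 n0 lam0 hLlam hL1 hL2 hl1 hl2 asym airr hwithin hal hbe hga A0 BU encU decU workU r0 r1 hM hM0.
have q0 : (0 < q)%N by exact: ltnW.
have p0 : (0 < p)%N by exact: leq_ltn_trans qp.
have NZ : (msize q s L <= psize p s L)%N by rewrite leq_mul2r leq_expn2 ?orbT // ltnW.
have Z0 : (0 < psize p s L)%N by exact: psize_gt0.
have nnN : (n * n <= msize q s L)%N by rewrite msize_side leq_mul.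
have wU : ((5 + lam) * psize p s L <= U)%N by apply: leq_trans workU; rewrite leq_addr.
have ZU : (psize p s L <= U)%N by apply: leq_trans wU; rewrite leq_pmull.
have sU : (side q s L <= U)%N.
  by apply: leq_trans ZU; apply: leq_trans NZ; rewrite msize_side leq_pmulr // side_gt0.
have l2U : (2 ^ lam <= U)%N.
  apply: leq_trans BU; apply: leq_trans (leq_addr _ _); rewrite leq_pexp2l //; lia.
have cost := @seidel_cost_le n L lam (msize q s L) (psize p s L) (clen scatter_body) (clen gather_body)
  (emap_cost (region (EC 1)) (EC 1)) square_cost start_cost (multiply_cost q p al be ga) copy_cost
  parity_cost lam0 Z0 n0 hLlam NZ nnN.
apply: (@triple_le _ _ _ _ _ _ _ _ _ (0 + (0 + (0 + (lam * p ^ L + (0 + (lam * (p ^ L + p ^ L) + 0)))))) _ _ cost);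
  last by move=> r' M' h; exact: h.
  2: by rewrite !addn0 !add0n mulnDr -mulnA; lia.
apply: triple_seq.
apply: (triple_le (triple_setup q1 qp s0 r0 r1 hL1 hL2 hl1 hl2 sU l2U wU)) => // r2 M2 [hp2 ->].
apply: triple_seq.
apply: (triple_le (triple_scatter q1 qp D0 s0 hL2 airr A0 BU encU decU workU hp2 hM hM0)) => // r3 M3 [ag3 hI3 hR3].
have hp3 : params q p n s L lam r3 by apply: (params_agree q1 qp) ag3 hp2.
apply: triple_seq.
have [_ _ [_ r35] [r36 _] _] := hp3.
apply: (triple_le (triple_emap (N := msize q s L) (b := 1 * psize p s L) (g := fun=> 1) s r35 _ _)) => //.
- move=> x r4 M4 hx ag4 rx hM4; rewrite /= ag4 // r36 mul1r mul1n //.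
- by move=> x hx; apply: leq_trans BU; rewrite addnC.
move=> r4 M4 [ag4 hM4].
have hp4 : params q p n s L lam r4 by apply: (params_agree q1 qp) ag4 hp3.
have hJ4 : mat q p s L M4 1 (fun _ _ => 1) 1 by apply: (mat_blit_same q1 s0 hM4).
have hI4 : mat q p s L M4 2 (fun i j => - identity_mat n i j) 1 by apply: (mat_blit q1 qp s0 hM4).
have hR4 : mat q p s L M4 3 (reach_mat n a 0) 2 by apply: (mat_blit q1 qp s0 hM4).
apply: triple_seq.
apply: (triple_le (triple_squares q1 qp HB D0 s0 hL2 hal hbe hga A0 BU encU decU workU hp4 hR4)) => // r5 M5 [ag5 hR5 keep5].
have hp5 : params q p n s L lam r5 by apply: (params_agree q1 qp) ag5 hp4.
apply: triple_seq.
have hI5 := keep5 2%N _ _ isT hI4; have hJ5 := keep5 1%N _ _ isT hJ4.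
apply: (triple_le (triple_start q1 qp s0 BU hp5 hI5 (hR5 lam (leqnn lam)))) => // r6 M6 [ag6 hT6 keep6].
have hp6 : params q p n s L lam r6 by apply: (params_agree q1 qp) ag6 hp5.
apply: triple_seq.
apply: (triple_le (triple_refine q1 qp HB D0 s0 hL2 asym hwithin hal hbe hga A0 BU encU decU workU hp6 _ hT6 _)) => //.
- exact: keep6.
- by move=> k hk; apply: keep6 => //; apply: hR5.
move=> r7 M7 [ag7 hT7 hR7].
have hp7 : params q p n s L lam r7 by apply: (params_agree q1 qp) ag7 hp6.
exact: (triple_le (triple_gather q1 qp D0 s0 hL2 A0 BU encU decU workU hp7 hT7 hR7)).
Qed.
End Main.

(** * Correctness, word length and running time *)

Section Graph.
Variables (n lam : nat) (e : rel 'I_n).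
Hypothesis n_le : (n <= 2 ^ lam)%N.

Definition nat_rel : rel nat := fun i j =>
  match (insub i : option 'I_n), (insub j : option 'I_n) with
  | Some x, Some y => e x y
  | _, _ => false
  end.

Lemma nat_relE (x y : 'I_n) : nat_rel x y = e x y.
Proof. by rewrite /nat_rel !valK. Qed.

Lemma nat_rel_sym : symmetric e -> symmetric nat_rel.
Proof. by move=> h i j; rewrite /nat_rel; case: insub => [x|]; case: insub => [y|]. Qed.

Lemma nat_rel_irr : irreflexive e -> irreflexive nat_rel.
Proof. by move=> h i; rewrite /nat_rel; case: insub. Qed.

Lemma within_path d (x y : 'I_n) : within n nat_rel d x y ->
  exists p, [/\ path e x p, last x p = y & (size p <= d)%N].
Proof.
elim: d y => [|d IH] y /=; first by move=> /eqP/val_inj <-; exists [::].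
case/orP => [/IH[p [h1 h2 h3]]|/hasP[w]]; first by exists p; split=> //; exact: leqW.
rewrite mem_iota /= add0n => hw; rewrite -[w]/(nat_of_ord (Ordinal hw)) nat_relE.
case/andP=> /IH[p [h1 h2 h3]] he; exists (rcons p y).
by rewrite rcons_path h1 h2 he last_rcons size_rcons.
Qed.

Lemma path_within (x : 'I_n) p : path e x p -> within n nat_rel (size p) x (last x p).
Proof.
elim/last_ind: p => [|p y IH] /=; first by [].
rewrite rcons_path last_rcons size_rcons => /andP[/IH h he] /=.
apply/orP; right; apply/hasP; exists (val (last x p)).
  by rewrite mem_iota add0n /=.
by rewrite h nat_relE.
Qed.

(** A path without repeated vertices has fewer than [n] edges. *)
Lemma connect_within (x y : 'I_n) : connect e x y -> within n nat_rel (2 ^ lam) x y.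
Proof.
case/connectP => p0 hp0 ->; case/shortenP: hp0 => p hp up _.
apply: within_leq (path_within hp); apply: leq_trans n_le.
have := max_card (mem (x :: p)); rewrite (card_uniqP up) card_ord /=.
exact: leq_trans (leqnSn _).
Qed.

Lemma within_connect d (x y : 'I_n) : within n nat_rel d x y -> connect e x y.
Proof. by case/within_path => p [h1 h2 _]; apply/connectP; exists p. Qed.

Lemma within_diameter d x y : (x < n)%N -> (y < n)%N -> within n nat_rel d x y ->
  within n nat_rel (2 ^ lam) x y.
Proof.
move=> hx hy; rewrite -[x]/(nat_of_ord (Ordinal hx)) -[y]/(nat_of_ord (Ordinal hy)).
by move/within_connect/connect_within.
Qed.

Lemma distance_word (x y : 'I_n) : is_distance_word e x y
  ((ceil_dist n lam nat_rel 0 x y)%:Z + reach_mat n nat_rel lam x y - 1).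
Proof.
rewrite /is_distance_word /reach_mat !ltn_ord /=; case: ifP => hc; last first.
  have hw : within n nat_rel (2 ^ lam) x y = false.
    by apply: contraFF hc; apply: within_connect.
  by rewrite hw ceil_dist_out // hw !ltn_ord.
have hw := connect_within hc; rewrite hw.
have [h1 h2] := ceil_distP 0 (ltn_ord x) (ltn_ord y) hw.
exists (ceil_dist n lam nat_rel 0 x y); last by rewrite addrK.
move: h1 h2; set d := ceil_dist _ _ _ _ _ _; rewrite expn0 muln1 => h1 h2.
have hmin p : path e x p -> last x p = y -> (d <= size p)%N.
  by move=> hp hl; apply: h2; rewrite muln1 -hl; apply: path_within.
split=> //; have [p [k1 k2 k3]] := within_path h1; exists p; split=> //.
by apply/eqP; rewrite eqn_leq k3 hmin.
Qed.

Lemma adjacency_memoryE (x y : nat) : (x < n)%N -> (y < n)%N ->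
  adjacency_memory e (x * n + y) = (nat_rel x y : nat)%:Z.
Proof.
move=> hx hy; rewrite /adjacency_memory (bigD1 (Ordinal hx)) //= (big_pred1 (Ordinal hy)).
  rewrite big1 ?addr0 => [|i ne_i]; last first.
    rewrite big_pred0 // => j; rewrite eq_mulnD //.
    by rewrite -(inj_eq val_inj) /= in ne_i; rewrite (negbTE ne_i).
  by rewrite -nat_relE.
by move=> j; rewrite eq_mulnD // eqxx /= -(inj_eq val_inj).
Qed.

Lemma adjacency_memory0 y : (n * n <= y)%N -> adjacency_memory e y = 0.
Proof.
move=> hy; rewrite /adjacency_memory big1 // => i _; rewrite big_pred0 // => j.
by apply/negbTE; rewrite neq_ltn (leq_trans _ hy) // ltn_mulD.
Qed.
End Graph.

(** The final 1 is the cost of [IHalt]. *)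
Lemma reach_runs (R : realType) s W (ell : R) P c t k c' :
  reach s W P c t k c' -> fetch P c' = IHalt ->
  runs s W ell P c (t%:R + k%:R * ell + 1) c'.
Proof.
elim=> [c0 h|c0 c1 c2 t0 k0 hs _ IH /IH h].
  by rewrite mul0r !add0r; apply: runs_halt.
have -> : (tcost s P c0 + t0)%:R + (kcost P c0 + k0)%:R * ell + 1 =
    cost s ell P c0 + (t0%:R + k0%:R * ell + 1).
  rewrite /cost /tcost /kcost; case: (fetch P c0) => *; rewrite !natrD ?mulr0n; ring.
exact: runs_step hs h.
Qed.

(** * All numbers are polynomial in n *)

Section WordLength.
Variables (lam L p A s : nat).
Hypothesis lam0 : (0 < lam)%N.
Hypothesis hL : (L <= lam)%N.
Hypothesis hs : (s <= 2 ^ lam)%N.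

Definition small k x := (x <= 2 ^ (k * lam))%N.

Lemma small_le k k' x : (k <= k')%N -> small k x -> small k' x.
Proof. by move=> h /leq_trans; apply; rewrite leq_pexp2l // leq_mul2r h orbT. Qed.

Lemma small_mul k l x y : small k x -> small l y -> small (k + l) (x * y).
Proof. by move=> h1 h2; rewrite /small mulnDl expnD leq_mul. Qed.

Lemma small_const c : small c c.
Proof. by apply: leq_trans (ltnW (ltn_expl c (ltnSn 1))) _; rewrite leq_pexp2l // leq_pmulr. Qed.

(** c ^ L <= 2 ^ (c L) <= 2 ^ (c lam): the depth is at most logarithmic, so constants may be raised
    to it. *)
Lemma small_exp c : small c (c ^ L).
Proof.
apply: leq_trans (_ : ((2 ^ c) ^ L <= _)%N).
  by apply: leq_expn2; apply: ltnW; apply: ltn_expl.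
by rewrite -expnM leq_pexp2l // leq_mul2l hL orbT.
Qed.

Lemma small_add k x y : small k x -> small k y -> small k.+1 (x + y).
Proof.
rewrite /small => h1 h2; apply: leq_trans (leq_add h1 h2) _.
rewrite addnn -mul2n (mulSn k lam) expnD; apply: leq_mul => //.
by rewrite -{1}(expn1 2) leq_pexp2l.
Qed.

Lemma small_lam : small 1 lam.
Proof. by rewrite /small mul1n ltnW // ltn_expl. Qed.

Lemma small_size : small 1 s. Proof. by rewrite /small mul1n. Qed.

(** 3 A for the three factors A ^ L of a decoded entry, [p] for the p ^ L in the size of the arrays,
    20 for the rest. *)
Definition word_exponent : nat := (3 * A + p + 20)%N.

Lemma word_bounds : let U := (2 ^ (word_exponent * lam))%N in
  [/\ (2 ^ lam.+2 + 2 <= U)%N, (A ^ L * 2 ^ lam.+2 <= U)%N,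
   (A ^ L * (s * ((A ^ L * 2 ^ lam.+2) * (A ^ L * 2 ^ lam.+2))) <= U)%N &
   ((5 + lam) * psize p s L + (3 * L + 1) * psize p s L <= U)%N].
Proof.
have h2 : small 3 (2 ^ lam.+2) by rewrite /small leq_pexp2l //; lia.
have hA := small_exp A; have hp := small_exp p.
have hAB := small_mul hA h2.
have hZ : small (p + (1 + 1)) (psize p s L) := small_mul hp (small_mul small_size small_size).
split.
- apply: small_le (small_add h2 (small_le _ (small_const 2))) => //; rewrite /word_exponent; lia.
- by apply: small_le hAB; rewrite /word_exponent; lia.
- by apply: small_le (small_mul hA (small_mul small_size (small_mul hAB hAB))); rewrite /word_exponent; lia.
rewrite -mulnDl; have h4 : small (8 + 1) ((5 + lam) + (3 * L + 1)).
  apply: leq_trans (small_mul (small_le (_ : 4 <= 8)%N (leqnn _ : small 4 (2 ^ (4 * lam)))) small_lam) => //.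
  have : (2 ^ 4 <= 2 ^ (4 * lam))%N by rewrite leq_pexp2l // leq_pmulr.
  rewrite -[(2 ^ 4)%N]/16%N; move: (2 ^ (4 * lam))%N => X hX.
  apply: (@leq_trans (16 * lam)); [move: lam0 hL; clear; lia|by rewrite leq_mul2r hX orbT].
by apply: small_le (small_mul h4 hZ); rewrite /word_exponent; lia.
Qed.
End WordLength.

(** * The running time in terms of the exponent *)

Section Estimate.
Variable R : realType.

Lemma powR_strassen_exponent (n0 p0 : nat) : (1 < n0)%N -> (0 < p0)%N ->
  n0%:R `^ strassen_exponent R n0 p0 = p0%:R.
Proof.
move=> h1 h2; have hn0 : n0%:R != 0 :> R by rewrite pnatr_eq0 -lt0n ltnW.
have hl : ln n0%:R != 0 :> R by rewrite gt_eqF // ln_gt0 // ltr1n.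
by rewrite /powR (negbTE hn0) /strassen_exponent divfK // lnK // posrE ltr0n.
Qed.

Lemma strassen_exponent_ge0 (n0 p0 : nat) : (1 < n0)%N -> (0 < p0)%N ->
  0 <= strassen_exponent R n0 p0.
Proof. by move=> h1 h2; rewrite divr_ge0 // ln_ge0 // ler1n // ltnW. Qed.

Lemma expn_le_powR (n0 p0 k : nat) (x : R) : (1 < n0)%N -> (0 < p0)%N ->
  (n0 ^ k)%:R <= x -> (p0 ^ k)%:R <= x `^ strassen_exponent R n0 p0.
Proof.
move=> h1 h2 hx; have x0 : 0 <= x by apply: le_trans hx.
apply: (@le_trans _ _ ((n0 ^ k)%:R `^ strassen_exponent R n0 p0)).
  have -> : (n0 ^ k)%:R = n0%:R `^ k%:R :> R by rewrite natrX powR_mulrn ?ler0n.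
  rewrite -powRrM mulrC powRrM powR_strassen_exponent //.
  by rewrite powR_mulrn ?ler0n // natrX.
by apply: ge0_ler_powR; rewrite ?nnegrE ?strassen_exponent_ge0 ?ler0n.
Qed.

(** 2 ^ (lam - 1) < n bounds (lam - 1) ln 2 by ln n, and n >= 2 pays for the missing ln 2. *)
Lemma up_log_le_ln (n : nat) : (1 < n)%N -> (up_log 2 n)%:R * ln 2 <= 2 * ln n%:R :> R.
Proof.
move=> n1; have /andP[h _] := up_log_bounds (ltnSn 1) n1.
have l0 : (0 < up_log 2 n)%N by rewrite up_log_gt0.
have n0 : (0 < n)%N by exact: ltnW.
have h1 : (up_log 2 n).-1%:R * ln 2 <= ln n%:R :> R.
  by rewrite mulrC mulr_natr -lnXn // ler_ln ?posrE ?exprn_gt0 ?ltr0n // -natrX ler_nat ltnW.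
have h2 : ln 2 <= ln n%:R :> R by rewrite ler_ln ?posrE ?ltr0n // ler_nat.
by rewrite -(prednK l0) -natr1 mulrDl mul1r mulr2n mulrDl mul1r lerD.
Qed.

(** In the constant, [C] pays for the machine time, 3 for the latencies and 1 for halting; [p0] is
    lost in passing from L - 1 to L, and 2 / ln 2 converts [lam] to ln n. *)
Lemma time_estimate (n m n0 p0 L lam C t k : nat) (ell : R) :
  (1 < n0)%N -> (0 < p0)%N -> (1 < n)%N -> (0 < m)%N -> 0 <= ell ->
  (n0 ^ L.-1 * m <= n ^ 2)%N -> lam = up_log 2 n ->
  (t <= lam * (p0 ^ L * m) * C)%N -> (k <= 3 * lam * p0 ^ L)%N ->
  t%:R + k%:R * ell + 1 <= ((C + 4) * p0)%N%:R * (2 / ln 2) *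
    ((n ^ 2)%:R / m%:R) `^ strassen_exponent R n0 p0 * (m%:R + ell) * ln n%:R.
Proof.
move=> n01 p00 n1 m0 ell0 hL elam ht hk.
set P := _ `^ _.
have l0 : (0 < lam)%N by rewrite elam up_log_gt0.
have hP : (p0 ^ L)%:R <= p0%:R * P.
  apply: (@le_trans _ _ (p0%:R * (p0 ^ L.-1)%:R)).
    by rewrite -natrM ler_nat -expnS leq_pexp2l //; case: (L).
  rewrite ler_wpM2l ?ler0n //; apply: expn_le_powR => //.
  by rewrite ler_pdivlMr ?ltr0n // -natrM ler_nat.
have P0 : 0 <= P by apply: powR_ge0.
have ln20 : 0 < ln 2 :> R by rewrite ln_gt0 // ltr1n.
have hlam : lam%:R <= 2 / ln 2 * ln n%:R :> R.
  by rewrite mulrAC ler_pdivlMr // elam up_log_le_ln.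
have hm : 1 <= m%:R + ell by rewrite -[X in X <= _]addr0 lerD // ler1n.
have hme : 0 <= m%:R + ell by apply: le_trans hm.
apply: (@le_trans _ _ ((C + 4)%:R * (lam%:R * (p0 ^ L)%:R * (m%:R + ell)))).
  have hX : 1 <= lam%:R * (p0 ^ L)%:R :> R by rewrite -natrM ler1n muln_gt0 l0 expn_gt0 p00.
  have t1 : t%:R <= lam%:R * (p0 ^ L)%:R * m%:R * C%:R :> R by rewrite -!natrM ler_nat -(mulnA lam).
  have k1 : k%:R <= 3 * (lam%:R * (p0 ^ L)%:R) :> R by rewrite -!natrM ler_nat mulnA.
  have k2 : k%:R * ell <= 3 * (lam%:R * (p0 ^ L)%:R) * ell by rewrite ler_wpM2r.
  rewrite natrD; move: (lam%:R * (p0 ^ L)%:R) hX t1 k2 => X hX t1 k2.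
  have C0 : 0 <= C%:R :> R by rewrite ler0n.
  have m1 : 1 <= m%:R :> R by rewrite ler1n.
  have Xm : 1 <= X * m%:R by rewrite -[X in X <= _]mulr1 ler_pM.
  have XCl : 0 <= C%:R * (X * ell) by rewrite !mulr_ge0 // (le_trans ler01).
  have Xl : 0 <= X * ell by rewrite mulr_ge0 // (le_trans ler01).
  lra.
rewrite natrM; set D := 2 / ln 2 in hlam *.
have D0 : 0 <= D by rewrite divr_ge0 // ltW.
have -> : (C + 4)%:R * p0%:R * D * P * (m%:R + ell) * ln n%:R =
  (C + 4)%:R * ((D * ln n%:R) * (p0%:R * P) * (m%:R + ell)) by ring.
rewrite ler_wpM2l ?ler0n // ler_wpM2r // ler_pM ?ler0n //.
Qed.
End Estimate.

(** Minimality of [L] keeps the padding within the bound: q ^ (L - 1) s < n. *)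
Lemma ex_level q s n : (1 < q)%N -> (0 < s)%N -> exists L : nat,
  (forall j, (j < L)%N -> (side q s j < n)%N) /\ (n <= side q s L)%N.
Proof.
move=> q1 s0; have h : exists j, (n <= side q s j)%N.
  by exists n; apply: leq_trans (ltnW (ltn_expl n q1)) _; rewrite leq_pmulr.
case: (ex_minnP h) => L hL hmin; exists L; split=> // j hj.
by rewrite ltnNge; apply/negP => /hmin; rewrite leqNgt hj.
Qed.

Lemma sum_le_pred (F : nat -> nat -> nat) a b t : (t < a)%N ->
  (\sum_(c < b) F t c <= \sum_(t < a) \sum_(c < b) F t c)%N.
Proof. by move=> ht; rewrite (bigD1 (Ordinal ht)) //= leq_addr. Qed.

Lemma nth_halt c : nth IHalt (ccode 0 c ++ [:: IHalt]) (0 + clen c) = IHalt.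
Proof. by rewrite add0n nth_cat size_ccode ltnn subnn. Qed.

Theorem theorem6 (R : realType) (kappa n0 p0 q : nat) (B : base_algorithm q)
    (hn0 : (1 < n0)%N) (hB : strassen_like kappa n0 p0 B) :
  exists (P : program) (w : nat) (K : R),
    forall (m s : nat) (ell : R) (n : nat) (e : rel 'I_n),
      m = (s ^ 2)%N -> (n0 <= m)%N -> 0 <= ell ->
      (2 <= n)%N -> (m <= n ^ 2)%N -> simple_graph e ->
      exists (T : R) (c : config),
        [/\ runs s (w * up_log 2 n) ell P (initial_config s e) T c,
            distance_memory e (memory c)
          & T <= K * ((n ^ 2)%:R / m%:R) `^ strassen_exponent R n0 p0
                   * (m%:R + ell) * ln n%:R].
Proof.
have [en0 q1 n0p0 [D [al [be [ga [D0 HB]]]]]] := strassen_like_bilinear hn0 hB.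
rewrite en0 in n0p0.
pose SA (f : nat -> nat -> int) a b := (\sum_(t < a) \sum_(c < b) `|f t c|)%N.
(* The sum of the absolute values of all coefficients bounds every row sum; the 1 makes it
   positive. *)
pose A := (SA al p0 (q * q)%N + SA be p0 (q * q)%N + SA ga (q * q)%N p0 + 1)%N.
pose prog := seidel q p0 al be ga.
pose C := seidel_cost q p0 al be ga.
pose u := word_exponent p0 A.
(* With U = 2 ^ (u lam), a word must exceed U ^ csize = 2 ^ (u csize lam); the added 1 makes the
   inequality strict, as lam > 0. *)
exists (ccode 0 prog ++ [:: IHalt]), (u * csize prog + 1)%N, (((C + 4) * p0)%N%:R * (2 / ln 2)).
move=> m s ell n e em hm ell0 n2 hmn [esym eirr].
set lam := up_log 2 n.
have p00 : (0 < p0)%N by exact: leq_ltn_trans n0p0.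
have m0 : (0 < m)%N by apply: leq_trans hm; exact: ltnW.
have s0 : (0 < s)%N by move: m0; rewrite em expn_gt0 orbF.
have sn : (s <= n)%N by move: hmn; rewrite em leq_exp2r.
have n0' : (0 < n)%N by exact: ltnW.
have lam0 : (0 < lam)%N by rewrite up_log_gt0.
have /andP[hlam1 hlam2] : (2 ^ lam.-1 < n <= 2 ^ lam)%N := up_log_bounds (ltnSn 1) n2.
have hl1 j : (j < lam)%N -> (2 ^ j < n)%N.
  by move=> hj; apply: leq_ltn_trans hlam1; rewrite leq_pexp2l // -ltnS prednK.
have [L [hL1 hL2]] := ex_level n q1 s0.
(* Otherwise minimality gives q ^ lam s < n, but q >= 2 and n <= 2 ^ lam. *)
have hLlam : (L <= lam)%N.
  rewrite leqNgt; apply/negP => /hL1; rewrite ltnNge => /negP; apply.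
  apply: leq_trans hlam2 _; apply: leq_trans (leq_pmulr _ s0).
  exact: leq_expn2.
have [BU encU decU workU] := @word_bounds lam L p0 A s lam0 hLlam (leq_trans sn hlam2).
set U := (2 ^ (word_exponent p0 A * lam))%N in BU encU decU workU.
have A0 : (0 < A)%N by rewrite /A addn1.
have hal t : (t < p0)%N -> (\sum_(c < q * q) `|al t c| <= A)%N.
  by move=> /(sum_le_pred (fun t c => `|al t c|%N) (q * q)) /leq_trans; apply; rewrite /A -!addnA leq_addr.
have hbe t : (t < p0)%N -> (\sum_(c < q * q) `|be t c| <= A)%N.
  move=> /(sum_le_pred (fun t c => `|be t c|%N) (q * q)) /leq_trans; apply.
  by rewrite /A -addnA addnAC leq_addl.
have hga c : (c < q * q)%N -> (\sum_(t < p0) `|ga c t| <= A)%N.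
  move=> /(sum_le_pred (fun c t => `|ga c t|%N) p0) /leq_trans; apply.
  by rewrite /A addnAC leq_addl.
pose r0 x : int := if x == 0%N then n%:Z else if x == 1%N then s%:Z else 0.
have H := triple_seidel q1 n0p0 HB D0 (U := U) (r := r0) (M := adjacency_memory e)
  s0 n0' lam0 hLlam hL1 hL2 hl1 hlam2 (nat_rel_sym esym) (nat_rel_irr eirr)
  (fun d x y => @within_diameter n lam e hlam2 d x y) hal hbe hga A0 BU encU decU workU
  (erefl _) (erefl _) (@adjacency_memoryE n e) (@adjacency_memory0 n e).
have lamU : (2 ^ lam <= U)%N by rewrite leq_pexp2l // leq_pmull // /word_exponent; lia.
have U1 : (1 < U)%N by apply: leq_trans lamU; apply: leq_trans (_ : 2 ^ 1 <= _)%N; rewrite ?leq_pexp2l.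
have [|||||R' [M' [r' [t [k [hreach [ht hk] _ _ hpost]]]]]] :=
  H ((u * csize prog + 1) * lam)%N (ccode 0 prog ++ [:: IHalt]) 0%N (regs (initial_config s e)) U1.
- by rewrite -expnM ltn_exp2l // -/u mulnAC mulnDl mul1n -addn1 leq_add2l.
- by move=> i hi; rewrite add0n nth_cat hi.
- move=> x; rewrite /= /upd /vreg /r0; do 2 (case: x => [|x] //).
- move=> x; rewrite /r0; case: eqP => _; first exact: leq_trans hlam2 lamU.
  by case: eqP => _ //; exact: leq_trans (leq_trans sn hlam2) lamU.
- move=> y; have [hy|hy] := ltnP y (n * n)%N; last by rewrite adjacency_memory0.
  rewrite (divn_eq y n) adjacency_memoryE ?ltn_mod ?ltn_divLR //.
  by case: (nat_rel _ _ _); rewrite ?(ltnW U1).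
exists (t%:R + k%:R * ell + 1), (Config (0 + clen prog) R' M').
split.
- by apply: reach_runs hreach _; apply: nth_halt.
- by move=> i j; rewrite /= hpost //; apply: distance_word.
rewrite en0; apply: (time_estimate (L := L) (lam := lam)) => //.
- by rewrite -en0.
(* For L = 0 this is m <= n ^ 2; otherwise it is the square of q ^ (L - 1) s < n. *)
- rewrite em -!mulnn; case: L hL1 {hL2 hLlam encU decU workU H hreach ht hk} => [|L] hL1 /=.
    by rewrite expn0 mul1n leq_mul.
  by rewrite -/(msize q s L) msize_side leq_mul // ltnW // hL1.
- move: ht; rewrite /psize -/C em -mulnn //.
Qed.
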